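(* Let $G$ be a topological group. The following assertions hold. (i) Two normal topological dynamical systems $(K_1,\varphi_1)$ and $(K_2,\varphi_2)$ (with acting group $G$) are isomorphic if and only if $\sigma_{\mathrm{p}}(K_1,\varphi_1)=\sigma_{\mathrm{p}}(K_2,\varphi_2)$. (ii) For every grouplike subset $\sigma\subset\hat{G}$ there is a normal topological dynamical system $(K,\varphi)$ such that $\sigma_{\mathrm{p}}(K,\varphi)=\sigma$. (iii) For every normal topological dynamical system $(K,\varphi)$ there is a group compactification $(H,c)$ of $G$ such that $(K,\varphi)$ is isomorphic to the rotation $(H,\varphi_c)$.
   Context: Compact spaces are Hausdorff; vector spaces are complex. **Dual and grouplike subsets.** A finite-dimensional representation of $G$ is a bounded continuous group representation $\pi\colon G\to\mathscr{L}(E_\pi)$ on a finite-dimensional vector space; it is irreducible if $E_\pi\ne\{0\}$ and $\{0\},E_\pi$ are the only invariant subspaces. $\hat{G}$ is the set of isomorphism classes $[\pi]$ of irreducible finite-dimensional representations, $\dim([\pi])=\dim E_\pi$. The conjugate $\overline{\pi}$ is $\pi$ acting on the complex conjugate vector space $\overline{E_\pi}$. $[\pi]\otimes[\varrho]\subset\hat{G}$ is the set of all $[\tau]$ with $\tau$ irreducible and isomorphic to a subrepresentation of $\pi\otimes\varrho$. A subset $\sigma\subset\hat{G}$ is grouplike if $[\pi]\otimes[\varrho]\subset\sigma$ and $[\overline{\pi}]\in\sigma$ for all $[\pi],[\varrho]\in\sigma$, and $\sigma$ contains the class $[\mathbb{1}]$ of the trivial one-dimensional representation. **Systems.** A topological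 dynamical system $(K,\varphi)$ is a compact space $K$ with a continuous action $\varphi\colon G\times K\to K$, $(t,x)\mapsto\varphi_t(x)$. Two systems $(K,\varphi)$, $(L,\psi)$ are isomorphic if there is a homeomorphism $q\colon K\to L$ with $q\circ\varphi_t=\psi_t\circ q$ for all $t\in G$. The Koopman representation is $T^\varphi_tf=f\circ\varphi_{t^{-1}}$ on $\mathrm{C}(K)$. For $[\pi]\in\hat{G}$, $\mathrm{mult}(K,\varphi;[\pi])=\sup\{n\in\mathbb{N}_0\mid\bigoplus_{k=1}^n\pi\text{ is isomorphic to a subrepresentation of }T^\varphi\}$, and the point spectrum is $\sigma_{\mathrm{p}}(K,\varphi)=\{[\pi]\in\hat{G}\mid\mathrm{mult}(K,\varphi;[\pi])>0\}$. The system is normal if it has discrete spectrum (the union of all finite-dimensional $T^\varphi$-invariant subspaces is dense in $\mathrm{C}(K)$), $\sigma_{\mathrm{p}}(K,\varphi)$ is grouplike, and $\mathrm{mult}(K,\varphi;[\pi])\in\{0,\dim([\pi])\}$ for every $[\pi]\in\hat{G}$. A group compactification of $G$ is a pair $(H,c)$ of a compact group $H$ and a continuous group homomorphism $c\colon G\to H$ with dense range. The associated rotation is the system $(H,\varphi_c)$ with $(\varphi_c)_t(x)=c(t)x$. *)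

(* Defs.v *)
From HB Require Import structures.
From mathcomp Require Import all_boot all_order all_algebra.
From mathcomp Require Import complex mxtens.
From mathcomp Require Import all_classical all_reals all_analysis.

Set Implicit Arguments.
Unset Strict Implicit.
Unset Printing Implicit Defensive.

Import Order.TTheory GRing.Theory Num.Theory.
Import numFieldNormedType.Exports.

Local Open Scope classical_set_scope.
Local Open Scope ring_scope.

HB.mixin Record isTopologicalGroup G of Group G & Topological G := {
  mulg_continuous : continuous (fun xy : G * G => (xy.1 * xy.2)%g);
  invg_continuous : continuous (fun x : G => x^-1%g)
}.

#[short(type="topologicalGroupType")]
HB.structure Definition TopologicalGroup :=
  {G of isTopologicalGroup G & Group G & Topological G}.

(* The complex numbers over R.  The alias hides the R-module structure that
   the library puts on R[i]: all vector spaces below are over Cplx R, whose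
   topology is the one induced by the modulus. *)
Definition Cplx (R : realType) : numClosedFieldType := R[i].

Section LinearActions.
Context {R : realType} {G : Type}.
Local Notation C := (Cplx R).

Definition linsubspace (E : lmodType C) (W : set E) : Prop :=
  GRing.submod_closed [in W].

Definition findim (E : lmodType C) (W : set E) : Prop :=
  exists (n : nat) (b : 'I_n -> E),
    W = [set \sum_i a i *: b i | a in [set: 'I_n -> C]].

Definition stable_under (E : lmodType C) (S : G -> E -> E) (W : set E) : Prop :=
  forall t v, W v -> W (S t v).

(* S, acting on E, is isomorphic to a subrepresentation of the restriction
   of T to the T-invariant subspace V of F. *)
Definition isom_to_subrep (E F : lmodType C) (S : G -> E -> E)
    (V : set F) (T : G -> F -> F) : Prop :=
  exists W : set F, [/\ W `<=` V, linsubspace W, stable_under T W &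
    exists J : {linear E -> F},
      [/\ injective J, range J = W & forall t v, J (S t v) = T t (J v)]].

End LinearActions.

Section Representations.
Context {R : realType} {G : topologicalGroupType}.
Local Notation C := (Cplx R).

(* Bounded continuous representations on C^rep_dim (column vectors).  As only
   isomorphism classes matter, these stand for all finite-dimensional
   representations; operators are matrices, with their usual norm topology. *)
Record fdrep := FdRep {
  rep_dim : nat;
  rep :> G -> 'M[C]_rep_dim;
  rep1 : rep 1%g = 1%:M;
  repM : forall s t, rep (s * t)%g = rep s *m rep t;
  rep_continuous : continuous rep;
  rep_bounded : [bounded rep t | t in [set: G]]
}.

Definition fdact (pi : fdrep) (t : G) (v : 'cV[C]_(rep_dim pi)) :
  'cV[C]_(rep_dim pi) := pi t *m v.

Definition irreducible (pi : fdrep) : Prop :=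
  (0 < rep_dim pi)%N /\
  forall W : set 'cV[C]_(rep_dim pi),
    linsubspace W -> stable_under (@fdact pi) W -> W = [set 0] \/ W = setT.

Definition isomorphic (pi rho : fdrep) : Prop :=
  exists J : {linear 'cV[C]_(rep_dim pi) -> 'cV[C]_(rep_dim rho)},
    bijective J /\ forall t v, J (fdact t v) = fdact t (J v).

Definition rclass (pi : fdrep) : set fdrep := [set rho | isomorphic pi rho].

Definition group_dual : set (set fdrep) := rclass @` irreducible.

(* The n-fold direct sum of copies of pi. *)
Definition dsum (n : nat) (pi : fdrep) (t : G)
    (v : {ffun 'I_n -> 'cV[C]_(rep_dim pi)}) :
  {ffun 'I_n -> 'cV[C]_(rep_dim pi)} := [ffun k => fdact t (v k)].

Lemma mx_norm_ltP m n (A : 'M[C]_(m, n)) (e : C) :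
  `|A| < e <-> 0 < e /\ forall i j, `|A i j| < e.
Proof.
have eqA : `|A| < e = ball (0 : 'M[C]_(m, n)) e (- A) :> Prop.
  by rewrite mx_norm_ball /ball_ /= opprK add0r.
rewrite eqA; split=> -[e0 Ae]; split=> // i j.
  by have := Ae i j; rewrite -ball_normE /ball_ /= !mxE opprK add0r.
by rewrite -ball_normE /ball_ /= !mxE opprK add0r.
Qed.

Lemma continuous_mxP (T : topologicalType) m n (f : T -> 'M[C]_(m, n)) :
  continuous f <-> forall i j, continuous (fun t => f t i j).
Proof.
split=> [fc i j t|fc t]; apply/cvgrPdist_lt => e e0.
  have /cvgrPdist_lt/(_ e e0) := fc t.
  by apply: filterS => s /mx_norm_ltP[_ /(_ i j)]; rewrite !mxE.
have near1 ij : \forall s \near t, `|f t ij.1 ij.2 - f s ij.1 ij.2| < e.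
  by have /cvgrPdist_lt/(_ e e0) := fc ij.1 ij.2 t.
have : \forall s \near t, forall ij : 'I_m * 'I_n,
    `|f t ij.1 ij.2 - f s ij.1 ij.2| < e by exact: filter_forall.
apply: filterS => s fs; apply/mx_norm_ltP; split=> // i j.
by rewrite !mxE; exact: (fs (i, j)).
Qed.

Lemma bounded_mxP (T : Type) m n (f : T -> 'M[C]_(m, n)) :
  [bounded f t | t in [set: T]] <->
  exists2 M : C, 0 < M & forall t i j, `|f t i j| < M.
Proof.
split=> [[M [Mr fM]]|[M M0 fM]].
  have M1 : M < `|M| + 1 by rewrite (le_lt_trans (real_ler_norm Mr)) // ltrDl.
  have {}fM t : `|f t| < `|M| + 1 + 1.
    by rewrite (le_lt_trans (fM _ M1 t I)) // ltrDl.
  exists (`|M| + 1 + 1) => [|t i j]; first by rewrite ltr_pwDr // addr_ge0.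
  by have /mx_norm_ltP[_] := fM t; exact.
exists M; split=> [|x Mx t _]; first exact: gtr0_real.
rewrite /= ltW // (lt_trans _ Mx) //; apply/mx_norm_ltP.
by split=> // i j; exact: fM.
Qed.

Definition triv_mx (t : G) : 'M[C]_1 := 1%:M.

Lemma triv_mxM s t : triv_mx (s * t)%g = triv_mx s *m triv_mx t.
Proof. by rewrite mul1mx. Qed.

Lemma triv_mx_continuous : continuous triv_mx.
Proof. exact: cst_continuous. Qed.

Lemma triv_mx_bounded : [bounded triv_mx t | t in [set: G]].
Proof. exact: bounded_cst. Qed.

Definition triv_rep : fdrep :=
  FdRep (erefl : triv_mx 1%g = 1%:M) triv_mxM triv_mx_continuous
    triv_mx_bounded.

Section Conjugate.
Variable pi : fdrep.

(* In the basis of the conjugate vector space given by the standard basis, an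
   operator has the entrywise conjugate matrix. *)
Definition conj_mx (t : G) : 'M[C]_(rep_dim pi) := map_mx Num.conj (pi t).

Lemma conj_mx1 : conj_mx 1%g = 1%:M.
Proof. by rewrite /conj_mx rep1 map_mx1. Qed.

Lemma conj_mxM s t : conj_mx (s * t)%g = conj_mx s *m conj_mx t.
Proof. by rewrite /conj_mx repM map_mxM. Qed.

Lemma conj_mx_continuous : continuous conj_mx.
Proof.
apply/continuous_mxP => i j t; apply/cvgrPdist_lt => e e0.
have /continuous_mxP/(_ i j t)/cvgrPdist_lt/(_ e e0) := @rep_continuous pi.
by apply: filterS => s; rewrite !mxE -rmorphB norm_conjC.
Qed.

Lemma conj_mx_bounded : [bounded conj_mx t | t in [set: G]].
Proof.
apply/bounded_mxP; have /bounded_mxP[M M0 piM] := @rep_bounded pi.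
by exists M => // t i j; rewrite mxE norm_conjC.
Qed.

Definition conj_rep : fdrep :=
  FdRep conj_mx1 conj_mxM conj_mx_continuous conj_mx_bounded.

End Conjugate.

Section Tensor.
Variables pi rho : fdrep.

Definition tens_mx (t : G) : 'M[C]_(rep_dim pi * rep_dim rho) :=
  tensmx (pi t) (rho t).

Lemma tens_mx1 : tens_mx 1%g = 1%:M.
Proof.
rewrite /tens_mx !rep1; apply/matrixP => k l.
case: (mxtens_indexP k) => i j; case: (mxtens_indexP l) => i' j'.
rewrite tensmxE !mxE (can_eq (@mxtens_indexK _ _)) xpair_eqE.
by case: eqP; case: eqP; rewrite ?mulr1 ?mulr0.
Qed.

Lemma tens_mxM s t : tens_mx (s * t)%g = tens_mx s *m tens_mx t.
Proof. by rewrite /tens_mx !repM tensmx_mul. Qed.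

Lemma tens_mx_continuous : continuous tens_mx.
Proof.
apply/continuous_mxP => k l t.
have /continuous_mxP piC := @rep_continuous pi.
have /continuous_mxP rhoC := @rep_continuous rho.
rewrite (_ : (fun t => _) = fun t =>
    pi t (mxtens_unindex k).1 (mxtens_unindex l).1 *
    rho t (mxtens_unindex k).2 (mxtens_unindex l).2).
  by apply: cvgM; [exact: piC|exact: rhoC].
by apply/funext => s; rewrite mxE.
Qed.

Lemma tens_mx_bounded : [bounded tens_mx t | t in [set: G]].
Proof.
apply/bounded_mxP.
have /bounded_mxP[M M0 piM] := @rep_bounded pi.
have /bounded_mxP[N N0 rhoN] := @rep_bounded rho.
exists (M * N) => [|t k l]; first exact: mulr_gt0.
by rewrite mxE normrM ltr_pM.
Qed.

Definition tens_rep : fdrep :=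
  FdRep tens_mx1 tens_mxM tens_mx_continuous tens_mx_bounded.

End Tensor.

(* The set [pi] (x) [rho] of classes. *)
Definition tens_classes (pi rho : fdrep) : set (set fdrep) :=
  rclass @` [set tau | irreducible tau /\
    isom_to_subrep (@fdact tau) setT (@fdact (tens_rep pi rho))].

Definition grouplike (sigma : set (set fdrep)) : Prop :=
  [/\ sigma `<=` group_dual,
      forall pi rho, sigma (rclass pi) -> sigma (rclass rho) ->
        tens_classes pi rho `<=` sigma,
      forall pi, sigma (rclass pi) -> sigma (rclass (conj_rep pi)) &
      sigma (rclass triv_rep)].

End Representations.

Arguments fdrep : clear implicits.
Arguments group_dual : clear implicits.

Record tds (G : topologicalGroupType) := Tds {
  phase :> topologicalType;
  tds_act : G -> phase -> phase;
  phase_compact : compact [set: phase];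
  phase_hausdorff : hausdorff_space phase;
  tds_act_continuous : continuous (fun tx : G * phase => tds_act tx.1 tx.2);
  tds_act1 : forall x, tds_act 1%g x = x;
  tds_actM : forall s t x, tds_act (s * t)%g x = tds_act s (tds_act t x)
}.

Definition tds_isom (G : topologicalGroupType) (X Y : tds G) : Prop :=
  exists (q : X -> Y) (r : Y -> X),
    [/\ cancel q r, cancel r q, continuous q, continuous r &
        forall t x, q (tds_act t x) = tds_act t (q x)].

Section PointSpectrum.
Context {R : realType} {G : topologicalGroupType}.
Local Notation C := (Cplx R).
Variable X : tds G.

(* C(X), as a subspace of the space of all functions from X to C. *)
Definition ctsfun : set (X -> C) := [set f | continuous f].

(* The Koopman representation is the restriction of this action to ctsfun,
   which is invariant. *)
Definition koopman (t : G) (f : X -> C) : X -> C :=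
  fun x => f (tds_act t^-1%g x).

Lemma koopman_ctsfun : stable_under koopman ctsfun.
Proof.
move=> t f fc x; apply: (continuous_comp _ (fc _)).
have h : {for x, continuous (fun y : X => (t^-1%g, y))}.
  by apply: cvg_pair; [exact: cvg_cst|exact: cvg_id].
exact: (continuous_comp h (@tds_act_continuous _ X _)).
Qed.

Definition multiplicity (pi : fdrep R G) : \bar R :=
  ereal_sup [set n%:R%:E | n in
    [set n : nat | isom_to_subrep (@dsum R G n pi) ctsfun koopman]].

Definition point_spectrum : set (set (fdrep R G)) :=
  rclass @` [set pi | irreducible pi /\ (0 < multiplicity pi)%E].

(* Density in C(X) is with respect to uniform convergence. *)
Definition discrete_spectrum : Prop :=
  ctsfun `<=`
  closure (\bigcup_(W in [set W : set (X -> C) |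
      [/\ W `<=` ctsfun, linsubspace W, findim W & stable_under koopman W]]) W
    : set {uniform X -> C}).

Definition normal_tds : Prop :=
  [/\ discrete_spectrum, grouplike point_spectrum &
      forall pi : fdrep R G, irreducible pi ->
        multiplicity pi = 0%E \/ multiplicity pi = (rep_dim pi)%:R%:E].

End PointSpectrum.

Arguments multiplicity {R G} X pi.
Arguments point_spectrum R {G} X.
Arguments normal_tds R {G} X.

Record group_compactification (G : topologicalGroupType) := GroupCompact {
  gcgroup :> topologicalGroupType;
  gcmap : G -> gcgroup;
  gc_compact : compact [set: gcgroup];
  gc_hausdorff : hausdorff_space gcgroup;
  gcmap_morphism : monoid.monoid_morphism gcmap;
  gcmap_continuous : continuous gcmap;
  gcmap_dense : dense (range gcmap)
}.

Section Rotation.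
Context {G : topologicalGroupType}.
Variable H : group_compactification G.

Definition rotate (t : G) (x : H) : H := (gcmap H t * x)%g.

Lemma rotate_continuous : continuous (fun tx : G * H => rotate tx.1 tx.2).
Proof.
move=> [t x] /=.
have h : {for (t, x), continuous (fun tx : G * H => (gcmap H tx.1, tx.2))}.
  apply: cvg_pair; last exact: cvg_snd.
  apply: (@continuous_comp _ _ _ fst (gcmap H)); first exact: cvg_fst.
  exact: gcmap_continuous.
exact: (continuous_comp h (@mulg_continuous H _)).
Qed.

Lemma rotate1 x : rotate 1%g x = x.
Proof. by rewrite /rotate (gcmap_morphism H).1 mul1g. Qed.

Lemma rotateM s t x : rotate (s * t)%g x = rotate s (rotate t x).
Proof. by rewrite /rotate (gcmap_morphism H).2 mulgA. Qed.

Definition rotation : tds G :=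
  Tds (@gc_compact G H) (@gc_hausdorff G H) rotate_continuous rotate1 rotateM.

End Rotation.

(* Main.v *)
From HB Require Import structures.
Require Import Defs.
From mathcomp Require Import all_boot all_order all_algebra.
From mathcomp Require Import complex mxtens ring lra.
From mathcomp Require Import all_classical all_reals all_analysis.

Set Implicit Arguments.
Unset Strict Implicit.
Unset Printing Implicit Defensive.

Import Order.TTheory GRing.Theory Num.Theory.
Import numFieldNormedType.Exports.

Local Open Scope classical_set_scope.
Local Open Scope ring_scope.

(** An embedding of n copies of a representation pi into C(X) is the same
    thing as a continuous matrix-valued function F on X, with n rows, such
    that F(t x) = F(x) pi(t)^-1 and such that the entries of F are linearly
    independent functions ([embedsP]).  The proof reads everything
    off such functions.

    Let X be normal.  The trivial representation has multiplicity one, so the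
    continuous invariant functions on X are constant ([normal_ergodic]).  Let
    pi be irreducible, in the point spectrum, and unitary, which costs no
    generality.  Its multiplicity is its dimension, so F can be taken square.
    The function F F^* is invariant, hence constant, and freeness makes it
    invertible; after a multiplication on the left by a constant matrix, F is
    unitary-valued and equal to 1 at a base point x0 ([frame_exists]).  The
    adjoint E_pi of F then satisfies E_pi(t x) = pi(t) E_pi(x), and
    x |-> (E_pi(x))_pi maps X equivariantly into a product of unitary groups.
    It is injective: finite-dimensional invariant subspaces are dense in C(X),
    they split into irreducible pieces, and any equivariant function of type
    pi is the product of a constant matrix and the frame ([frame_factor],
    [frames_separate]).  Its image is the closure H of
    {(pi(t))_pi | t in G}: it is closed and contains this set, which is the
    orbit of x0, and conversely the distance from E(x) to that orbit, being a
    continuous invariant function of x which vanishes at x0, vanishes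
    everywhere ([orbit_approximation]).  Now H is a compact group in which
    G has dense image, and X is isomorphic to its rotation
    ([normal_isom_rotation]).  As H depends on the point spectrum only, this
    also shows that normal systems with the same spectrum are isomorphic.

    Conversely, a grouplike set sigma gives rise to such a group H, built from
    the unitary irreducible representations whose class is in sigma.  The
    linear combinations of the matrix coordinates on H form an algebra,
    because a tensor product of two members of sigma decomposes inside sigma;
    it is closed under conjugation, because sigma is; and it separates the
    points of H.  By Stone and Weierstrass it is dense in C(H)
    ([repfun_dense]), so that the rotation has discrete spectrum.  A member pi
    of sigma has multiplicity exactly dim pi: the entries of pi are linearly
    independent ([coefficients_independent]), and the adjoint of the coordinate
    projection is a frame, which bounds the multiplicity ([frame_embeds_le]).  An
    irreducible rho outside sigma has multiplicity zero: the entries of an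
    equivariant function of type rho would be approximable by combinations of
    entries of members of sigma, to which they are orthogonal
    ([unitary_mult_sigma]).

    The averaging needed for complete reducibility, for invariant inner
    products and for orthogonality rests on a fixed point theorem for any group
    acting linearly and boundedly on a space of matrices: the closed convex
    hull of an orbit contains a fixed point, namely the point where the
    supremum over the orbit of the squared Frobenius norm, a strictly convex
    invariant function, is smallest ([hull_fixed_point]). *)

(** * The squared Frobenius norm *)

Section Nsq.
Context {R : realType}.
Local Notation C := (Cplx R).

(** The squared modulus as an element of the ordered field R, where real
    arithmetic tactics apply; it avoids square roots throughout. *)
Definition nsq (z : C) : R := complex.Re z ^+ 2 + complex.Im z ^+ 2.

Lemma cReD (x y : C) : complex.Re (x + y) = complex.Re x + complex.Re y.
Proof. by case: x => a b; case: y => c d. Qed.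
Lemma cImD (x y : C) : complex.Im (x + y) = complex.Im x + complex.Im y.
Proof. by case: x => a b; case: y => c d. Qed.
Lemma cReN (x : C) : complex.Re (- x) = - complex.Re x.
Proof. by case: x. Qed.
Lemma cImN (x : C) : complex.Im (- x) = - complex.Im x.
Proof. by case: x. Qed.
Lemma cReM (x y : C) : complex.Re (x * y) =
  complex.Re x * complex.Re y - complex.Im x * complex.Im y.
Proof. by case: x => a b; case: y => c d. Qed.
Lemma cImM (x y : C) : complex.Im (x * y) =
  complex.Re x * complex.Im y + complex.Im x * complex.Re y.
Proof. by case: x => a b; case: y => c d. Qed.

Lemma nsq_ge0 z : 0 <= nsq z.
Proof. by rewrite addr_ge0 ?sqr_ge0. Qed.

Lemma nsq_eq0 z : nsq z = 0 -> z = 0.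
Proof.
case: z => a b /eqP; rewrite /nsq /= paddr_eq0 ?sqr_ge0 // !sqrf_eq0.
by case/andP => /eqP -> /eqP ->.
Qed.

Lemma nsqE (z : C) : (nsq z)%:C%C = `|z| ^+ 2 :> C.
Proof. exact: add_Re2_Im2. Qed.

Lemma nsqM z w : nsq (z * w) = nsq z * nsq w.
Proof. by rewrite /nsq cReM cImM; ring. Qed.

Lemma nsq_parallelogram z w :
  nsq (z + w) + nsq (z - w) = 2 * (nsq z + nsq w).
Proof. by rewrite /nsq !cReD !cImD cReN cImN; ring. Qed.

Lemma nsqD_le z w : nsq (z + w) <= 2 * (nsq z + nsq w).
Proof. by rewrite -nsq_parallelogram lerDl nsq_ge0. Qed.

Lemma gt0_realC (e : C) : 0 < e -> exists2 r : R, 0 < r & e = r%:C%C.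
Proof.
move=> e0; have er : e = (complex.Re e)%:C%C by rewrite RRe_real // gtr0_real.
by exists (complex.Re e) => //; rewrite -ltcR -er.
Qed.

Lemma nsq0 : nsq 0 = 0.
Proof. by rewrite /nsq /= expr0n addr0. Qed.

Lemma nsq_sum_le (n : nat) (F : 'I_n -> C) :
  nsq (\sum_i F i) <= 2 ^+ n * \sum_i nsq (F i).
Proof.
elim: n F => [|n IH] F; first by rewrite !big_ord0 nsq0 mulr0.
rewrite !big_ord_recl; apply: (le_trans (nsqD_le _ _)).
rewrite exprS -mulrA ler_pM2l // mulrDr lerD ?IH //.
by rewrite ler_peMl ?nsq_ge0 // exprn_ege1 // ler1n.
Qed.

Definition fro m n (A : 'M[C]_(m, n)) : R := \sum_i \sum_j nsq (A i j).

Lemma fro_ge0 m n (A : 'M[C]_(m, n)) : 0 <= fro A.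
Proof. by do 2![apply: sumr_ge0 => ? _]; exact: nsq_ge0. Qed.

Lemma nsq_le_fro m n (A : 'M[C]_(m, n)) i j : nsq (A i j) <= fro A.
Proof.
rewrite /fro (bigD1 i) //= (bigD1 j) //= -addrA lerDl addr_ge0 //.
  by apply: sumr_ge0 => ? _; exact: nsq_ge0.
by do 2![apply: sumr_ge0 => ? _]; exact: nsq_ge0.
Qed.

Lemma fro_eq0 m n (A : 'M[C]_(m, n)) : fro A = 0 -> A = 0.
Proof.
move=> A0; apply/matrixP => i j; rewrite mxE; apply: nsq_eq0; apply/eqP.
by rewrite eq_le nsq_ge0 -A0 nsq_le_fro.
Qed.

Lemma fro_parallelogram m n (A B : 'M[C]_(m, n)) :
  fro (A + B) + fro (A - B) = 2 * (fro A + fro B).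
Proof.
rewrite /fro -!big_split mulr_sumr; apply: eq_bigr => i _.
rewrite /= -!big_split mulr_sumr; apply: eq_bigr => j _ /=.
rewrite !mxE; exact: nsq_parallelogram.
Qed.

Lemma froD_le m n (A B : 'M[C]_(m, n)) : fro (A + B) <= 2 * (fro A + fro B).
Proof. by rewrite -fro_parallelogram lerDl fro_ge0. Qed.

Lemma froZ m n (a : C) (A : 'M[C]_(m, n)) : fro (a *: A) = nsq a * fro A.
Proof.
rewrite /fro mulr_sumr; apply: eq_bigr => i _.
by rewrite mulr_sumr; apply: eq_bigr => j _; rewrite mxE nsqM.
Qed.

Lemma froN m n (A : 'M[C]_(m, n)) : fro (- A) = fro A.
Proof.
by rewrite -scaleN1r froZ /nsq cReN cImN /= oppr0 expr0n /= addr0 sqrrN expr1n mul1r.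
Qed.

(** The constant is far from the optimal one, which is 1; it suffices for
    boundedness statements, and avoids the Cauchy-Schwarz inequality. *)
Lemma froM_le m n p (A : 'M[C]_(m, n)) (B : 'M[C]_(n, p)) :
  fro (A *m B) <= 2 ^+ n * (fro A * fro B).
Proof.
have e : fro B = \sum_j \sum_k nsq (B k j) by rewrite /fro exchange_big.
rewrite e {1 2}/fro mulr_suml mulr_sumr ler_sum // => i _.
rewrite mulr_sumr mulr_sumr ler_sum // => j _; rewrite mxE.
apply: (le_trans (nsq_sum_le _)); rewrite ler_wpM2l ?exprn_ge0 //.
rewrite mulr_suml ler_sum // => k _; rewrite nsqM ler_wpM2l ?nsq_ge0 //.
rewrite (bigD1 k) //= lerDl; apply: sumr_ge0 => ? _; exact: nsq_ge0.
Qed.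

Lemma froMM_le m n p q (A : 'M[C]_(m, n)) (B : 'M[C]_(n, p)) (D : 'M[C]_(p, q)) :
  fro (A *m B *m D) <= 2 ^+ p * 2 ^+ n * (fro A * fro D) * fro B.
Proof.
apply: (le_trans (froM_le _ _)); rewrite -!mulrA ler_wpM2l ?exprn_ge0 //.
rewrite [leRHS]mulrCA !mulrA [leRHS]mulrAC ler_wpM2r ?fro_ge0 //.
apply: (le_trans (froM_le _ _)); rewrite mulrCA -mulrA ler_wpM2l ?fro_ge0 //.
Qed.

Lemma scalar_fro_le m n (l : {scalar 'M[C]_(m, n)}) :
  exists L : R, forall A, nsq (l A) <= L * fro A.
Proof.
exists (2 ^+ m * 2 ^+ n * \sum_i \sum_j nsq (l (delta_mx i j))) => A.
rewrite {1}(matrix_sum_delta A) linear_sum; apply: (le_trans (nsq_sum_le _)).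
rewrite -!mulrA ler_wpM2l ?exprn_ge0 //.
rewrite mulr_suml mulr_sumr ler_sum // => i _; rewrite linear_sum.
apply: (le_trans (nsq_sum_le _)); rewrite ler_wpM2l ?exprn_ge0 //.
rewrite mulr_suml ler_sum // => j _.
by rewrite linearZ /= nsqM mulrC ler_wpM2l ?nsq_ge0 // nsq_le_fro.
Qed.

Lemma Re_sqr_le (z : C) : complex.Re z ^+ 2 <= nsq z.
Proof. by rewrite lerDl sqr_ge0. Qed.

End Nsq.

(** * A fixed point in the convex hull of a bounded orbit *)

Section HullFixedPoint.
Context {R : realType}.
Local Notation C := (Cplx R).

Lemma sqr_cauchy_cvg (u : nat -> R) :
  (forall e, 0 < e -> exists N, forall j k, (N <= j)%N -> (N <= k)%N ->
     (u j - u k) ^+ 2 < e) -> exists p : R, u k @[k --> \oo] --> p.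
Proof.
move=> uC; suff h : cvgn u by exists (limn u).
apply/cauchy_cvgP/cauchy_exP => e e0.
have [N uN] := uC _ (exprn_gt0 2 e0).
exists (u N); exists N => // k /= Nk; rewrite /ball /= -ltr_sqr ?nnegrE ?normr_ge0 //.
  by rewrite real_normK ?num_real //; exact: uN.
by rewrite ltW.
Qed.

Lemma fro_complete m n (A : nat -> 'M[C]_(m, n)) :
  (forall e, 0 < e -> exists N, forall j k, (N <= j)%N -> (N <= k)%N ->
     fro (A j - A k) < e) ->
  exists P, forall e, 0 < e -> \forall k \near \oo, fro (P - A k) < e.
Proof.
move=> AC.
have coordC (h : C -> R) : (forall x y, (h x - h y) ^+ 2 <= nsq (x - y)) ->
    forall i j, exists p : R, h (A k i j) @[k --> \oo] --> p.
  move=> hC i j; apply: sqr_cauchy_cvg => e e0.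
  have [N AN] := AC _ e0; exists N => k l Nk Nl.
  apply: le_lt_trans (AN _ _ Nk Nl); apply: (le_trans (hC _ _)).
  by have := nsq_le_fro (A k - A l) i j; rewrite !mxE.
have /(_ (@complex.Re R)) reC := coordC.
have {}/reC reC : forall x y : C, (complex.Re x - complex.Re y) ^+ 2 <= nsq (x - y).
  by move=> x y; rewrite /nsq cReD cReN lerDl sqr_ge0.
have /(_ (@complex.Im R)) imC := coordC.
have {}/imC imC : forall x y : C, (complex.Im x - complex.Im y) ^+ 2 <= nsq (x - y).
  by move=> x y; rewrite /nsq cImD cImN lerDr sqr_ge0.
have [p pE] := choice (fun ij : 'I_m * 'I_n => reC ij.1 ij.2).
have [q qE] := choice (fun ij : 'I_m * 'I_n => imC ij.1 ij.2).
pose P : 'M[C]_(m, n) := \matrix_(i, j) Complex (p (i, j)) (q (i, j)).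
have lim0 : fro (P - A k) @[k --> \oo] --> (0 : R).
  have -> : (0 : R) = \sum_(i < m) \sum_(j < n) ((p (i, j) - p (i, j)) ^+ 2 + (q (i, j) - q (i, j)) ^+ 2).
    by rewrite big1 // => i _; rewrite big1 // => j _; rewrite !subrr expr0n addr0.
  apply: cvg_big => [|i _]; first exact: add_continuous.
  apply: cvg_big => [|j _]; first exact: add_continuous.
  under eq_cvg do rewrite /nsq !mxE cReD cImD cReN cImN /=.
  by apply: cvgD; apply: cvgM; apply: cvgB;
    [exact: cvg_cst|exact: (pE (i, j))|exact: cvg_cst|exact: (pE (i, j))
    |exact: cvg_cst|exact: (qE (i, j))|exact: cvg_cst|exact: (qE (i, j))].
exists P => e e0; move/cvgrPdist_lt: lim0 => /(_ e e0).
by apply: filterS => k; rewrite sub0r normrN ger0_norm ?fro_ge0.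
Qed.

Variables (G : topologicalGroupType) (m n : nat).
Variable Theta : G -> {linear 'M[C]_(m, n) -> 'M[C]_(m, n)}.
Variables (M : R) (A0 : 'M[C]_(m, n)).
Hypothesis Theta1 : forall A, Theta 1%g A = A.
Hypothesis ThetaM : forall s t A, Theta (s * t)%g A = Theta s (Theta t A).
Hypothesis M0 : 0 < M.
Hypothesis ThetaB : forall t A, fro (Theta t A) <= M * fro A.

(** The closed convex hull of the orbit of A0, as the intersection of the
    closed half-spaces which contain the orbit.  This form makes it immediate
    that an affine condition satisfied along the orbit holds on the hull. *)
Definition orbit_hull : set 'M[C]_(m, n) := [set A |
  forall (l : {scalar 'M[C]_(m, n)}) (c : R),
    (forall t, c <= complex.Re (l (Theta t A0))) -> c <= complex.Re (l A)].

(** Bounded actions need not preserve [fro]; the supremum over the orbit does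
   what an invariant norm would do. *)
Let supfro A := sup [set fro (Theta t A) | t in [set: G]].

Let has_sup_fro A : has_sup [set fro (Theta t A) | t in [set: G]].
Proof.
split; first by exists (fro (Theta 1%g A)), 1%g.
by exists (M * fro A) => _ [t _ <-].
Qed.

Let fro_le_sup t A : fro (Theta t A) <= supfro A.
Proof. by apply: sup_upper_bound => //; exists t. Qed.

Let supfro_stable s A : supfro (Theta s A) <= supfro A.
Proof.
apply: ge_sup; first by case: (has_sup_fro (Theta s A)).
by move=> _ [t _ <-]; rewrite -ThetaM.
Qed.

Let hull_stable s A : orbit_hull A -> orbit_hull (Theta s A).
Proof.
move=> hA l c lc; apply: (hA (l \o Theta s) c) => t /=.
by rewrite -ThetaM.
Qed.

Let half : C := (2^-1 : R)%:C%C.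

Let hull_mid A B : orbit_hull A -> orbit_hull B -> orbit_hull (half *: (A + B)).
Proof.
move=> hA hB l c lc; rewrite linearZ linearD /= cReM /= mul0r subr0 cReD.
by have := hA l c lc; have := hB l c lc; lra.
Qed.

Let m0 := inf (supfro @` orbit_hull).

Let has_inf_sup : has_inf (supfro @` orbit_hull).
Proof.
split; first by exists (supfro A0), A0 => // l c /(_ 1%g); rewrite Theta1.
by exists 0 => _ [A _ <-]; rewrite (le_trans (fro_ge0 (Theta 1%g A))).
Qed.

(** Strict convexity, made quantitative: by the parallelogram law, two points
    at which the supremum is nearly minimal are close to each other, because
    their midpoint cannot do better than the infimum. *)
Let hull_close A B d : 0 < d -> orbit_hull A -> orbit_hull B ->
  supfro A < m0 + d -> supfro B < m0 + d -> fro (A - B) < M * (8 * d).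
Proof.
move=> d0 hA hB Ad Bd.
have mAB : m0 <= supfro (half *: (A + B)).
  by apply: ge_inf; [case: has_inf_sup|exists (half *: (A + B)) => //; exact: hull_mid].
have [_ [t _ <-] tE] := sup_adherent d0 (has_sup_fro (half *: (A + B))).
have := fro_le_sup t A; have := fro_le_sup t B.
have := fro_parallelogram (Theta t A) (Theta t B).
rewrite -linearD -linearB => par At Bt.
have {}tE : m0 - d < 4^-1 * fro (Theta t (A + B)).
  apply: (le_lt_trans _ (lt_le_trans tE _)); first by rewrite lerB.
  by rewrite linearZ froZ /nsq /= expr0n /= addr0 exprVn -natrX lexx.
have -> : A - B = Theta t^-1%g (Theta t (A - B)) by rewrite -ThetaM mulVg Theta1.
by apply: (le_lt_trans (ThetaB _ _)); rewrite ltr_pM2l //; lra.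
Qed.

(** A minimizing sequence for [supfro] is a Cauchy sequence by [hull_close];
    its limit P is fixed because Theta s P is also the limit of a minimizing
    sequence. *)
Lemma hull_fixed_point : exists2 P, orbit_hull P & forall t, Theta t P = P.
Proof.
have /choice[A AP] (k : nat) : exists A, orbit_hull A /\ supfro A < m0 + k.+1%:R^-1.
  have k0 : 0 < k.+1%:R^-1 :> R by rewrite invr_gt0.
  by have [_ [A hA <-] Ak] := inf_adherent k0 has_inf_sup; exists A.
have AP' N k : (N <= k)%N -> supfro (A k) < m0 + N.+1%:R^-1.
  move=> Nk; apply: (lt_le_trans (AP k).2); rewrite lerD2l.
  by rewrite lef_pV2 ?posrE // ler_nat.
have small e : 0 < e -> exists N : nat, M * (8 * N.+1%:R^-1) < e.
  move=> e0; have c0 : 0 < e / (M * 8) by rewrite divr_gt0 ?mulr_gt0.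
  have [N _ /(_ N (leqnn _)) NE] := near_infty_natSinv_lt (PosNum c0).
  by exists N; rewrite mulrA mulrC -ltr_pdivlMr ?mulr_gt0.
have gt0 (N : nat) : 0 < N.+1%:R^-1 :> R by rewrite invr_gt0.
have [|P PA] := @fro_complete _ _ A.
  move=> e /small[N Ne]; exists N => j k Nj Nk; apply: lt_trans Ne.
  by apply: hull_close; [exact: gt0|exact: (AP j).1|exact: (AP k).1|exact: AP'..].
exists P => [l c lc|s].
  (* The hull is closed: a linear functional below c at P is below c at A N. *)
  have [L lL] := scalar_fro_le l.
  rewrite leNgt; apply/negP => Pc.
  pose e := (c - complex.Re (l P)) ^+ 2.
  have e0 : 0 < e by rewrite exprn_gt0 // subr_gt0.
  have L1 : 0 < `|L| + 1 by rewrite ltr_pwDr.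
  have [N _ /(_ N (leqnn _)) PN] := PA _ (divr_gt0 e0 L1).
  have := (AP N).1 l c lc; rewrite leNgt => /negP; apply.
  have : (complex.Re (l P) - complex.Re (l (A N))) ^+ 2 < e.
    have -> : complex.Re (l P) - complex.Re (l (A N)) = complex.Re (l (P - A N)).
      by rewrite linearB cReD cReN.
    apply: (le_lt_trans (Re_sqr_le _)); apply: (le_lt_trans (lL _)).
    move: PN; rewrite ltr_pdivlMr // mulrC; apply: le_lt_trans.
    by rewrite ler_wpM2r ?fro_ge0 // ler_wpDr // ler_norm.
  rewrite /e => sq; rewrite ltNge; apply/negP => cA.
  have : (c - complex.Re (l P)) ^+ 2 <= (complex.Re (l (A N)) - complex.Re (l P)) ^+ 2.
    by rewrite ler_sqr ?nnegrE; lra.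
  by rewrite -[X in _ <= X]sqrrN opprB; lra.
apply/esym/eqP; rewrite -subr_eq0; apply/eqP/fro_eq0/eqP.
(* P - Theta s P is the sum of P - B, B - Theta s B and Theta s (B - P), for B
   a late term of the sequence; the constant 6 + 4 M collects the factors 2 of
   two uses of [froD_le]. *)
rewrite eq_le fro_ge0 andbT; apply/ler_addgt0Pr => e e0; rewrite add0r.
have c0 : 0 < 6 + 4 * M by rewrite addr_gt0 ?mulr_gt0.
pose d := e / (6 + 4 * M).
have d0 : 0 < d by rewrite divr_gt0.
have [N Nd] := small d d0.
have [K _ /(_ (maxn N K) (leq_maxr _ _)) PK] := PA _ d0.
set B := A (maxn N K) in PK.
have hB : orbit_hull B by exact: (AP _).1.
have NB : supfro B < m0 + N.+1%:R^-1 by apply: AP'; rewrite leq_maxl.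
have Bs : fro (B - Theta s B) < d.
  apply: lt_trans Nd; apply: hull_close => //; first exact: hull_stable.
  exact: le_lt_trans (supfro_stable _ _) NB.
have Ps : fro (Theta s B - Theta s P) <= M * d.
  rewrite -linearB; apply: (le_trans (ThetaB _ _)).
  by rewrite ler_pM2l // -froN opprB ltW.
have -> : P - Theta s P = (P - B) + ((B - Theta s B) + (Theta s B - Theta s P)).
  by rewrite !addrA !subrK.
apply: (le_trans (froD_le _ _)).
have := froD_le (B - Theta s B) (Theta s B - Theta s P).
have -> : e = (6 + 4 * M) * d by rewrite mulrC divfK // gt_eqF.
by nra.
Qed.

End HullFixedPoint.

(** * Adjoints, and linear conditions on the hull of an orbit *)

Section Adjoint.
Context {R : realType}.
Local Notation C := (Cplx R).

Definition adj m n (A : 'M[C]_(m, n)) : 'M[C]_(n, m) := map_mx Num.conj A^T.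

Lemma adjM m n p (A : 'M[C]_(m, n)) (B : 'M[C]_(n, p)) :
  adj (A *m B) = adj B *m adj A.
Proof. by rewrite /adj trmx_mul map_mxM. Qed.

Lemma adjK m n (A : 'M[C]_(m, n)) : adj (adj A) = A.
Proof. by apply/matrixP => i j; rewrite !mxE conjCK. Qed.

Lemma adjmx1 n : adj (1%:M : 'M[C]_n) = 1%:M.
Proof. by rewrite /adj trmx1 map_mx1. Qed.

Lemma adjD m n (A B : 'M[C]_(m, n)) : adj (A + B) = adj A + adj B.
Proof. by rewrite /adj linearD map_mxD. Qed.

Lemma fro_adj m n (A : 'M[C]_(m, n)) : fro (adj A) = fro A.
Proof.
rewrite /fro exchange_big; apply: eq_bigr => i _; apply: eq_bigr => j _.
by rewrite !mxE; apply: (@complexI R); rewrite !nsqE norm_conjC.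
Qed.

Lemma tr_mul_adj m n (A : 'M[C]_(m, n)) : \tr (A *m adj A) = (fro A)%:C%C.
Proof.
rewrite /mxtrace /fro rmorph_sum; apply: eq_bigr => i _.
rewrite mxE rmorph_sum; apply: eq_bigr => j _.
by rewrite !mxE [RHS]nsqE normCK.
Qed.

Lemma rV_mul_adj n (v : 'rV[C]_n) : (v *m adj v) 0 0 = (fro v)%:C%C.
Proof. by rewrite -tr_mul_adj /mxtrace big_ord1. Qed.

Lemma norm_entry_le1 n (U : 'M[C]_n) i j : U *m adj U = 1%:M -> `|U i j| <= 1.
Proof.
move=> U1; have /matrixP/(_ i i) := U1; rewrite !mxE eqxx /= => e.
rewrite -(@ler_pXn2r _ 2) ?nnegrE ?expr1n // -[leRHS]e.
rewrite (bigD1 j) //= !mxE normCK lerDl; apply: sumr_ge0 => k _.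
by rewrite !mxE mul_conjC_ge0.
Qed.

End Adjoint.

Section HullEq.
Context {R : realType} {G : topologicalGroupType}.
Local Notation C := (Cplx R).

Definition mk_scalar (V : lmodType C) (f : V -> C) (h : linear_for *%R f) :
  {scalar V} := HB.pack f (GRing.isLinear.Build C V C *%R f h).

(** The half-spaces defined by f and its multiples by -1, i and -i cut the
    hull down to the level set of f. *)
Lemma hull_scalar_eq m n (Theta : G -> {linear 'M[C]_(m, n) -> 'M[C]_(m, n)})
    A0 P (f : 'M[C]_(m, n) -> C) v : linear_for *%R f ->
  orbit_hull Theta A0 P -> (forall t, f (Theta t A0) = v) -> f P = v.
Proof.
move=> fl hP fv.
have re (a : C) : complex.Re (a * v) <= complex.Re (a * f P).
  have l : linear_for *%R (fun A => a * f A).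
    by move=> b x y /=; rewrite fl mulrDr mulrCA.
  by apply: (hP (mk_scalar l)) => t /=; rewrite fv.
have := re 1; have := re (-1); have := re 'i%C; have := re (- 'i%C).
rewrite !mul1r !mulN1r !mulNr !cReN !cReM /= !mul0r !mul1r !sub0r !opprK.
case: v {fv re} => a b; case: (f P) => c d /= h1 h2 h3 h4.
by congr Complex; lra.
Qed.

Lemma hull_linear_eq m n p q (Theta : G -> {linear 'M[C]_(m, n) -> 'M[C]_(m, n)})
    A0 P (f : {linear 'M[C]_(m, n) -> 'M[C]_(p, q)}) B :
  orbit_hull Theta A0 P -> (forall t, f (Theta t A0) = B) -> f P = B.
Proof.
move=> hP fB; apply/matrixP => i j.
apply: (hull_scalar_eq (f := fun A => f A i j) _ hP) => [a x y /=|t].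
  by rewrite linearP !mxE.
by rewrite fB.
Qed.

End HullEq.

(** * Averaging: invariant complements and invariant inner products *)

Section Representations.
Context {R : realType} {G : topologicalGroupType}.
Local Notation C := (Cplx R).
Implicit Types pi rho : fdrep R G.

Lemma repK pi t : pi t^-1%g *m pi t = 1%:M.
Proof. by rewrite -repM mulVg rep1. Qed.

Lemma repVK pi t : pi t *m pi t^-1%g = 1%:M.
Proof. by rewrite -repM mulgV rep1. Qed.

Lemma rep_fro_bounded pi : exists2 M : R, 0 < M & forall t, fro (pi t) <= M.
Proof.
have /bounded_mxP[M M0 piM] := @rep_bounded _ _ pi.
pose d := (rep_dim pi)%:R : R.
exists (d * (d * nsq M) + 1) => [|t].
  by rewrite ltr_pwDr // !mulr_ge0 ?nsq_ge0 ?ler0n.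
rewrite ler_wpDr //; apply: (@le_trans _ _ (\sum_(i < rep_dim pi) \sum_(j < rep_dim pi) nsq M)).
  by do 2![apply: ler_sum => ? _]; rewrite -lecR !nsqE ler_sqr ?nnegrE // (gtr0_norm M0) ltW.
by rewrite !big_const_ord !iter_addr_0 /d !mulr_natl.
Qed.

Lemma bounded_fro m n (f : G -> 'M[C]_(m, n)) (M : R) :
  (forall t, fro (f t) <= M) -> [bounded f t | t in [set: G]].
Proof.
move=> fM; apply/bounded_mxP.
have M0 : 0 <= M := le_trans (fro_ge0 _) (fM 1%g).
exists ((M + 1)%:C%C) => [|t i j]; first by rewrite ltcR ltr_wpDl.
have M1 : 0 <= (M + 1)%:C%C :> C by rewrite lecR addr_ge0.
rewrite -(@ltr_pXn2r _ 2) ?nnegrE // -nsqE -rmorphXn ltcR /=.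
apply: (le_lt_trans (nsq_le_fro _ _ _)); apply: (le_lt_trans (fM t)); nra.
Qed.

(** When A is a left inverse of B and the idempotent B A commutes with pi, the
    range of B is a subrepresentation with an invariant complement, and A pi B
    is its matrix form.  This covers both a change of basis (A and B inverse
    to each other) and the passage to a direct summand. *)
Section Sandwich.
Variables (pi : fdrep R G) (d : nat).
Variables (A : 'M[C]_(d, rep_dim pi)) (B : 'M[C]_(rep_dim pi, d)).
Hypothesis AB1 : A *m B = 1%:M.
Hypothesis BAC : forall t, B *m A *m pi t = pi t *m (B *m A).

Let f t := A *m pi t *m B.

Let f1 : f 1%g = 1%:M.
Proof. by rewrite /f rep1 mulmx1. Qed.

Let fM s t : f (s * t)%g = f s *m f t.
Proof.
rewrite /f repM !mulmxA -(mulmxA _ B) -(mulmxA _ (B *m A)) BAC !mulmxA.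
by rewrite -(mulmxA _ A) AB1 mulmx1.
Qed.

Let f_continuous : continuous f.
Proof.
apply/continuous_mxP => i j.
have /continuous_mxP piC := @rep_continuous _ _ pi.
have -> : (fun t => f t i j) =
    (fun t => \sum_k (\sum_l A i l * pi t l k) * B k j).
  by apply/funext => t; rewrite mxE; apply: eq_bigr => k _; rewrite mxE.
move=> t; apply: cvg_big => [|k _]; first exact: add_continuous.
apply: cvgM; last exact: cvg_cst.
apply: cvg_big => [|l _]; first exact: add_continuous.
by apply: cvgM; [exact: cvg_cst|exact: piC].
Qed.

Let f_bounded : [bounded f t | t in [set: G]].
Proof.
have [M M0 piM] := rep_fro_bounded pi.
pose K : R := 2 ^+ rep_dim pi * 2 ^+ rep_dim pi * (fro A * fro B).
apply: (@bounded_fro _ _ _ (K * M)) => t; apply: (le_trans (froMM_le _ _ _)).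
by rewrite ler_wpM2l // !mulr_ge0 ?exprn_ge0 ?fro_ge0.
Qed.

Definition sandwich_rep : fdrep R G := FdRep f1 fM f_continuous f_bounded.

End Sandwich.

(** The conjugates pi(t) P0 pi(t)^-1 of a projection P0 onto an invariant
    subspace are again projections onto this subspace.  The corresponding
    identities are affine, so a fixed point in the hull of these conjugates
    satisfies them too, and it commutes with pi. *)
Lemma maschke pi (P0 : 'M[C]_(rep_dim pi)) :
  P0 *m P0 = P0 -> (forall t, P0 *m pi t *m P0 = pi t *m P0) ->
  exists P, [/\ P0 *m P = P, P *m P0 = P0, P *m P = P &
    forall t, pi t *m P = P *m pi t].
Proof.
move=> P00 P0s.
pose Theta t : {linear 'M[C]_(rep_dim pi) -> 'M[C]_(rep_dim pi)} :=
  mulmxr (pi t^-1%g) \o mulmx (pi t).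
have [M M0 piM] := rep_fro_bounded pi.
pose K : R := 2 ^+ rep_dim pi.
have K0 : 0 < K by rewrite exprn_gt0.
have [||||P hP PT] := @hull_fixed_point R G _ _ Theta (K * K * (M * M)) P0.
- by move=> A /=; rewrite invg1 rep1 mulmx1 mul1mx.
- by move=> s t A /=; rewrite invgM !repM !mulmxA.
- by rewrite !mulr_gt0.
- move=> t A /=; apply: (le_trans (froMM_le _ _ _)).
  by rewrite ler_wpM2r ?fro_ge0 // ler_pM2l ?mulr_gt0 // ler_pM ?fro_ge0.
have e1 : P0 *m P = P.
  have h : (1%:M - P0) *m P = 0.
    apply: (@hull_linear_eq _ _ _ _ _ _ Theta P0 P (mulmx (1%:M - P0)) 0 hP) => t.
    by rewrite /= mulmxBl mul1mx !mulmxA P0s subrr.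
  by apply/esym/eqP; move/eqP: h; rewrite mulmxBl mul1mx subr_eq0.
have e2 : P *m P0 = P0.
  apply: (@hull_linear_eq _ _ _ _ _ _ Theta P0 P (mulmxr P0) P0 hP) => t /=.
  by rewrite -!mulmxA (mulmxA P0) P0s mulmxA repVK mul1mx.
exists P; split => //; first by rewrite -{2}e1 mulmxA e2.
by move=> t; rewrite -{2}(PT t) /= -mulmxA repK mulmx1.
Qed.

Definition unitary_rep pi := forall t, pi t *m adj (pi t) = 1%:M.

(** A positive definite Hermitian matrix is congruent to 1, by the spectral
    theorem and square roots of the eigenvalues. *)
Lemma positive_factor n (S : 'M[C]_n) : adj S = S ->
  (forall v : 'rV_n, v != 0 -> 0 < (v *m S *m adj v) 0 0) ->
  exists T : 'M[C]_n, T \in unitmx /\ S = T *m adj T.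
Proof.
move=> Sh Sp.
have /hermitian_normalmx/orthomx_spectralP : S \is hermsymmx.
  by apply/is_hermitianmxP; rewrite expr0 scale1r; exact: esym Sh.
have := spectral_unitarymx S; have := spectral_unit S.
set U := spectralmx S; set D := spectral_diag S => Uu UU /=.
rewrite invmx_unitary // => SE.
have UU1 : U *m adj U = 1%:M by apply/unitarymxP.
have D0 i : 0 < D 0 i.
  have -> : D 0 i = (row i U *m S *m adj (row i U)) 0 0.
    have -> : (row i U *m S *m adj (row i U)) 0 0 = (U *m S *m adj U) i i.
      by rewrite -row_mul !mxE; apply: eq_bigr => k _; rewrite !mxE.
    rewrite SE -[(U ^t*)%sesqui]/(adj U) !mulmxA UU1 mul1mx -mulmxA UU1 mulmx1.
    by rewrite mxE eqxx mulr1n.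
  apply: Sp; apply/eqP => r0; have := congr1 (fun v => v *m adj U) r0.
  rewrite -row_mul UU1 mul0mx row1 => /rowP/(_ i).
  by rewrite !mxE !eqxx => /eqP; rewrite oner_eq0.
pose sD := map_mx sqrtC D.
exists (adj U *m diag_mx sD); split.
  rewrite unitmx_mul; apply/andP; split.
    by rewrite map_unitmx unitmx_tr.
  rewrite unitmxE det_diag unitfE; apply/prodf_neq0 => i _.
  by rewrite mxE sqrtC_eq0 gt_eqF.
rewrite adjM adjK SE !mulmxA; congr (_ *m _); rewrite -!mulmxA; congr (_ *m _).
apply/matrixP => i j; rewrite mul_diag_mx !mxE eq_sym.
case: eqP => [->|_]; last by rewrite !mulr0n conjC0 mulr0.
rewrite !mulr1n -normCK ger0_norm ?sqrtC_ge0 ?ltW //; exact: esym (sqrtCK _).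
Qed.

(** A fixed point S of A |-> pi(t) A pi(t)^* in the hull of the orbit of 1 is
    an invariant form; as the forms pi(t) pi(t)^* are uniformly bounded below,
    it is positive definite.  In a basis which is orthonormal for it, pi is
    unitary. *)
Lemma unitarize pi : exists A B : 'M[C]_(rep_dim pi),
  [/\ A *m B = 1%:M, B *m A = 1%:M &
      forall t, A *m pi t *m B *m adj (A *m pi t *m B) = 1%:M].
Proof.
pose Theta t : {linear 'M[C]_(rep_dim pi) -> 'M[C]_(rep_dim pi)} :=
  mulmxr (adj (pi t)) \o mulmx (pi t).
have [M M0 piM] := rep_fro_bounded pi.
pose K : R := 2 ^+ rep_dim pi.
have K0 : 0 < K by rewrite exprn_gt0.
have [||||S hS ST] := @hull_fixed_point R G _ _ Theta (K * K * (M * M)) 1%:M.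
- by move=> A /=; rewrite rep1 adjmx1 mulmx1 mul1mx.
- by move=> s t A /=; rewrite repM adjM !mulmxA.
- by rewrite !mulr_gt0.
- move=> t A /=; apply: (le_trans (froMM_le _ _ _)); rewrite fro_adj.
  by rewrite ler_wpM2r ?fro_ge0 // ler_pM2l ?mulr_gt0 // ler_pM ?fro_ge0.
have Sp (v : 'rV_(rep_dim pi)) : v != 0 -> 0 < complex.Re ((v *m S *m adj v) 0 0).
  move=> v0; have fv0 : 0 < fro v.
    rewrite lt_neqAle fro_ge0 andbT eq_sym; apply: contra_neq v0; exact: fro_eq0.
  have l : linear_for *%R (fun A : 'M[C]_(rep_dim pi) => (v *m A *m adj v) 0 0).
    by move=> a x y /=; rewrite linearD linearZ /= mulmxDl -scalemxAl !mxE.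
  (* The lower bound: v = v pi(t) pi(t)^-1, and pi(t)^-1 is bounded. *)
  apply: (@lt_le_trans _ _ (fro v / (K * M))); first by rewrite divr_gt0 ?mulr_gt0.
  apply: (hS (mk_scalar l)) => t /=.
  rewrite mulmx1 mulmxA -mulmxA -adjM rV_mul_adj /=.
  rewrite ler_pdivrMr ?mulr_gt0 // mulrC -mulrA.
  have {1}-> : v = (v *m pi t) *m pi t^-1%g by rewrite -mulmxA repVK mulmx1.
  apply: (le_trans (froM_le _ _)); rewrite ler_pM2l // mulrC.
  by rewrite ler_wpM2l ?fro_ge0.
(* Adding the adjoint makes the form Hermitian and keeps it positive. *)
have [T [Tu TS]] : exists T : 'M[C]_(rep_dim pi), T \in unitmx /\ S + adj S = T *m adj T.
  apply: positive_factor => [|v /Sp v0]; first by rewrite adjD adjK addrC.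
  have -> : (v *m (S + adj S) *m adj v) 0 0 =
      (v *m S *m adj v) 0 0 + ((v *m S *m adj v) 0 0)^*.
    rewrite mulmxDr mulmxDl mxE; congr (_ + _).
    have -> : v *m adj S *m adj v = adj (v *m S *m adj v) by rewrite !adjM adjK mulmxA.
    by rewrite 2!mxE.
  rewrite [X in 0 < X](_ : _ = 2 * (complex.Re ((v *m S *m adj v) 0 0))%:C%C).
    by rewrite mulr_gt0 // ltcR.
  exact: addcJ.
exists (invmx T), T; split; [exact: mulVmx|exact: mulmxV|] => t.
have piS : pi t *m (T *m adj T) *m adj (pi t) = T *m adj T.
  rewrite -TS mulmxDr mulmxDl; congr (_ + _); first exact: ST.
  by rewrite -[in RHS](ST t) /= !adjM adjK mulmxA.
have -> : invmx T *m pi t *m T *m adj (invmx T *m pi t *m T) =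
    invmx T *m (pi t *m (T *m adj T) *m adj (pi t)) *m adj (invmx T).
  by rewrite !adjM !mulmxA.
by rewrite piS !mulmxA mulVmx // mul1mx -adjM mulVmx // adjmx1.
Qed.

End Representations.

(** * Subspaces, isomorphisms and the lemma of Schur *)

Section LinSubspace.
Context {R : realType}.
Local Notation C := (Cplx R).

Lemma linsubspaceP (E : lmodType C) (W : set E) :
  linsubspace W <-> W 0 /\ forall a u v, W u -> W v -> W (a *: u + v).
Proof.
split=> [[W0 WD]|[W0 WD]].
  split; first exact: set_mem W0.
  by move=> a u v Wu Wv; apply/set_mem/WD; exact: mem_set.
split; first exact: mem_set.
by move=> a u v /set_mem Wu /set_mem Wv; apply/mem_set/WD.
Qed.

Lemma linear_cV_mx m n (J : {linear 'cV[C]_n -> 'cV[C]_m}) :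
  exists Q : 'M[C]_(m, n), forall v, J v = Q *m v.
Proof.
exists (\matrix_(i, j) J (delta_mx j 0) i 0) => v; apply/colP => i.
rewrite [in LHS](matrix_sum_delta v) linear_sum summxE mxE; apply: eq_bigr => j _.
by rewrite big_ord1 linearZ !mxE mulrC.
Qed.

(** Abstract subspaces of column vectors are turned into idempotent matrices,
    on which [maschke] operates; a matrix of maximal rank with rows in the
    transposed subspace provides a basis. *)
Lemma linsubspace_idem n (W : set 'cV[C]_n) : linsubspace W ->
  exists P : 'M[C]_n, P *m P = P /\ forall v, W v <-> P *m v = v.
Proof.
move=> /linsubspaceP[W0 WD].
pose inW (B : 'M[C]_n) := forall (u : 'rV[C]_n), (u <= B)%MS -> W u^T.
pose Q (k : nat) := `[< exists B : 'M[C]_n, inW B /\ \rank B = k >].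
have Q0 : exists k, Q k.
  exists 0%N; apply/asboolP; exists 0; split; last exact: mxrank0.
  by move=> u; rewrite submx0 => /eqP ->; rewrite trmx0.
have Qb k : Q k -> (k <= n)%N by move=> /asboolP[B [_ <-]]; exact: rank_leq_row.
have [k /asboolP[B [BW Bk]] kmax] := ex_maxnP Q0 Qb.
have WB v : W v <-> (v^T <= B)%MS.
  split=> [Wv|/BW]; last by rewrite trmxK.
  have CW : inW (B + v^T)%MS.
    move=> u /sub_addsmxP[[u1 u2] /= ->]; rewrite linearD /= addrC.
    rewrite [u2]mx11_scalar mul_scalar_mx linearZ /= trmxK; apply: WD => //.
    by apply: BW; rewrite submxMl.
  have /kmax : Q (\rank (B + v^T)%MS) by apply/asboolP; exists (B + v^T)%MS.
  rewrite -Bk => le; have := mxrank_leqif_sup (addsmxSl B v^T).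
  move=> h; have := geq_leqif h; rewrite le => /esym; exact: submx_trans (addsmxSr _ _).
exists (pinvmx B *m B)^T; split.
  by rewrite -trmx_mul mulmxA mulmxKpV // submxMl.
move=> v; rewrite WB -[v in _ *m v]trmxK -trmx_mul mulmxA; split=> [/mulmxKpV ->|].
  by rewrite trmxK.
by move=> <-; rewrite trmxK submxMl.
Qed.

End LinSubspace.

Section Schur.
Context {R : realType} {G : topologicalGroupType}.
Local Notation C := (Cplx R).
Implicit Types pi rho : fdrep R G.

Lemma bij_of_inj_surj (T U : Type) (f : T -> U) :
  injective f -> (forall y, exists x, f x = y) -> bijective f.
Proof.
move=> fi /choice[g gK]; exists g => // x; exact/fi.
Qed.

Lemma isomorphic_mx pi rho : isomorphic pi rho ->
  exists (A : 'M[C]_(rep_dim rho, rep_dim pi)) (B : 'M[C]_(rep_dim pi, rep_dim rho)),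
  [/\ A *m B = 1%:M, B *m A = 1%:M & forall t, A *m pi t = rho t *m A].
Proof.
case=> J [[J' JK J'K] Jt].
have J'l : linear J'.
  by move=> a u v; apply: (can_inj JK); rewrite linearP !J'K.
pose J'L : {linear 'cV[C]_(rep_dim rho) -> 'cV[C]_(rep_dim pi)} :=
  HB.pack J' (GRing.isLinear.Build C _ _ _ J' J'l).
have [A AE] := linear_cV_mx J; have [B BE] := linear_cV_mx J'L.
have colE m n (M N : 'M[C]_(m, n)) : (forall v : 'cV_n, M *m v = N *m v) -> M = N.
  by move=> MN; apply/matrixP => i j; have /colP/(_ i) := MN (delta_mx j 0);
     rewrite -!colE !mxE.
exists A, B; split=> [||t]; apply: colE => v; rewrite -mulmxA ?mul1mx.
- by rewrite -BE -AE J'K.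
- by rewrite -AE -BE; exact: JK.
by rewrite -AE Jt AE /fdact mulmxA.
Qed.

Lemma mx_isomorphic pi rho
    (A : 'M[C]_(rep_dim rho, rep_dim pi)) (B : 'M[C]_(rep_dim pi, rep_dim rho)) :
  A *m B = 1%:M -> B *m A = 1%:M -> (forall t, A *m pi t = rho t *m A) ->
  isomorphic pi rho.
Proof.
move=> AB BA At; exists (mulmx A); split.
  by exists (mulmx B) => v /=; rewrite mulmxA ?AB ?BA mul1mx.
by move=> t v; rewrite /fdact /= !mulmxA At.
Qed.

Lemma isomorphic_refl pi : isomorphic pi pi.
Proof. by apply: (@mx_isomorphic _ _ 1%:M 1%:M) => *; rewrite ?mulmx1 ?mul1mx. Qed.

Lemma isomorphic_sym pi rho : isomorphic pi rho -> isomorphic rho pi.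
Proof.
move=> /isomorphic_mx[A [B [AB BA At]]]; apply: (mx_isomorphic BA AB) => t.
by rewrite -[LHS]mulmx1 -AB !mulmxA -(mulmxA B) -At mulmxA BA mul1mx.
Qed.

Lemma isomorphic_trans rho pi tau :
  isomorphic pi rho -> isomorphic rho tau -> isomorphic pi tau.
Proof.
move=> [J [Jb Jt]] [K [Kb Kt]]; exists (K \o J); split; first exact: bij_comp.
by move=> t v; rewrite /= Jt Kt.
Qed.

Lemma rclass_eq pi rho : rclass pi = rclass rho <-> isomorphic pi rho.
Proof.
split=> [e|h]; first by rewrite -[isomorphic _ _]/(rclass pi rho) e; exact: isomorphic_refl.
apply/seteqP; split=> tau; apply: isomorphic_trans => //; exact: isomorphic_sym.
Qed.

Lemma irreducible_iso pi rho : isomorphic pi rho -> irreducible pi -> irreducible rho.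
Proof.
move=> /isomorphic_sym [J [Jb Jt]] [d0 irr].
have [A [B [AB BA _]]] : exists (A : 'M[C]_(rep_dim pi, rep_dim rho)) (B : 'M[C]_(rep_dim rho, rep_dim pi)),
  [/\ A *m B = 1%:M, B *m A = 1%:M & forall t, A *m rho t = pi t *m A].
  by apply: isomorphic_mx; exists J.
split.
  move: A B AB BA {J Jb Jt irr}; case: (rep_dim rho) => // A B AB.
  by move: AB; rewrite thinmx0 mul0mx => /matrixP/(_ (Ordinal d0) (Ordinal d0));
     rewrite !mxE eqxx => /eqP; rewrite eq_sym oner_eq0.
have [J' JK J'K] := Jb.
move=> W /linsubspaceP[W0 WD] Ws.
have [||W1|WT] := irr (J @` W).
- apply/linsubspaceP; split; first by exists 0 => //; rewrite linear0.
  by move=> a _ _ [u Wu <-] [v Wv <-]; exists (a *: u + v); [exact: WD|rewrite linearP].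
- by move=> t _ [u Wu <-]; exists (fdact t u); [exact: Ws|exact: Jt].
- left; apply/seteqP; split=> [v Wv|_ ->] //.
  have : [set 0 : 'cV[C]_(rep_dim pi)] (J v) by rewrite -W1; exists v.
  by move=> /= Jv; apply: (can_inj JK); rewrite Jv linear0.
right; apply/seteqP; split=> // v _.
have : (J @` W) (J v) by rewrite WT.
by case=> u Wu /(can_inj JK) <-.
Qed.

(** The kernel and the range of an intertwiner are invariant subspaces. *)
Lemma schur pi rho (T : 'M[C]_(rep_dim rho, rep_dim pi)) :
  irreducible pi -> irreducible rho -> (forall t, T *m pi t = rho t *m T) ->
  T <> 0 -> bijective (mulmx T : 'cV[C]_(rep_dim pi) -> 'cV[C]_(rep_dim rho)).
Proof.
move=> [_ ipi] [_ irho] Tt T0.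
apply: bij_of_inj_surj.
  have [||k0|kT] := ipi [set v | T *m v = 0].
  - apply/linsubspaceP; split => [|a u v] /=; first by rewrite mulmx0.
    by move=> Tu Tv; rewrite mulmxDr -scalemxAr Tu Tv scaler0 addr0.
  - by move=> t v /= Tv; rewrite /fdact mulmxA Tt -mulmxA Tv mulmx0.
  - move=> u v /eqP; rewrite -subr_eq0 -mulmxBr => /eqP Tuv.
    have : [set 0] (u - v) by rewrite -k0.
    by move=> /eqP; rewrite subr_eq0 => /eqP.
  - case: T0; apply/matrixP => i j.
    have : [set: 'cV[C]_(rep_dim pi)] (delta_mx j 0) by [].
    by rewrite -kT /= -colE => /colP/(_ i); rewrite !mxE.
have [||r0|rT] := irho (range (mulmx T)).
- apply/linsubspaceP; split => [|a _ _ [u _ <-] [v _ <-]]; first by exists 0; rewrite ?mulmx0.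
  by exists (a *: u + v); rewrite // mulmxDr -scalemxAr.
- by move=> t _ [v _ <-]; exists (pi t *m v); rewrite // /fdact !mulmxA Tt.
- case: T0; apply/matrixP => i j.
  have : range (mulmx T) (T *m delta_mx j (0 : 'I_1)) by exists (delta_mx j 0).
  by rewrite r0 /= -colE => /colP/(_ i); rewrite !mxE.
move=> w; have : [set: 'cV[C]_(rep_dim rho)] w by [].
rewrite -rT; by case=> v _ <-; exists v.
Qed.

Lemma schur_iso pi rho (T : 'M[C]_(rep_dim rho, rep_dim pi)) :
  irreducible pi -> irreducible rho -> (forall t, T *m pi t = rho t *m T) ->
  T <> 0 -> isomorphic pi rho.
Proof.
move=> ipi irho Tt T0; exists (mulmx T); split; first exact: schur.
by move=> t v; rewrite /fdact /= !mulmxA Tt.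
Qed.

(** An intertwiner minus one of its eigenvalues is not bijective. *)
Lemma schur_scalar pi (T : 'M[C]_(rep_dim pi)) :
  irreducible pi -> (forall t, T *m pi t = pi t *m T) -> exists a, T = a%:M.
Proof.
move=> ipi Tt; have [a /eigenvalueP[v vT v0]] := eigenvalue_closed T ipi.1.
exists a; apply/eqP; rewrite -subr_eq0; apply/negP => /negP/eqP Ta0.
have [|g _ gK] := schur ipi ipi _ Ta0.
  by move=> t; rewrite mulmxBl mulmxBr Tt mul_scalar_mx mul_mx_scalar.
have vTa : v *m (T - a%:M) = 0 by rewrite mulmxBr vT mul_mx_scalar subrr.
move/eqP: v0; apply; apply/rowP => j; rewrite !mxE.
have := congr1 (mulmx v) (gK (delta_mx j 0)).
by rewrite mulmxA vTa mul0mx -colE => /colP/(_ 0); rewrite !mxE.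
Qed.

End Schur.

(** * Complete reducibility *)

Section Decomposition.
Context {R : realType} {G : topologicalGroupType}.
Local Notation C := (Cplx R).
Implicit Types pi rho : fdrep R G.

(** An irreducible direct summand of pi, given by its inclusion and by an
    equivariant projection.  The summand is required to be unitary, since it
    is the unitary representatives that index the coordinates of the
    compactification. *)
Record component pi := Component {
  comp_rep :> fdrep R G;
  comp_in : 'M[C]_(rep_dim pi, rep_dim comp_rep);
  comp_out : 'M[C]_(rep_dim comp_rep, rep_dim pi);
  comp_unitary : unitary_rep comp_rep;
  comp_irr : irreducible comp_rep;
  comp_inE : forall t, pi t *m comp_in = comp_in *m comp_rep t;
  comp_outE : forall t, comp_out *m pi t = comp_rep t *m comp_out;
  comp_outK : comp_out *m comp_in = 1%:M
}.

Section Lift.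
Variables (pi : fdrep R G) (d : nat).
Variables (A : 'M[C]_(d, rep_dim pi)) (B : 'M[C]_(rep_dim pi, d)).
Hypothesis AB1 : A *m B = 1%:M.
Hypothesis BAC : forall t, B *m A *m pi t = pi t *m (B *m A).
Let rho := sandwich_rep AB1 BAC.

Lemma sandwich_in t : pi t *m B = B *m rho t.
Proof. by rewrite /= !mulmxA BAC -!mulmxA AB1 mulmx1. Qed.

Lemma sandwich_out t : A *m pi t = rho t *m A.
Proof. by rewrite /= -!mulmxA -BAC !mulmxA AB1 mul1mx. Qed.

Let lift_inE (c : component rho) t : pi t *m (B *m comp_in c) = (B *m comp_in c) *m c t.
Proof. by rewrite mulmxA sandwich_in -(mulmxA B (rho t)) (comp_inE c t) mulmxA. Qed.

Let lift_outE (c : component rho) t : (comp_out c *m A) *m pi t = c t *m (comp_out c *m A).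
Proof. by rewrite -mulmxA sandwich_out (mulmxA _ (rho t)) (comp_outE c t) -mulmxA. Qed.

Let lift_outK (c : component rho) : (comp_out c *m A) *m (B *m comp_in c) = 1%:M.
Proof. by rewrite mulmxA -(mulmxA _ A B) AB1 mulmx1 comp_outK. Qed.

Definition lift_component (c : component rho) : component pi :=
  Component (@comp_unitary _ c) (@comp_irr _ c) (lift_inE c) (lift_outE c) (lift_outK c).

End Lift.

(** The inductive step of [decomposition]: the components of the range of an
    equivariant projection P, of smaller dimension, are components of pi, and
    they add up to P. *)
Lemma commuting_idem_components pi (P : 'M[C]_(rep_dim pi)) :
  (forall rho, (rep_dim rho < rep_dim pi)%N ->
     exists l : seq (component rho), \sum_(c <- l) comp_in c *m comp_out c = 1%:M) ->
  P *m P = P -> (forall t, pi t *m P = P *m pi t) -> (\rank P < rep_dim pi)%N ->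
  exists l : seq (component pi), \sum_(c <- l) comp_in c *m comp_out c = P.
Proof.
move=> IH PP Pt rP.
pose A := row_base P; pose B := col_base P.
have BA : B *m A = P by exact: mulmx_base.
have AB : A *m B = 1%:M.
  have e : B *m (A *m B) *m A = B *m 1%:M *m A.
    by rewrite mulmx1 (mulmxA B A B) BA -(mulmxA P B A) BA PP.
  exact: (row_full_inj (col_base_full P) (row_free_inj (row_base_free P) e)).
have BAC t : B *m A *m pi t = pi t *m (B *m A) by rewrite BA Pt.
have [l lE] := IH (sandwich_rep AB BAC) rP.
exists (map (lift_component (BAC := BAC)) l); rewrite big_map /=.
transitivity (B *m (\sum_(c <- l) comp_in c *m comp_out c) *m A).
  rewrite mulmx_sumr mulmx_suml; apply: eq_bigr => c _.
  by rewrite [LHS]mulmxA; congr (_ *m _); rewrite -mulmxA.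
by rewrite lE mulmx1.
Qed.

Lemma unitary_representative pi :
  exists rho : fdrep R G, unitary_rep rho /\ isomorphic pi rho.
Proof.
have [A [B [AB BA ABu]]] := unitarize pi.
have BAC t : B *m A *m pi t = pi t *m (B *m A) by rewrite BA mul1mx mulmx1.
exists (sandwich_rep AB BAC); split; first exact: ABu.
by apply: (@mx_isomorphic _ _ _ (sandwich_rep AB BAC) A B) => // t; exact: sandwich_out.
Qed.

(** A proper invariant subspace has an invariant complement by [maschke];
    induct on the dimension. *)
Lemma decomposition pi :
  exists l : seq (component pi), \sum_(c <- l) comp_in c *m comp_out c = 1%:M.
Proof.
have [n] := ubnP (rep_dim pi); elim: n pi => // n IH pi; rewrite ltnS => dn.
have {}IH rho : (rep_dim rho < rep_dim pi)%N ->
     exists l : seq (component rho), \sum_(c <- l) comp_in c *m comp_out c = 1%:M.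
  by move=> h; apply: IH; exact: leq_trans dn.
have [d0|d0] := posnP (rep_dim pi).
  exists [::]; rewrite big_nil; apply/matrixP => i.
  by have := ltn_ord i; rewrite [X in (_ < X)%N]d0.
have [ipi|nipi] := pselect (irreducible pi).
  have [A [B [AB BA ABu]]] := unitarize pi.
  have BAC t : B *m A *m pi t = pi t *m (B *m A) by rewrite BA mul1mx mulmx1.
  pose rho := sandwich_rep AB BAC.
  have irho : irreducible rho.
    apply: irreducible_iso ipi; apply: (@mx_isomorphic _ _ _ rho A B) => // t.
    exact: sandwich_out.
  exists [:: @Component pi rho B A ABu irho (sandwich_in AB BAC) (sandwich_out AB BAC) AB].
  by rewrite big_seq1.
have [W [Wl Ws W0 WT]] : exists W, [/\ linsubspace W, stable_under (@fdact _ _ pi) W,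
    W <> [set 0] & W <> setT].
  apply: contrapT => h; apply: nipi; split => // W Wl Ws.
  apply: contrapT => /not_orP[W0 WT]; apply: h; exists W; split => //.
have [P0 [P00 WP0]] := linsubspace_idem Wl.
have P0s t : P0 *m pi t *m P0 = pi t *m P0.
  apply/matrixP => i j.
  have h : P0 *m (pi t *m (P0 *m delta_mx j 0)) = pi t *m (P0 *m delta_mx j (0 : 'I_1)).
    by apply/WP0/(Ws t)/WP0; rewrite mulmxA P00.
  by move: h; rewrite !mulmxA -!colE => /colP/(_ i); rewrite !mxE.
have [P [P0P PP0 PP Pt]] := maschke P00 P0s.
have ltP (Q Q' : 'M[C]_(rep_dim pi)) : Q *m Q' = 0 -> Q' <> 0 -> (\rank Q < rep_dim pi)%N.
  move=> QQ' Q'0; rewrite ltn_neqAle rank_leq_row andbT; apply/eqP => rQ; apply: Q'0.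
  have Qu : Q \in unitmx by rewrite -row_free_unit /row_free rQ.
  by rewrite -(mulKmx Qu Q') QQ' mulmx0.
have [l1 l1E] : exists l : seq (component pi), \sum_(c <- l) comp_in c *m comp_out c = P.
  apply: commuting_idem_components => //; apply: (ltP _ (1%:M - P)).
    by rewrite mulmxBr mulmx1 PP subrr.
  move=> /eqP; rewrite subr_eq0 => /eqP P1; apply: WT; apply/seteqP; split => // v _.
  have P01 : P0 = 1%:M by rewrite -[LHS]mulmx1 P1 P0P.
  by apply/WP0; rewrite P01 mul1mx.
have [l2 l2E] : exists l : seq (component pi), \sum_(c <- l) comp_in c *m comp_out c = 1%:M - P.
  apply: commuting_idem_components => //.
  - by rewrite mulmxBr mulmx1 mulmxBl mul1mx PP subrr subr0.
  - by move=> t; rewrite mulmxBr mulmxBl mulmx1 mul1mx Pt.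
  apply: (ltP _ P); first by rewrite mulmxBl mul1mx PP subrr.
  move=> P_0; apply: W0; apply/seteqP; split=> v /=.
    by move=> /WP0 <-; rewrite -PP0 P_0 !mul0mx.
  by move=> ->; case/linsubspaceP: Wl.
by exists (l1 ++ l2); rewrite big_cat /= l1E l2E addrC subrK.
Qed.

End Decomposition.

(** * Equivariant functions and multiplicities *)

Section ContinuousMatrices.
Context {R : realType} {X : topologicalType}.
Local Notation C := (Cplx R).

Definition ctsmx m n (F : X -> 'M[C]_(m, n)) :=
  forall i j, continuous (fun x => F x i j).

Lemma cts_sum (I : Type) (r : seq I) (f : I -> X -> C) :
  (forall i, continuous (f i)) -> continuous (fun x => \sum_(i <- r) f i x).
Proof.
by move=> fc x; apply: cvg_big => [|i _]; [exact: add_continuous|exact: fc].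
Qed.

Lemma ctsM (f g : X -> C) : continuous f -> continuous g ->
  continuous (fun x => f x * g x).
Proof. by move=> fc gc x; apply: cvgM; [exact: fc|exact: gc]. Qed.

Lemma ctsC (c : C) : continuous (fun _ : X => c).
Proof. by move=> x; exact: cvg_cst. Qed.

Lemma cts_conj (f : X -> C) : continuous f -> continuous (fun x => (f x)^*).
Proof.
move=> fc x; apply/cvgrPdist_lt => e e0.
have /cvgrPdist_lt/(_ e e0) := fc x.
by apply: filterS => y; rewrite -rmorphB norm_conjC.
Qed.

Lemma ctsmx_mul m n p (F : X -> 'M[C]_(m, n)) (H : X -> 'M[C]_(n, p)) :
  ctsmx F -> ctsmx H -> ctsmx (fun x => F x *m H x).
Proof.
move=> Fc Hc i j.
have -> : (fun x => (F x *m H x) i j) = (fun x => \sum_k F x i k * H x k j).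
  by apply/funext => x; rewrite mxE.
by apply: cts_sum => k; apply: ctsM; [exact: Fc|exact: Hc].
Qed.

Lemma ctsmx_cst m n (A : 'M[C]_(m, n)) : ctsmx (fun _ => A).
Proof. by move=> i j; exact: ctsC. Qed.

Lemma ctsmx_adj m n (F : X -> 'M[C]_(m, n)) : ctsmx F -> ctsmx (fun x => adj (F x)).
Proof.
move=> Fc i j.
have -> : (fun x => adj (F x) i j) = (fun x => (F x j i)^*).
  by apply/funext => x; rewrite !mxE.
exact: cts_conj.
Qed.

End ContinuousMatrices.

Arguments ctsmx_mul {R X m n p F H} _ _.
Arguments ctsmx_cst {R X m n} A.
Arguments ctsmx_adj {R X m n F} _.

Section Equivariant.
Context {R : realType} {G : topologicalGroupType}.
Local Notation C := (Cplx R).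
Implicit Types (pi rho : fdrep R G) (X : tds G).

Definition equivariant X pi m (F : X -> 'M[C]_(m, rep_dim pi)) :=
  ctsmx F /\ forall t x, F (tds_act t x) = F x *m pi t^-1%g.

(** This is the injectivity of the map which sends a family (v k) of vectors
    to the scalar function with value at x the sum of the (F x *m v k) k 0,
    that is, of the embedding of n copies of pi that F stands for. *)
Definition free_entries (X : Type) m n (F : X -> 'M[C]_(m, n)) :=
  forall v : 'I_m -> 'cV[C]_n,
    (forall x, \sum_k (F x *m v k) k 0 = 0) -> forall k, v k = 0.

Definition embeds n pi X :=
  isom_to_subrep (@dsum R G n pi) (@ctsfun R G X) (@koopman R G X).

(** The rows of F are the images under an embedding J of the standard basis
    vectors of each copy: row k, column l holds J(e k l).  Equivariance of J
    is the transformation rule of F. *)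
Lemma embedsP n pi X : embeds n pi X <->
  exists F : X -> 'M[C]_(n, rep_dim pi), equivariant F /\ free_entries F.
Proof.
split.
  case=> W [Wc _ _ [J [Ji JW Jt]]].
  pose e k l : {ffun 'I_n -> 'cV[C]_(rep_dim pi)} :=
    [ffun k' => if k' == k then delta_mx l 0 else 0].
  pose F (x : X) : 'M[C]_(n, rep_dim pi) := \matrix_(k, l) J (e k l) x.
  have JF v x : J v x = \sum_k (F x *m v k) k 0.
    have {1}-> : v = \sum_k \sum_l v k l 0 *: e k l.
      apply/ffunP => k; rewrite sum_ffunE (bigD1 k) //= [X in _ + X]big1 ?addr0 => [|k' k'k]; last first.
        rewrite sum_ffunE big1 // => l _.
        by rewrite !ffunE eq_sym (negPf k'k) scaler0.
      rewrite sum_ffunE [LHS](matrix_sum_delta (v k)); apply: eq_bigr => l _.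
      by rewrite big_ord1 !ffunE eqxx.
    rewrite linear_sum fct_sumE; apply: eq_bigr => k _.
    rewrite linear_sum fct_sumE mxE; apply: eq_bigr => l _.
    by rewrite linearZ mxE mulrC.
  exists F; split; last first.
    move=> v v0; have : [ffun k => v k] = 0.
      apply: Ji; rewrite linear0; apply/funext => x; rewrite JF -[RHS](v0 x).
      by apply: eq_bigr => k _; rewrite ffunE.
    by move=> /ffunP v00 k; have := v00 k; rewrite !ffunE.
  split=> [k l|t x].
    have -> : (fun x => F x k l) = J (e k l) by apply/funext => x; rewrite mxE.
    by apply: Wc; rewrite -JW; exists (e k l).
  apply/matrixP => k l; rewrite mxE.
  have -> : J (e k l) (tds_act t x) = koopman t^-1%g (J (e k l)) x.
    by rewrite /koopman invgK.
  rewrite -Jt JF (bigD1 k) //= big1 ?addr0 => [|k' k'k]; last first.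
    by rewrite !ffunE (negPf k'k) /fdact !mulmx0 mxE.
  by rewrite !ffunE eqxx /fdact mulmxA -colE mxE.
case=> F [[Fc Ft] Ff].
pose J (v : {ffun 'I_n -> 'cV[C]_(rep_dim pi)}) : X -> C :=
  fun x => \sum_k (F x *m v k) k 0.
have Jc v : continuous (J v).
  by apply: cts_sum => k; exact: (ctsmx_mul Fc (ctsmx_cst (v k)) k 0).
have Jl : linear J.
  move=> a u v; apply/funext => x; rewrite /J -[RHS]/(a * _ + _) mulr_sumr -big_split.
  by apply: eq_bigr => k _; rewrite !ffunE mulmxDr -scalemxAr !mxE.
pose JL : {linear {ffun 'I_n -> 'cV[C]_(rep_dim pi)} -> (X -> C)} :=
  HB.pack J (GRing.isLinear.Build C _ _ _ J Jl).
have Jt t v : J (dsum t v) = koopman t (J v).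
  apply/funext => x; rewrite /koopman /J; apply: eq_bigr => k _.
  by rewrite Ft invgK ffunE /fdact mulmxA.
exists (range J); split.
- by move=> _ [v _ <-]; exact: Jc.
- apply/linsubspaceP; split=> [|a _ _ [u _ <-] [v _ <-]].
    by exists 0 => //; exact: (linear0 JL).
  by exists (a *: u + v); rewrite // Jl.
- by move=> t _ [v _ <-]; exists (dsum t v); rewrite // Jt.
exists JL; split => //.
move=> u v /= uv; apply/ffunP => k; apply/eqP; rewrite -subr_eq0; apply/eqP.
apply: (Ff (fun k => u k - v k)) => x.
rewrite -[RHS](subrr (J v x)) -{1}uv /J -sumrB; apply: eq_bigr => i _.
by rewrite mulmxBr !mxE.
Qed.

Lemma embeds0 pi X : embeds 0 pi X.
Proof.
apply/embedsP; exists (fun _ => 0); split; last by move=> v _ [].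
by split=> [i|t x]; [case: i|rewrite mul0mx].
Qed.

Lemma embeds_le_mult n pi X : embeds n pi X -> (n%:R%:E <= multiplicity X pi)%E.
Proof. by move=> h; apply: ereal_sup_ubound; exists n. Qed.

Lemma mult_eq_embeds n pi X : multiplicity X pi = n%:R%:E -> embeds n pi X.
Proof.
case: n => [_|n mn]; first exact: embeds0.
have [k kh kn] : exists2 k, embeds k pi X & (n < k)%N.
  apply: contrapT => h.
  have : (multiplicity X pi <= n%:R%:E)%E.
    apply: ge_ereal_sup => _ [k kh <-]; rewrite lee_fin ler_nat leqNgt.
    by apply/negP => nk; apply: h; exists k.
  by rewrite mn lee_fin ler_nat ltnn.
have := embeds_le_mult kh; rewrite mn lee_fin ler_nat => kn1.
by have -> : n.+1 = k by apply/eqP; rewrite eqn_leq kn kn1.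
Qed.

Lemma embeds_iso n pi rho X : isomorphic pi rho -> embeds n pi X -> embeds n rho X.
Proof.
move=> /isomorphic_mx[A [B [AB BA At]]] /embedsP[F [[Fc Ft] Ff]].
have Bt t : pi t *m B = B *m rho t.
  by rewrite -[LHS]mul1mx -BA -!mulmxA (mulmxA A) At -mulmxA AB mulmx1.
apply/embedsP; exists (fun x => F x *m B); split.
  split; first exact: (ctsmx_mul Fc (ctsmx_cst B)).
  by move=> t x; rewrite Ft -!mulmxA Bt.
move=> v v0 k; rewrite -[v k]mul1mx -AB -mulmxA.
rewrite (Ff (fun k => B *m v k)) ?mulmx0 // => x.
by rewrite -[RHS](v0 x); apply: eq_bigr => i _; rewrite mulmxA.
Qed.

Lemma multiplicity_iso pi rho X : isomorphic pi rho ->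
  multiplicity X pi = multiplicity X rho.
Proof.
move=> h; congr ereal_sup; apply/seteqP; split=> _ [n nh <-]; exists n => //.
  exact: embeds_iso nh.
by apply: embeds_iso nh; exact: isomorphic_sym.
Qed.

(** For an irreducible pi, a single nonzero equivariant row is an embedding:
    the vectors that it annihilates at all points form a proper invariant
    subspace. *)
Lemma mult_gt0P pi X : irreducible pi -> (0 < multiplicity X pi)%E <->
  exists j : X -> 'rV[C]_(rep_dim pi), equivariant j /\ exists x, j x <> 0.
Proof.
move=> [d0 ipi]; split.
  move=> m0; have [n nh n0] : exists2 n, embeds n pi X & (0 < n)%N.
    apply: contrapT => h; move: m0; rewrite ltNge => /negP; apply.
    apply: ge_ereal_sup => _ [k kh <-]; rewrite lee_fin (ler_nat _ k 0) leqNgt.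
    by apply/negP => k0; apply: h; exists k.
  case/embedsP: nh => F [[Fc Ft] Ff]; pose k0 := Ordinal n0.
  exists (fun x => row k0 (F x)); split.
    split=> [i j|t x]; last by rewrite Ft row_mul.
    rewrite (_ : (fun x => _) = fun x => F x k0 j) //.
    by apply/funext => x; rewrite mxE.
  apply: contrapT => j0; pose l0 := Ordinal d0.
  have := Ff (fun k => if k == k0 then delta_mx l0 0 else 0) _ k0.
  rewrite eqxx => /(_ _)/matrixP/(_ l0 0); rewrite !mxE !eqxx /= => h.
  have /eqP := oner_neq0 C; apply; apply: h => x.
  rewrite (bigD1 k0) //= big1 ?addr0 => [|k kk0]; last by rewrite (negPf kk0) mulmx0 mxE.
  rewrite ?eqxx -colE mxE; apply/eqP/negP => /negP/eqP Fx; apply: j0; exists x.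
  by move=> /rowP/(_ l0); rewrite !mxE.
case=> j [[jc jt] [x0 jx0]].
suff h : embeds 1 pi X by apply: lt_le_trans (embeds_le_mult h); rewrite lte_fin.
apply/embedsP; exists j; split; first by split.
move=> v v1 k; rewrite {k}ord1.
have v0 x : (j x *m v 0) 0 0 = 0 by have := v1 x; rewrite big_ord1.
pose K := [set w : 'cV[C]_(rep_dim pi) | forall x, (j x *m w) 0 0 = 0].
have [||K0|KT] := ipi K.
- apply/linsubspaceP; split => [x|a u w Ku Kw x]; first by rewrite mulmx0 mxE.
  by rewrite mulmxDr -scalemxAr mxE mxE Ku Kw mulr0 addr0.
- move=> t w Kw x; rewrite /fdact mulmxA.
  by have := Kw (tds_act t^-1%g x); rewrite jt invgK.
- by have : K (v 0) by []; rewrite K0.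
case: jx0; apply/rowP => i; have : [set: 'cV[C]_(rep_dim pi)] (delta_mx i 0) by [].
by rewrite -KT => /(_ x0); rewrite -colE !mxE.
Qed.

Lemma equivariant_mulr X pi m (F : X -> 'M[C]_(m, rep_dim pi)) p (A : 'M[C]_(p, m)) :
  equivariant F -> equivariant (fun x => A *m F x).
Proof.
move=> [Fc Ft]; split=> [|t x]; first exact: (ctsmx_mul (ctsmx_cst A) Fc).
by rewrite Ft mulmxA.
Qed.

End Equivariant.

(** * Ergodicity and frames *)

Section Ergodic.
Context {R : realType} {G : topologicalGroupType}.
Local Notation C := (Cplx R).
Implicit Types (pi rho : fdrep R G) (X : tds G).

(** Equivalently, the trivial representation occurs in C(X) through the
    constants only. *)
Definition ergodic X := forall g : X -> C, continuous g ->
  (forall t x, g (tds_act t x) = g x) -> forall x y, g x = g y.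

Lemma ergodic_mx X m n (F : X -> 'M[C]_(m, n)) : ergodic X -> ctsmx F ->
  (forall t x, F (tds_act t x) = F x) -> forall x y, F x = F y.
Proof.
move=> eX Fc Ft x y; apply/matrixP => i j.
by apply: (eX (fun x => F x i j)) => [|t z]; [exact: Fc|rewrite Ft].
Qed.

Lemma triv_irreducible : irreducible (@triv_rep R G).
Proof.
split=> // W /linsubspaceP[W0 WD] _.
have [[v [Wv v0]]|h] := pselect (exists v, W v /\ v <> 0); last first.
  left; apply/seteqP; split=> [v Wv|_ ->] //=.
  by apply: contrapT => v0; apply: h; exists v.
right; apply/seteqP; split => // w _.
have v00 : v 0 0 != 0.
  by apply/eqP => e; apply: v0; apply/colP => i; rewrite ord1 e mxE.
rewrite -[w]addr0.
have -> : w = (w 0 0 / v 0 0) *: v.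
  by apply/colP => i; rewrite ord1 mxE divfK.
exact: WD.
Qed.

Lemma normal_mult_triv X : normal_tds R X -> multiplicity X (@triv_rep R G) = 1%:E.
Proof.
move=> [_ [_ _ _ [pi [ipi mpi] /rclass_eq h]] md].
have [m0|//] := md _ triv_irreducible.
by move: mpi; rewrite (multiplicity_iso X h) m0 ltxx.
Qed.

(** An invariant function which is not constant would be linearly independent
    of the constant 1, and the trivial representation would embed twice. *)
Lemma normal_ergodic X : normal_tds R X -> ergodic X.
Proof.
move=> /normal_mult_triv m1 g gc gt x y; apply: contrapT => gxy.
have : embeds 2 (@triv_rep R G) X.
  pose F (z : X) : 'M[C]_(2, 1) := \matrix_(k, l) if k == 0 then 1 else g z.
  apply/embedsP; exists F; split; first split.
  - move=> k l; have -> : (fun z => F z k l) = (fun z => if k == 0 then 1 else g z).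
      by apply/funext => z; rewrite mxE.
    by case: (k == 0); [exact: ctsC|exact: gc].
  - by move=> t z; rewrite /= mulmx1; apply/matrixP => k l; rewrite !mxE gt.
  move=> v v0; pose w k : C := (v k : 'cV[C]_1) ord0 ord0.
  have vE z : w ord0 + g z * w ord_max = 0.
    have := v0 z; rewrite big_ord_recl big_ord1 !mxE !big_ord1 !mxE /= mul1r => <-.
    by congr (_ + _ * (v _ : 'cV[C]_1) _ _); apply/val_inj.
  have w1 : w ord_max = 0.
    have /eqP : (g x - g y) * w ord_max = 0.
      by rewrite mulrBl; have := vE x; rewrite -(vE y) => /addrI ->; rewrite subrr.
    by rewrite mulf_eq0 subr_eq0 => /orP[/eqP //|/eqP].
  have w0 : w ord0 = 0 by have := vE x; rewrite w1 mulr0 addr0.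
  have wk k : w k = 0.
    by case: k => -[|[|//]] p; [rewrite -w0|rewrite -w1]; congr w; apply/val_inj.
  by move=> k; apply/colP => i; rewrite (ord1 i) mxE; exact: wk.
by move=> /embeds_le_mult; rewrite m1 lee_fin (ler_nat _ 2 1).
Qed.

Lemma normal_point X : normal_tds R X -> exists x : X, True.
Proof.
move=> /normal_mult_triv m1; apply: contrapT => h.
have : (0 < multiplicity X (@triv_rep R G))%E by rewrite m1 lte_fin.
by move=> /(mult_gt0P _ triv_irreducible)[j [_ [x _]]]; apply: h; exists x.
Qed.

(** On an ergodic system the rows of F form a basis of the equivariant row
    functions of type pi; this basis is orthonormal at every point. *)
Definition frame X pi (F : X -> 'M[C]_(rep_dim pi)) :=
  equivariant F /\ forall x, F x *m adj (F x) = 1%:M.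

Lemma frame_adjK X pi (F : X -> 'M[C]_(rep_dim pi)) x :
  frame F -> adj (F x) *m F x = 1%:M.
Proof. by move=> [_ /(_ x)]; exact: mulmx1C. Qed.

(** F F^* is invariant, hence constant.  If it were singular, some fixed
    combination of the rows of F would vanish everywhere, against freeness.
    So F(x0) is invertible, and F(x0)^-1 F is the frame. *)
Lemma frame_exists X (x0 : X) pi : ergodic X -> unitary_rep pi ->
  embeds (rep_dim pi) pi X -> exists F, frame (X := X) (pi := pi) F /\ F x0 = 1%:M.
Proof.
move=> eX piu /embedsP[F [Fe Ff]]; have [Fc Ft] := Fe.
have FF x y : F x *m adj (F x) = F y *m adj (F y).
  apply: (ergodic_mx eX (F := fun x => F x *m adj (F x))) => [|t z].
    exact: (ctsmx_mul Fc (ctsmx_adj Fc)).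
  by rewrite Ft adjM mulmxA -(mulmxA (F z)) piu mulmx1.
have Fu : F x0 \in unitmx.
  rewrite -row_free_unit -kermx_eq0; apply/eqP/row_matrixP => i; rewrite row0.
  set a := row i _.
  have aF0 : a *m F x0 = 0 by rewrite -row_mul mulmx_ker row0.
  have aF x : a *m F x = 0.
    apply: fro_eq0; apply: (@complexI R); rewrite -rV_mul_adj adjM mulmxA.
    by rewrite -(mulmxA a) (FF x x0) mulmxA aF0 !mul0mx mxE.
  have h (w : 'cV_(rep_dim pi)) k : a 0 k *: w = 0.
    apply: (Ff (fun k => a 0 k *: w)) => x.
    have /matrixP/(_ 0 0) : a *m F x *m w = 0 by rewrite aF mul0mx.
    rewrite -mulmxA [in RHS]mxE => e; rewrite -[RHS]e [RHS]mxE; apply: eq_bigr => l _.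
    by rewrite -scalemxAr mxE.
  apply/rowP => k; have /colP/(_ k) := h (delta_mx k 0) k.
  by rewrite !mxE !eqxx mulr1 => ->.
exists (fun x => invmx (F x0) *m F x); split; last exact: mulVmx.
split; first exact: (equivariant_mulr (invmx (F x0)) Fe).
move=> x; rewrite adjM mulmxA -(mulmxA _ (F x)) (FF x x0) mulmxA mulVmx // mul1mx.
by rewrite -adjM mulVmx // adjmx1.
Qed.

(** The matrix j F^* is invariant, hence constant: the coefficients of j on the
    frame do not depend on the point. *)
Lemma frame_factor X pi (F : X -> 'M[C]_(rep_dim pi)) m
    (j : X -> 'M[C]_(m, rep_dim pi)) : ergodic X -> unitary_rep pi ->
  frame F -> equivariant j -> forall x y, j x = j y *m adj (F y) *m F x.
Proof.
move=> eX piu Ff [jc jt] x y; have [[Fc Ft] Fu] := Ff.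
have -> : j y *m adj (F y) = j x *m adj (F x); last first.
  by rewrite -mulmxA frame_adjK // mulmx1.
apply: (ergodic_mx eX (F := fun x => j x *m adj (F x))) => [|t z].
  exact: (ctsmx_mul jc (ctsmx_adj Fc)).
by rewrite jt Ft adjM mulmxA -(mulmxA (j z)) piu mulmx1.
Qed.

(** By [frame_factor] the rows of an embedding are constant combinations of
    the rows of the frame, of which there are only rep_dim pi. *)
Lemma frame_embeds_le X pi (F : X -> 'M[C]_(rep_dim pi)) n : ergodic X ->
  unitary_rep pi -> frame F -> (exists x : X, True) -> irreducible pi ->
  embeds n pi X -> (n <= rep_dim pi)%N.
Proof.
move=> eX piu Ff [x0 _] ipi /embedsP[j [je jf]].
pose A := j x0 *m adj (F x0).
rewrite leqNgt; apply/negP => dn.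
have : kermx A != 0.
  by rewrite kermx_eq0 /row_free neq_ltn (leq_ltn_trans (rank_leq_col _) dn).
move=> /eqP; apply; apply/row_matrixP => i; rewrite row0.
set a := row i _; have aA : a *m A = 0 by rewrite -row_mul mulmx_ker row0.
have h (w : 'cV_(rep_dim pi)) k : a 0 k *: w = 0.
  apply: (jf (fun k => a 0 k *: w)) => x.
  have /matrixP/(_ 0 0) : a *m (j x *m w) = 0.
    by rewrite (frame_factor eX piu Ff je x x0) -/A -(mulmxA A) (mulmxA a) aA mul0mx.
  rewrite [in RHS]mxE => e; rewrite -[RHS]e [RHS]mxE; apply: eq_bigr => l _.
  by rewrite -scalemxAr mxE.
apply/rowP => k; have /colP/(_ (Ordinal ipi.1)) := h (delta_mx (Ordinal ipi.1) 0) k.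
by rewrite !mxE !eqxx mulr1 => ->.
Qed.

End Ergodic.

(** * Finite-dimensional invariant subspaces of C(X) *)

(** Otherwise the complements in K of the sets with property P would generate a
    proper filter without cluster point. *)
Lemma compact_induction (T : topologicalType) (K : set T) (P : set T -> Prop) :
  compact K -> P set0 -> (forall U V, P U -> P V -> P (U `|` V)) ->
  (forall x, K x -> exists2 U, nbhs x U & P U) -> exists2 U, K `<=` U & P U.
Proof.
move=> Kc P0 PU Px; apply: contrapT => h.
pose F := filter_from P (fun U => K `\` U).
have FF : ProperFilter F.
  apply: filter_from_proper.
    apply: filter_from_filter; first by exists set0.
    move=> U V PU' PV; exists (U `|` V); first exact: PU.
    by move=> x [Kx /not_orP[nU nV]]; split.
  move=> U PU'; apply/set0P/eqP => KU; apply: h; exists U => //.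
  by move=> x Kx; apply: contrapT => nU; have : (K `\` U) x by []; rewrite KU.
have [|x [Kx Fx]] := Kc F FF; first by exists set0 => // x [].
have [U Ux PU'] := Px x Kx.
by have [|y [[_ nU] Uy]] := Fx (K `\` U) U _ Ux; [exists U|exact: nU].
Qed.

Lemma continuous_bounded (K : numFieldType) (V : pseudoMetricNormedZmodType K)
    (T : topologicalType) (f : T -> V) :
  compact [set: T] -> continuous f -> exists M, forall x, `|f x| <= M.
Proof.
move=> Tc fc.
have [|||U TU [M _ UM]] := @compact_induction T setT
  (fun U => exists2 M : K, 0 <= M & forall x, U x -> `|f x| <= M) Tc.
- by exists 0.
- move=> U V' [M M0 UM] [N N0 VN]; exists (M + N) => [|x [/UM|/VN] h].
  + exact: addr_ge0.
  + exact: ler_wpDr.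
  + exact: ler_wpDl.
- move=> x _; exists [set y | `|f x - f y| < 1].
    by have /cvgrPdist_lt/(_ 1 ltr01) := fc x.
  exists (`|f x| + 1) => [|y /= fxy]; first exact: addr_ge0.
  have -> : f y = f x - (f x - f y) by rewrite opprB addrC subrK.
  by apply: (le_trans (ler_normB _ _)); rewrite lerD2l ltW.
by exists M => x; apply: UM; exact: TU.
Qed.

Section FiniteDimensionalSubspaces.
Context {R : realType} {G : topologicalGroupType}.
Local Notation C := (Cplx R).

Variables (X : tds G) (W : set (X -> C)).
Hypothesis Wcts : W `<=` @ctsfun R G X.
Hypothesis Wlin : linsubspace W.
Hypothesis Wfin : findim W.
Hypothesis Wstable : stable_under (@koopman R G X) W.

Let W0 : W 0. Proof. by case/linsubspaceP: Wlin. Qed.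
Let WZ a u : W u -> W (a *: u).
Proof. by case/linsubspaceP: Wlin => _ h Wu; rewrite -[_ *: _]addr0; exact: h. Qed.
Let WD u v : W u -> W v -> W (u + v).
Proof. by case/linsubspaceP: Wlin => _ h Wu Wv; rewrite -[u]scale1r; exact: h. Qed.
Let WS n (u : 'I_n -> X -> C) : (forall i, W (u i)) -> W (\sum_i u i).
Proof. by move=> Wu; elim/big_ind: _. Qed.

(** Points x k and functions e i of W which are dual to each other.  A maximal
    such system gives a basis of W whose coordinates are values at points, so
    that the matrices of the Koopman action inherit continuity and
    boundedness from the functions in W. *)
Definition dual_system r (x : 'I_r -> X) (e : 'I_r -> X -> C) :=
  (forall i, W (e i)) /\ forall i k, e i (x k) = (i == k)%:R.

Let dual_system_bound : exists n, forall r x e, @dual_system r x e -> (r <= n)%N.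
Proof.
case: Wfin => n [b Wb]; exists n => r x e [We ex].
have coef i : exists a : 'I_n -> C, e i = \sum_j a j *: b j.
  by have := We i; rewrite Wb => -[a _ <-]; exists a.
have [A AE] := choice coef.
apply: (@mulmx1_min C r n (\matrix_(k, j) b j (x k)) (\matrix_(j, i) A i j)).
apply/matrixP => k i; rewrite !mxE eq_sym -ex AE fct_sumE; apply: eq_bigr => j _.
by rewrite !mxE mulrC.
Qed.

Let dual_extend r x e w : @dual_system r x e -> W w ->
  w <> \sum_i w (x i) *: e i ->
  exists x' e', @dual_system r.+1 x' e'.
Proof.
move=> [We ex] Ww nw.
pose w' : X -> C := w - \sum_i w (x i) *: e i.
have Ww' : W w'.
  by apply: WD => //; rewrite -scaleN1r; apply/WZ/WS => i; exact: WZ.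
have w'x k : w' (x k) = 0.
  rewrite /w' -[LHS]/(w (x k) - (\sum_i w (x i) *: e i) (x k)) fct_sumE (bigD1 k) //=.
  rewrite big1 ?addr0 => [|i ik]; last by rewrite -[LHS]/(_ * _) ex (negPf ik) mulr0.
  by rewrite -[(w (x k) *: e k) (x k)]/(w (x k) * e k (x k)) ex eqxx mulr1 subrr.
have [y y0] : exists y, w' y <> 0.
  apply: contrapT => h; apply: nw; apply/eqP; rewrite -subr_eq0; apply/eqP.
  by apply/funext => y; apply: contrapT => y0; apply: h; exists y.
have {}y0 : w' y != 0 by apply/eqP.
exists (fun k => if unlift ord0 k is Some k' then x k' else y).
exists (fun i => if unlift ord0 i is Some i' then e i' - (e i' y / w' y) *: w'
                 else (w' y)^-1 *: w').
split=> [i|i k].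
  case: unliftP => [i' _|_]; last exact: WZ.
  by apply: WD => //; rewrite -scaleN1r; do 2!apply: WZ.
case: unliftP => [i' ->|->]; case: unliftP => [k' ->|->].
- rewrite -[LHS]/(e i' (x k') - (e i' y / w' y) * w' (x k')) w'x mulr0 subr0 ex.
  by rewrite (inj_eq lift_inj).
- by rewrite -[LHS]/(e i' y - (e i' y / w' y) * w' y) divfK // subrr.
- by rewrite -[LHS]/(_ * w' (x k')) w'x mulr0.
- by rewrite -[LHS]/(_ * w' y) mulVf // eqxx.
Qed.

Lemma dual_system_exists : exists r x e, @dual_system r x e /\
  forall w, W w -> w = \sum_i w (x i) *: e i.
Proof.
have [n nb] := dual_system_bound.
pose Q r := `[< exists x e, @dual_system r x e >].
have Q0 : exists r, Q r.
  have x0 : 'I_0 -> X by case.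
  by exists 0%N; apply/asboolP; exists x0, (fun _ => 0); split=> -[].
have [|r /asboolP[x [e xe]] rmax] := ex_maxnP Q0 (m := n).
  by move=> r /asboolP[x [e xe]]; exact: nb xe.
exists r, x, e; split => // w Ww; apply: contrapT => nw.
have [x' [e' xe']] := dual_extend xe Ww nw.
have /rmax : Q r.+1 by apply/asboolP; exists x', e'.
by rewrite ltnn.
Qed.

(** In the basis of [dual_system_exists] the action has the matrix
    e i (t^-1 x k), and the row e of basis functions is equivariant. *)
Lemma findim_rep : exists (pi : fdrep R G) (e : X -> 'rV[C]_(rep_dim pi)),
  equivariant e /\ forall w, W w -> exists a : 'cV_(rep_dim pi), forall x, w x = (e x *m a) 0 0.
Proof.
have [r [x [e [[We ex] eW]]]] := dual_system_exists.
pose Pi (t : G) : 'M[C]_r := \matrix_(k, i) e i (tds_act t^-1%g (x k)).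
have et t z i : e i (tds_act t^-1%g z) = \sum_k Pi t k i * e k z.
  rewrite -[LHS]/(koopman t (e i) z) (eW _ (Wstable t (We i))) fct_sumE.
  by apply: eq_bigr => k _; rewrite mxE.
have Pi1 : Pi 1%g = 1%:M.
  by apply/matrixP => k i; rewrite !mxE invg1 tds_act1 ex eq_sym.
have PiM s t : Pi (s * t)%g = Pi s *m Pi t.
  apply/matrixP => k i; rewrite !mxE invgM tds_actM et.
  by apply: eq_bigr => l _; rewrite !mxE mulrC.
have Pic : continuous Pi.
  apply/continuous_mxP => k i.
  have -> : (fun t => Pi t k i) = (fun t => e i (tds_act t^-1%g (x k))).
    by apply/funext => t; rewrite mxE.
  have eic : continuous (e i) by exact: (Wcts (We i)).
  move=> t; apply: (@continuous_comp _ _ _ (fun t => tds_act t^-1%g (x k)) (e i)); last exact: eic.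
  have h : {for t, continuous (fun t : G => (t^-1%g, x k))}.
    by apply: cvg_pair; [exact: invg_continuous|exact: cvg_cst].
  exact: (continuous_comp h (@tds_act_continuous _ X _)).
have Pib : [bounded Pi t | t in [set: G]].
  have [M eM] := choice (fun i => continuous_bounded (@phase_compact _ X) (Wcts (We i))).
  apply: (@bounded_fro _ _ _ _ _ (\sum_(k < r) \sum_(i < r) nsq (M i))) => t.
  apply: ler_sum => k _; apply: ler_sum => i _; rewrite mxE -lecR !nsqE.
  have h := eM i (tds_act t^-1%g (x k)); have M0 := le_trans (normr_ge0 _) h.
  by rewrite (ger0_norm M0) ler_sqr ?nnegrE // h.
exists (FdRep Pi1 PiM Pic Pib), (fun z => \row_i e i z); split.
  split=> [j i|t z].
    have -> : (fun z => (\row_i e i z) j i) = e i by apply/funext => z; rewrite mxE.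
    exact: Wcts.
  apply/rowP => i; rewrite !mxE -{1}[t]invgK et; apply: eq_bigr => k _.
  by rewrite !mxE mulrC.
move=> w Ww; exists (\col_i w (x i)) => z.
rewrite {1}(eW w Ww) fct_sumE mxE; apply: eq_bigr => i _.
by rewrite !mxE mulrC.
Qed.

End FiniteDimensionalSubspaces.

(** * The theorem of Stone and Weierstrass *)

Section StoneWeierstrass.
Context {R : realType} {T : topologicalType}.
Hypothesis Tc : compact [set: T].

Lemma exists_expr_lt (q e : R) : 0 <= q < 1 -> 0 < e -> exists n, q ^+ n < e.
Proof.
move=> /andP[q0 q1] e0.
have qn : `|q| < 1 by rewrite ger0_norm.
have /cvgrPdist_lt/(_ e e0)[n _ /(_ n (leqnn n))] := cvg_expr qn.
by rewrite sub0r normrN ger0_norm ?exprn_ge0 // => h; exists n.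
Qed.

Variable B : set (T -> R).
Hypothesis Bcts : forall f, B f -> continuous f.
Hypothesis Bcst : forall c, B (fun _ => c).
Hypothesis BD : forall f g, B f -> B g -> B (fun x => f x + g x).
Hypothesis BM : forall f g, B f -> B g -> B (fun x => f x * g x).
Hypothesis Bsep : forall x y, x != y -> exists2 z, B z & z x <> z y.

Let Bsum (I : Type) (l : seq I) (F : I -> T -> R) :
  (forall i, B (F i)) -> B (fun x => \sum_(i <- l) F i x).
Proof.
move=> BF; elim: l => [|i l IH].
  by rewrite (_ : (fun x => _) = fun=> 0) //; apply/funext => x; rewrite big_nil.
rewrite (_ : (fun x => _) = fun x => F i x + \sum_(i <- l) F i x).
  exact: BD.
by apply/funext => x; rewrite big_cons.
Qed.

Let Bexp f n : B f -> B (fun x => f x ^+ n).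
Proof.
move=> Bf; elim: n => [|n IH].
  by rewrite (_ : (fun x => _) = fun=> 1).
rewrite (_ : (fun x => _) = fun x => f x * f x ^+ n); first exact: BM.
by apply/funext => x; rewrite exprS.
Qed.

(** By compactness of the complement of V, a finite sum of squares
    c (z - z(x0))^2 of functions z in B is large outside V. *)
Let bump x0 (V : set T) : nbhs x0 V -> exists h, [/\ B h, forall y, 0 <= h y,
  h x0 = 0 & forall y, ~ V y -> 2 <= h y].
Proof.
move=> Vx0; pose K := ~` V°.
have Kc : compact K.
  by apply: (subclosed_compact _ Tc) => //; apply/open_closedC/open_interior.
have [|||U KU [h [Bh h0 hx0 hU]]] := @compact_induction T K
  (fun U => exists h, [/\ B h, forall y, 0 <= h y, h x0 = 0 & forall y, U y -> 2 <= h y]) Kc.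
- by exists (fun=> 0); split.
- move=> U1 U2 [h1 [Bh1 h10 h1x h1U]] [h2 [Bh2 h20 h2x h2U]].
  exists (fun y => h1 y + h2 y); split=> [|y||y].
  + exact: BD.
  + by rewrite addr_ge0.
  + by rewrite h1x h2x addr0.
  + by move=> [/h1U|/h2U] hy; [rewrite -[2]addr0|rewrite -[2]add0r]; apply: lerD.
- move=> y Ky.
  have [|z Bz zxy] := Bsep (x := y) (y := x0).
    by apply/eqP => e; apply: Ky; rewrite e.
  pose c := 3 / (z y - z x0) ^+ 2.
  have zy0 : 0 < (z y - z x0) ^+ 2.
    by rewrite lt_neqAle sqr_ge0 andbT eq_sym sqrf_eq0 subr_eq0; apply/eqP.
  pose h u := c * (z u - z x0) ^+ 2.
  have Bh : B h.
    by apply: BM => //; apply: (@Bexp (fun u => z u - z x0)); exact: BD.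
  exists [set u | 2 < h u].
    have hc : h u @[u --> y] --> h y by exact: Bcts.
    apply: (hc [set r | 2 < r]); rewrite /h /c divfK ?gt_eqF //.
    by apply: open_nbhs_nbhs; split; [exact: open_gt|rewrite /= ltr_nat].
  exists h; split => // [u||u /ltW //]; rewrite /h.
    by rewrite mulr_ge0 ?sqr_ge0 // divr_ge0 // ltW.
  by rewrite subrr expr0n mulr0.
exists h; split => // y nVy; apply/hU/KU => Vy; apply: nVy; exact: interior_subset Vy.
Qed.

(** A partition of unity made of members of B.  Let h x be the bump function
    of x, which vanishes at x and is at least 2 wherever f differs much from
    f x.  The weights w x = (1 - h x / M)^n are in B; for large n, those which
    belong to points x with f x far from f y are negligible at y compared with
    those for which h x y < 1.  So f is close to the weighted mean of the values
    f x, which is a quotient of members of B; its denominator S is bounded away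
    from 0, and 1 / S is a limit of partial sums of a geometric series. *)
Lemma stone_weierstrass_real f e : continuous f -> 0 < e ->
  exists2 g, B g & forall x, `|f x - g x| < e.
Proof.
move=> fc e1; pose d := e / 4; have d0 : 0 < d by rewrite divr_gt0.
have Vx x : nbhs x [set y | `|f x - f y| < d].
  by have /cvgrPdist_lt/(_ d d0) := fc x.
have [h hP] := choice (fun x => bump (Vx x)).
have Bh x : B (h x) by case: (hP x).
have h0 x y : 0 <= h x y by case: (hP x).
have h2 x y : d <= `|f x - f y| -> 2 <= h x y.
  by move=> fxy; case: (hP x) => _ _ _; apply; apply/negP; rewrite -leNgt.
have [|||U TU [l lU]] := @compact_induction T setT
  (fun U => exists l : seq T, forall y, U y -> exists2 x, x \in l & h x y < 1) Tc.
- by exists [::].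
- move=> U1 U2 [l1 l1U] [l2 l2U]; exists (l1 ++ l2) => y [/l1U|/l2U] [x xl hxy];
    exists x => //; by rewrite mem_cat xl ?orbT.
- move=> x _; exists [set y | h x y < 1]; last by exists [:: x] => y; exists x; rewrite ?mem_head.
  have hc : h x u @[u --> x] --> h x x by exact: Bcts.
  apply: (hc [set r | r < 1]); case: (hP x) => _ _ -> _.
  by apply: open_nbhs_nbhs; split; [exact: open_lt|exact: ltr01].
(* Finitely many points x suffice to have some h x y < 1 at every y. *)
have {U TU lU} cover y : exists2 x, x \in l & h x y < 1 by apply/lU/TU.
have [M M3 hM] : exists2 M : R, 3 <= M & forall x, x \in l -> forall y, h x y <= M.
  elim: (l) => [|x s [M M3 sM]]; first by exists 3.
  have [N hN] := continuous_bounded Tc (Bcts (Bh x)).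
  exists (Num.max M N) => [|z]; first by rewrite le_max M3.
  rewrite inE => /predU1P[->|zs] y.
    by rewrite le_max (le_trans (ler_norm _) (hN y)) orbT.
  by rewrite le_max sM.
have [F0 fF] := continuous_bounded Tc fc; pose F := `|F0| + 1.
have F1 : 0 < F by rewrite ltr_pwDr.
have {}fF y : `|f y| <= F by rewrite (le_trans (fF y)) // ler_wpDr // ler_norm.
have M0 : 0 < M by lra.
pose p x y := 1 - h x y / M.
have p0 x y : x \in l -> 0 <= p x y.
  by move=> xl; rewrite subr_ge0 ler_pdivrMr // mul1r hM.
have p1 x y : p x y <= 1 by rewrite lerBlDr lerDl divr_ge0 // ltW.
pose N := (size l).+1%:R : R; have N0 : 0 < N by rewrite ltr0n.
have Mi : M^-1 <= 3^-1 by rewrite lef_pV2 ?posrE //.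
have Mi0 : 0 < M^-1 by rewrite invr_gt0.
(* A weight with h x y < 1 is at least u ^+ n, one with h x y >= 2 is at most
   v ^+ n. *)
pose u := 1 - M^-1; pose v := 1 - 2 / M.
have u0 : 0 < u by rewrite /u; lra.
have v0 : 0 <= v by rewrite /v; lra.
have vu : v < u by rewrite /u /v; lra.
have [n nP] : exists n, N * (2 * F) * v ^+ n <= d * u ^+ n.
  have NF : 0 < N * (2 * F) by rewrite !mulr_gt0.
  have [||n] := @exists_expr_lt (v / u) (d / (N * (2 * F))).
  - by rewrite divr_ge0 ?(ltW u0) //= ltr_pdivrMr // mul1r.
  - by rewrite divr_gt0.
  rewrite expr_div_n ltr_pdivrMr ?exprn_gt0 // mulrAC ltr_pdivlMr // => h'.
  by exists n; rewrite mulrC ltW.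
pose w x y := p x y ^+ n; pose S y := \sum_(x <- l) w x y.
pose g0 y := \sum_(x <- l) f x * w x y.
have w0 x y : x \in l -> 0 <= w x y by move=> xl; rewrite exprn_ge0 // p0.
have Bw x : B (w x).
  apply: Bexp; rewrite (_ : p x = fun y => 1 + (- M^-1) * h x y).
    by apply: BD => //; exact: BM.
  by apply/funext => y; rewrite /p mulNr [M^-1 * _]mulrC.
have Su y : u ^+ n <= S y.
  have [x xl hxy] := cover y.
  apply: (@le_trans _ _ (w x y)).
    apply: lerXn2r; rewrite ?nnegrE ?p0 ?(ltW u0) // /p /u lerD2l lerN2.
    by rewrite ler_pdivrMr // mulVf ?gt_eqF // ltW.
  rewrite /S (big_rem x) //= lerDl big_seq sumr_ge0 // => z /mem_rem zl.
  exact: w0.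
have S0 y : 0 < S y by rewrite (lt_le_trans _ (Su y)) // exprn_gt0.
have SN y : S y <= N.
  apply: (@le_trans _ _ (\sum_(x <- l) 1)).
    by rewrite /S !big_seq ler_sum // => x xl; rewrite /w exprn_ile1 ?p0.
  by rewrite big_const_seq count_predT iter_addr_0 ler_nat leqnSn.
have g0S y : `|g0 y - f y * S y| <= 2 * d * S y.
  rewrite /g0 /S mulr_sumr -sumrB.
  apply: (@le_trans _ _ (\sum_(x <- l) (d * w x y + 2 * F * v ^+ n))).
    apply: (le_trans (ler_norm_sum _ _ _)); rewrite !big_seq ler_sum // => x xl.
    rewrite -mulrBl normrM (ger0_norm (w0 _ _ xl)).
    have [fxy|/h2 hxy] := ltP `|f x - f y| d.
      apply: (@le_trans _ _ (d * w x y)); first by rewrite ler_wpM2r ?w0 // ltW.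
      by rewrite lerDl !mulr_ge0 ?exprn_ge0 // ltW.
    apply: (@le_trans _ _ (2 * F * v ^+ n)); last by rewrite lerDr mulr_ge0 ?w0 // ltW.
    apply: ler_pM => //; first exact: w0.
      rewrite (le_trans (ler_normB _ _)) // mulr_natl mulr2n lerD //.
    by apply: lerXn2r; rewrite ?nnegrE ?p0 // /p /v lerD2l lerN2 ler_pM2r.
  rewrite big_split /= -mulr_sumr -/(S y).
  have : \sum_(x <- l) 2 * F * v ^+ n <= d * S y.
    apply: (@le_trans _ _ (d * u ^+ n)); last by rewrite ler_pM2l.
    apply: le_trans nP; rewrite big_const_seq count_predT iter_addr_0 -[leLHS]mulr_natl.
    rewrite -(mulrA N (2 * F)); apply: ler_wpM2r; last by rewrite ler_nat leqnSn.
    by rewrite !mulr_ge0 ?exprn_ge0 // ltW.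
  by lra.
(* The inverse of S is N^-1 times the geometric series of r = 1 - S / N. *)
pose r y := 1 - S y / N; pose rho := 1 - u ^+ n / N.
have r0 y : 0 <= r y by rewrite subr_ge0 ler_pdivrMr // mul1r.
have rr y : r y <= rho by rewrite lerD2l lerN2 ler_pM2r ?invr_gt0.
have [k kP] : exists k, rho ^+ k < d / F.
  apply: exists_expr_lt; last by rewrite divr_gt0.
  have [y|noy] := pselect (exists y : T, True); last first.
    rewrite /rho; apply/andP; split; last by rewrite ltrBlDr ltrDl divr_gt0 ?exprn_gt0.
    rewrite subr_ge0 ler_pdivrMr // mul1r; apply: (@le_trans _ _ 1).
      by rewrite exprn_ile1 ?(ltW u0) // /u; lra.
    by rewrite ler1n.
  case: y => y _.
  rewrite (le_trans (r0 y) (rr y)) /rho ltrBlDr ltrDl divr_gt0 ?exprn_gt0 //.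
pose t y := N^-1 * \sum_(i < k) r y ^+ i.
have St y : S y * t y = 1 - r y ^+ k.
  have -> : S y = N * (1 - r y).
    by rewrite /r opprB addrC subrK mulrC divfK ?gt_eqF.
  rewrite /t mulrACA divff ?gt_eqF // mul1r -[1 in RHS](expr1n _ k) subrXX.
  by congr (_ * _); apply: eq_bigr => i _; rewrite expr1n mul1r.
have t0 y : 0 <= t y.
  by rewrite mulr_ge0 ?invr_ge0 ?(ltW N0) // sumr_ge0 // => i _; rewrite exprn_ge0.
have BS : B S by exact: Bsum.
have Br : B r.
  rewrite (_ : r = fun y => 1 + (- N^-1) * S y); first by apply: BD => //; exact: BM.
  by apply/funext => y; rewrite /r mulNr [N^-1 * _]mulrC.
exists (fun y => g0 y * t y).
  apply: BM; first by apply: Bsum => x; exact: BM.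
  by apply: BM => //; apply: Bsum => i; exact: Bexp.
move=> y.
have -> : f y - g0 y * t y = f y * r y ^+ k - (g0 y - f y * S y) * t y.
  rewrite mulrBl -[f y * S y * t y]mulrA St mulrBr mulr1; ring.
apply: (le_lt_trans (ler_normB _ _)).
have rk : r y ^+ k <= rho ^+ k by apply: lerXn2r; rewrite ?nnegrE // (le_trans (r0 y)).
have h1 : `|f y * r y ^+ k| <= d.
  rewrite normrM (ger0_norm (exprn_ge0 k (r0 y))).
  apply: (@le_trans _ _ (F * (d / F))); last by rewrite mulrC divfK ?gt_eqF.
  by apply: ler_pM; rewrite ?exprn_ge0 // (le_trans rk) // ltW.
have h3 : `|(g0 y - f y * S y) * t y| <= 2 * d.
  rewrite normrM (ger0_norm (t0 y)).
  apply: (@le_trans _ _ (2 * d * S y * t y)); first by rewrite ler_wpM2r.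
  rewrite -(mulrA _ (S y)) St mulrBr mulr1 lerBlDr lerDl.
  by rewrite !mulr_ge0 ?exprn_ge0 // ltW.
apply: (le_lt_trans (lerD h1 h3)).
by rewrite /d; lra.
Qed.

End StoneWeierstrass.

Section ComplexStoneWeierstrass.
Context {R : realType} {T : topologicalType}.
Local Notation C := (Cplx R).
Hypothesis Tc : compact [set: T].

Lemma cts_Re (f : T -> C) : continuous f -> continuous (fun x => complex.Re (f x)).
Proof.
move=> fc x; apply/cvgrPdist_lt => e e0.
have e0' : 0 < e%:C%C :> C by rewrite ltcR.
have /cvgrPdist_lt/(_ _ e0') := fc x; apply: filterS => y.
have -> : complex.Re (f x) - complex.Re (f y) = complex.Re (f x - f y).
  by rewrite cReD cReN.
by move=> h; rewrite -ltcR; apply: le_lt_trans h; exact: normc_ge_Re.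
Qed.

Lemma ImE (z : C) : complex.Im z = complex.Re (z * (- 'i%C)).
Proof. by case: z => a b /=; ring. Qed.

Lemma cts_Im (f : T -> C) : continuous f -> continuous (fun x => complex.Im (f x)).
Proof.
move=> fc; rewrite (_ : (fun x => _) = fun x => complex.Re (f x * (- 'i%C))).
  exact: (@cts_Re (fun x => f x * (- 'i%C)) (ctsM fc (@ctsC R T (- 'i%C)))).
by apply/funext => x; exact: ImE.
Qed.

Lemma cts_realC (b : T -> R) : continuous b -> continuous (fun x => (b x)%:C%C : C).
Proof.
move=> bc x; apply/cvgrPdist_lt => d d0; have [r r0 er] := gt0_realC d0.
have /cvgrPdist_lt/(_ _ r0) := bc x; apply: filterS => y.
by rewrite er -rmorphB normc_def /= expr0n /= addr0 sqrtr_sqr ltcR.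
Qed.

Lemma cts_complex (b : T -> R) : continuous (fun x => (b x)%:C%C : C) -> continuous b.
Proof. by move=> /cts_Re. Qed.

Variable A : set (T -> C).
Hypothesis Acts : forall f, A f -> continuous f.
Hypothesis Acst : forall c, A (fun _ => c).
Hypothesis AD : forall f g, A f -> A g -> A (fun x => f x + g x).
Hypothesis AM : forall f g, A f -> A g -> A (fun x => f x * g x).
Hypothesis Aconj : forall f, A f -> A (fun x => (f x)^*).
Hypothesis Asep : forall x y, x != y -> exists2 z, A z & z x <> z y.

Let B : set (T -> R) := [set b | A (fun x => (b x)%:C%C)].

Let BRe f : A f -> B (fun x => complex.Re (f x)).
Proof.
move=> Af; rewrite /B /= (_ : (fun x => _) = fun x => (f x + (f x)^*) * 2^-1).
  by apply: AM => //; apply: AD => //; exact: Aconj.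
by apply/funext => x; exact: ReJ_add.
Qed.

Let BIm f : A f -> B (fun x => complex.Im (f x)).
Proof.
move=> Af; rewrite (_ : (fun x => _) = fun x => complex.Re (f x * (- 'i%C))).
  by apply: BRe; exact: AM.
by apply/funext => x; exact: ImE.
Qed.

(** Reduction to the real case: a conjugation-invariant algebra contains the
    real and the imaginary parts of its members. *)
Lemma stone_weierstrass f e : continuous f -> 0 < e ->
  exists2 g, A g & forall x, nsq (f x - g x) < e.
Proof.
move=> fc e0; pose d := Num.min 1 (e / 2).
have d0 : 0 < d by rewrite lt_min ltr01 divr_gt0.
have d1 : d <= 1 by rewrite ge_min lexx.
have de : d <= e / 2 by rewrite ge_min lexx orbT.
have sw b : continuous b -> exists2 c, B c & forall x, `|b x - c x| < d.
  move=> bc; apply: (@stone_weierstrass_real R T Tc B _ _ _ _ _ b d bc d0).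
  - by move=> c Bc; apply: cts_complex; exact: Acts.
  - by move=> c; exact: (Acst c%:C%C).
  - move=> b1 b2 Bb1 Bb2; rewrite /B /=.
    rewrite (_ : (fun x => _) = fun x => (b1 x)%:C%C + (b2 x)%:C%C); first exact: AD.
    by apply/funext => x; rewrite rmorphD.
  - move=> b1 b2 Bb1 Bb2; rewrite /B /=.
    rewrite (_ : (fun x => _) = fun x => (b1 x)%:C%C * (b2 x)%:C%C); first exact: AM.
    by apply/funext => x; rewrite rmorphM.
  - move=> x y /Asep[z Az zxy].
    have [e1|/eqP n1] := eqVneq (complex.Re (z x)) (complex.Re (z y)); last first.
      by exists (fun x => complex.Re (z x)) => //; exact: BRe.
    exists (fun x => complex.Im (z x)); first exact: BIm.
    by move=> e2; apply: zxy; move: e1 e2; case: (z x) (z y) => ? ? [? ?] /= -> ->.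
have [g1 Bg1 g1P] := sw _ (cts_Re fc).
have [g2 Bg2 g2P] := sw _ (cts_Im fc).
exists (fun x => (g1 x)%:C%C + 'i%C * (g2 x)%:C%C).
  by apply: AD => //; exact: AM.
move=> x.
have -> : nsq (f x - ((g1 x)%:C%C + 'i%C * (g2 x)%:C%C)) =
    (complex.Re (f x) - g1 x) ^+ 2 + (complex.Im (f x) - g2 x) ^+ 2.
  by rewrite /nsq !(cReD, cImD, cReN, cImN) cReM cImM /=; ring.
have sq a : `|a| < d -> a ^+ 2 < e / 2.
  move=> ad; apply: lt_le_trans de; rewrite -real_normK ?num_real // expr2.
  by apply: (le_lt_trans _ ad); rewrite ler_piMr // (le_trans _ d1) // ltW.
have := sq _ (g1P x); have := sq _ (g2P x); lra.
Qed.

End ComplexStoneWeierstrass.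

(** * The compactification of G attached to a set of representations *)

Section ProductTopology.
Context {R : realType}.
Local Notation C := (Cplx R).

Lemma norm_ltr (z : C) (r : R) : 0 <= r -> (`|z| < r%:C%C) = (nsq z < r ^+ 2).
Proof.
move=> r0; have r0' : 0 <= r%:C%C :> C by rewrite lecR.
by rewrite -(@ltr_pXn2r _ 2) ?nnegrE // -nsqE -rmorphXn ltcR.
Qed.

Lemma cts_to_prod (T : topologicalType) (K : Type)
    (f : T -> prod_topology (fun _ : K => C)) :
  (forall k, continuous (fun x => f x k)) -> continuous f.
Proof.
move=> fc x; apply/cvg_sup => k U [_ [[W oW <-] Wx]] /filterS; apply.
by apply: (fc k x); exact: open_nbhs_nbhs.
Qed.

Lemma cts_proj (K : Type) (k : K) :
  continuous (fun x : prod_topology (fun _ : K => C) => x k).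
Proof. exact: (@proj_continuous {classic K} (fun _ => C) k). Qed.

Lemma closure_eq (T : topologicalType) (A : set T) (f g : T -> C) :
  continuous f -> continuous g -> (forall x, A x -> f x = g x) ->
  forall x, closure A x -> f x = g x.
Proof.
move=> fc gc fg x Ax; apply/eqP; rewrite -subr_eq0; apply/negP => /negP d0.
have dc : continuous (fun y => f y - g y).
  by move=> y; apply: cvgB; [exact: fc|exact: gc].
have e0 : 0 < `|f x - g x| by rewrite normr_gt0.
have /cvgrPdist_lt/(_ _ e0)/Ax[y [Ay]] := dc x.
by rewrite /= (fg y Ay) subrr subr0 ltxx.
Qed.

Lemma separated_hausdorff (T : topologicalType) :
  (forall x y : T, x <> y -> exists2 f : T -> C, continuous f & f x <> f y) ->
  hausdorff_space T.
Proof.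
move=> sep p q pq; apply: contrapT => npq.
have [f fc fpq] := sep _ _ npq.
have e0 : 0 < `|f p - f q| / 2 by rewrite divr_gt0 // normr_gt0 subr_eq0; apply/eqP.
have /cvgrPdist_lt/(_ _ e0) fp := fc p.
have /cvgrPdist_lt/(_ _ e0) fq := fc q.
have [z [/= zp zq]] := pq _ _ fp fq.
have : `|f p - f q| < `|f p - f q|.
  rewrite {2}(splitr `|f p - f q|); apply: le_lt_trans (ltrD zp zq).
  by rewrite [X in _ <= _ + X]distrC -[f p - f q](subrKA (f z)) ler_normD.
by rewrite ltxx.
Qed.

Lemma prod_hausdorff (K : Type) : hausdorff_space (prod_topology (fun _ : K => C)).
Proof.
apply: separated_hausdorff => x y xy.
have [k xyk] : exists k, x k <> y k.
  by apply: contrapT => h; apply: xy; apply/funext => k; apply: contrapT => xyk; apply: h; exists k.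
by exists (fun z => z k) => //; exact: cts_proj.
Qed.

(** A convenient compact subset of C which contains the closed unit disc, hence
    all the entries of unitary matrices. *)
Definition square : set C := [set z | complex.Re z \in `[-1, 1] /\ complex.Im z \in `[-1, 1]].

Lemma square_compact : compact square.
Proof.
pose f (ab : R * R) : C := Complex ab.1 ab.2.
have fc : continuous f.
  move=> ab; apply/cvgrPdist_lt => e e0.
  have [r r0 er] := gt0_realC e0.
  have r20 : 0 < r / 2 by rewrite divr_gt0.
  have /cvgrPdist_lt/(_ _ r20) h1 : fst x @[x --> ab] --> ab.1 by exact: cvg_fst.
  have /cvgrPdist_lt/(_ _ r20) h2 : snd x @[x --> ab] --> ab.2 by exact: cvg_snd.
  apply: filterS2 h1 h2 => cd h1 h2; rewrite er.
  rewrite (norm_ltr _ (ltW r0)) /nsq /=.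
  have sq a : `|a| < r / 2 -> a ^+ 2 < (r / 2) ^+ 2.
    by move=> ar; rewrite -real_normK ?num_real // ltr_pXn2r ?nnegrE // ltW.
  by have := sq _ h1; have := sq _ h2; rewrite !exprMn; nra.
have -> : square = f @` (`[-1, 1]%classic `*` `[-1, 1]%classic).
  apply/seteqP; split=> [z [z1 z2]|_ [[a b] [/= a1 b1] <-]]; last by split.
  by exists (complex.Re z, complex.Im z) => //; case: (z).
apply: continuous_compact; first exact: continuous_subspaceT.
by apply: compact_setX; exact: segment_compact.
Qed.

Lemma norm1_square (z : C) : `|z| <= 1 -> square z.
Proof.
move=> z1; have : nsq z <= 1 by rewrite -lecR nsqE expr_le1.
by rewrite /nsq => h; split; rewrite in_itv /=; apply/andP; split; nra.
Qed.

Lemma closure_map (T U : topologicalType) (f : T -> U) (A : set T) (B : set U) :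
  continuous f -> (forall x, A x -> closure B (f x)) ->
  forall x, closure A x -> closure B (f x).
Proof.
move=> fc AB x Ax; apply: (@closed_closure _ B) => V Vx.
have [y [Ay Vy]] := Ax _ (fc x V Vx).
by exists (f y); split => //; exact: AB.
Qed.

End ProductTopology.

Section BohrGroup.
Context {R : realType} {G : topologicalGroupType}.
Local Notation C := (Cplx R).
Variable S : set (fdrep R G).

(** The ambient product is over all entries of all unitary members of S.  It is
    a product of copies of C rather than of unitary groups, so that
    Tychonoff's theorem applies to non-dependent factors; the matrices are
    recovered by [umx]. *)
Definition uindex := {tau : fdrep R G | S tau /\ unitary_rep tau}.
Definition ucoord := {i : uindex & ('I_(rep_dim (sval i)) * 'I_(rep_dim (sval i)))%type}.
Definition uprod : topologicalType := prod_topology (fun _ : ucoord => C).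

Definition umx (x : uprod) (i : uindex) : 'M[C]_(rep_dim (sval i)) :=
  \matrix_(a, b) x (existT _ i (a, b)).

Definition of_umx (A : forall i : uindex, 'M[C]_(rep_dim (sval i))) : uprod :=
  fun k => A (projT1 k) (projT2 k).1 (projT2 k).2.

Lemma umxK A i : umx (of_umx A) i = A i.
Proof. by apply/matrixP => a b; rewrite mxE. Qed.

Lemma umx_inj x y : umx x = umx y -> x = y.
Proof.
move=> xy; apply/funext => -[i [a b]].
have : umx x i = umx y i by rewrite xy.
by move=> /matrixP/(_ a b); rewrite !mxE.
Qed.

Lemma cts_umx i : ctsmx (umx ^~ i).
Proof.
move=> a b; rewrite (_ : (fun x => _) = fun x => x (existT _ i (a, b))).
  exact: cts_proj.
by apply/funext => x; rewrite mxE.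
Qed.

Lemma cts_of_umx (T : topologicalType) (A : T -> forall i, 'M[C]_(rep_dim (sval i))) :
  (forall i, ctsmx (fun x => A x i)) -> continuous (fun x => of_umx (A x)).
Proof. by move=> Ac; apply: cts_to_prod => -[i [a b]]; exact: Ac. Qed.

Definition uorbit (t : G) : uprod := of_umx (fun i => sval i t).

(** The products and inverses of [umul] and [uinv] are continuous and
    coordinatewise, so this closure of an image of G is closed under them; it
    is the underlying space of the compactification. *)
Definition uset : set uprod := closure (range uorbit).

Lemma uorbit_uset t : uset (uorbit t).
Proof. by apply: subset_closure; exists t. Qed.
Arguments uorbit_uset : clear implicits.

Definition umul (x y : uprod) : uprod := of_umx (fun i => umx x i *m umx y i).
Definition uinv (x : uprod) : uprod := of_umx (fun i => adj (umx x i)).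

Lemma umul_orbit s t : umul (uorbit s) (uorbit t) = uorbit (s * t)%g.
Proof.
by apply: umx_inj; apply: functional_extensionality_dep => i; rewrite !umxK repM.
Qed.

Lemma unitary_inv (pi : fdrep R G) t : unitary_rep pi -> adj (pi t) = pi t^-1%g :> 'M[C]_(rep_dim pi).
Proof.
by move=> piu; rewrite -[LHS]mul1mx -(repK pi t) -mulmxA piu mulmx1.
Qed.

Lemma uinv_orbit t : uinv (uorbit t) = uorbit t^-1%g.
Proof.
apply: umx_inj; apply: functional_extensionality_dep => i; rewrite !umxK.
by apply: unitary_inv; case: (svalP i).
Qed.

Lemma uset_mul x y : uset x -> uset y -> uset (umul x y).
Proof.
move=> + Hy; apply: (closure_map (f := umul ^~ y)).
  apply: (@cts_of_umx uprod (fun x i => umx x i *m umx y i)) => i.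
  exact: (ctsmx_mul (@cts_umx i) (ctsmx_cst (umx y i))).
move=> _ [s _ <-]; move: y Hy; apply: closure_map.
  apply: (@cts_of_umx uprod (fun y i => umx (uorbit s) i *m umx y i)) => i.
  exact: (ctsmx_mul (ctsmx_cst (umx (uorbit s) i)) (@cts_umx i)).
by move=> _ [t _ <-]; rewrite umul_orbit; exact: uorbit_uset.
Qed.

Lemma uset_inv x : uset x -> uset (uinv x).
Proof.
apply: closure_map.
  by apply: (@cts_of_umx uprod (fun x i => adj (umx x i))) => i; exact: (ctsmx_adj (@cts_umx i)).
by move=> _ [t _ <-]; rewrite uinv_orbit; exact: uorbit_uset.
Qed.

Lemma uset_eq m n (A B : uprod -> 'M[C]_(m, n)) : ctsmx A -> ctsmx B ->
  (forall t, A (uorbit t) = B (uorbit t)) -> forall x, uset x -> A x = B x.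
Proof.
move=> Ac Bc AB x Hx; apply/matrixP => a b.
by apply: (closure_eq (Ac a b) (Bc a b) _ Hx) => _ [t _ <-]; rewrite AB.
Qed.

Lemma uset_unitary x i : uset x -> umx x i *m adj (umx x i) = 1%:M.
Proof.
apply: (@uset_eq _ _ (fun x => umx x i *m adj (umx x i)) (fun=> 1%:M)).
- exact: (ctsmx_mul (@cts_umx i) (ctsmx_adj (@cts_umx i))).
- exact: ctsmx_cst.
by move=> t; rewrite umxK; case: (svalP i) => _; apply.
Qed.

Lemma uset_compact : compact uset.
Proof.
have cK : compact [set x : uprod | forall k, square (x k)].
  exact: (@tychonoff {classic ucoord} (fun _ => C) (fun _ => square) (fun _ => square_compact)).
apply: (subclosed_compact _ cK); first exact: closed_closure.
have /closure_id -> := compact_closed (@prod_hausdorff R ucoord) cK.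
apply: closureS => _ [t _ <-] [i [a b]]; apply: norm1_square.
by apply: norm_entry_le1; case: (svalP i) => _; apply.
Qed.

Definition bohr : Type := {x : uprod | x \in uset}.
HB.instance Definition _ := Topological.copy bohr (set_type uset).

Definition bohr_mx (x : bohr) i := umx (val x) i.

Lemma bohrP (x : bohr) : uset (val x).
Proof. exact: set_mem (valP x). Qed.
Arguments bohrP : clear implicits.

Lemma bohr_inj (x y : bohr) : (forall i, bohr_mx x i = bohr_mx y i) -> x = y.
Proof.
by move=> xy; apply/val_inj/umx_inj; apply: functional_extensionality_dep => i; exact: xy.
Qed.

Definition to_bohr (x : uprod) (Hx : uset x) : bohr := exist _ x (mem_set Hx).

Lemma cts_bohr_val : continuous (val : bohr -> uprod).
Proof. exact: initial_continuous. Qed.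

Lemma cts_bohr_mx i : ctsmx (bohr_mx ^~ i).
Proof.
move=> a b x; apply: (@continuous_comp _ _ _ (val : bohr -> uprod) (fun y => umx y i a b)).
  exact: cts_bohr_val.
exact: cts_umx.
Qed.

Lemma cts_to_bohr (T : topologicalType) (f : T -> bohr) :
  (forall i, ctsmx (fun x => bohr_mx (f x) i)) -> continuous f.
Proof.
move=> fc; apply: continuous_comp_initial.
rewrite (_ : _ \o _ = fun x => of_umx (fun i => bohr_mx (f x) i)).
  exact: cts_of_umx.
apply/funext => x /=; apply: umx_inj; apply: functional_extensionality_dep => i.
by rewrite umxK.
Qed.

Definition bohr_mul (x y : bohr) : bohr := to_bohr (uset_mul (bohrP x) (bohrP y)).
Definition bohr_inv (x : bohr) : bohr := to_bohr (uset_inv (bohrP x)).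
Definition bohr_of (t : G) : bohr := to_bohr (uorbit_uset t).

Lemma bohr_mxM x y i : bohr_mx (bohr_mul x y) i = bohr_mx x i *m bohr_mx y i.
Proof. exact: umxK. Qed.
Lemma bohr_mxV x i : bohr_mx (bohr_inv x) i = adj (bohr_mx x i).
Proof. exact: umxK. Qed.
Lemma bohr_mx_of t i : bohr_mx (bohr_of t) i = sval i t.
Proof. exact: umxK. Qed.
Lemma bohr_mx_unitary x i : bohr_mx x i *m adj (bohr_mx x i) = 1%:M.
Proof. exact: (uset_unitary i (bohrP x)). Qed.

Lemma bohr_mulA : associative bohr_mul.
Proof. by move=> x y z; apply: bohr_inj => i; rewrite !bohr_mxM mulmxA. Qed.
Lemma bohr_mul1 : left_id (bohr_of 1%g) bohr_mul.
Proof. by move=> x; apply: bohr_inj => i; rewrite bohr_mxM bohr_mx_of rep1 mul1mx. Qed.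
Lemma bohr_1mul : right_id (bohr_of 1%g) bohr_mul.
Proof. by move=> x; apply: bohr_inj => i; rewrite bohr_mxM bohr_mx_of rep1 mulmx1. Qed.
Lemma bohr_mulV : left_inverse (bohr_of 1%g) bohr_inv bohr_mul.
Proof.
move=> x; apply: bohr_inj => i; rewrite bohr_mxM bohr_mx_of rep1 bohr_mxV.
exact: mulmx1C (bohr_mx_unitary x i).
Qed.
Lemma bohr_mulV' : right_inverse (bohr_of 1%g) bohr_inv bohr_mul.
Proof.
move=> x; apply: bohr_inj => i; rewrite bohr_mxM bohr_mx_of rep1 bohr_mxV.
exact: bohr_mx_unitary.
Qed.

HB.instance Definition _ := isGroup.Build bohr bohr_mulA bohr_mul1 bohr_1mul bohr_mulV bohr_mulV'.

Lemma bohr_mul_continuous : continuous (fun xy : bohr * bohr => (xy.1 * xy.2)%g).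
Proof.
apply: cts_to_bohr => i.
have fstc : ctsmx (fun xy : bohr * bohr => bohr_mx xy.1 i).
  move=> a b x; apply: (@continuous_comp _ _ _ fst (fun y => bohr_mx y i a b)).
    exact: cvg_fst.
  exact: cts_bohr_mx.
have sndc : ctsmx (fun xy : bohr * bohr => bohr_mx xy.2 i).
  move=> a b x; apply: (@continuous_comp _ _ _ snd (fun y => bohr_mx y i a b)).
    exact: cvg_snd.
  exact: cts_bohr_mx.
rewrite (_ : (fun x => _) = fun xy : bohr * bohr => bohr_mx xy.1 i *m bohr_mx xy.2 i).
  exact: (ctsmx_mul fstc sndc).
by apply/funext => xy; rewrite bohr_mxM.
Qed.

Lemma bohr_inv_continuous : continuous (fun x : bohr => x^-1%g).
Proof.
apply: cts_to_bohr => i.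
rewrite (_ : (fun x => _) = fun x : bohr => adj (bohr_mx x i)).
  exact: (ctsmx_adj (@cts_bohr_mx i)).
by apply/funext => x; rewrite bohr_mxV.
Qed.

HB.instance Definition _ :=
  isTopologicalGroup.Build bohr bohr_mul_continuous bohr_inv_continuous.

Lemma bohr_compact : compact [set: bohr].
Proof.
move=> F FF _.
have [|p [Hp Fp]] := uset_compact (F := (val : bohr -> uprod) @ F) _.
  by apply: (@filterS _ F _ setT) => [x _|]; [exact: (bohrP x)|exact: filterT].
exists (to_bohr Hp); split => // A B FA [_ [[W oW <-] Wp WB]].
have [|_ [[z Az <-] Wz]] := Fp (val @` A) W _ (open_nbhs_nbhs (conj oW Wp)).
  by apply: (@filterS _ F _ A) => [z Az|//]; exists z.
by exists z; split => //; exact: WB.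
Qed.

Lemma bohr_hausdorff : hausdorff_space bohr.
Proof.
apply: (@separated_hausdorff R) => x y xy.
have [i [a [b h]]] : exists i a b, bohr_mx x i a b <> bohr_mx y i a b.
  apply: contrapT => h; apply: xy; apply: bohr_inj => i; apply/matrixP => a b.
  by apply: contrapT => hab; apply: h; exists i, a, b.
by exists (fun z => bohr_mx z i a b) => //; exact: cts_bohr_mx.
Qed.

Lemma bohr_of_morphism : monoid.monoid_morphism bohr_of.
Proof.
split=> // s t; apply: bohr_inj => i.
by rewrite [RHS]bohr_mxM !bohr_mx_of repM.
Qed.

Lemma bohr_of_continuous : continuous bohr_of.
Proof.
apply: cts_to_bohr => i a b.
rewrite (_ : (fun t => _) = fun t => sval i t a b).
  by have /continuous_mxP := @rep_continuous _ _ (sval i).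
by apply/funext => t; rewrite bohr_mx_of.
Qed.

Lemma bohr_of_dense : dense (range bohr_of).
Proof.
move=> U [x Ux] [W oW WU].
have Wx : W (val x) by rewrite -[W _]/((val @^-1` W) x) WU.
have [_ [[t _ <-] Wt]] := bohrP x _ (open_nbhs_nbhs (conj oW Wx)).
by exists (bohr_of t); split; [rewrite -WU|exists t].
Qed.

Definition bohr_compactification : group_compactification G :=
  GroupCompact bohr_compact bohr_hausdorff bohr_of_morphism bohr_of_continuous
    bohr_of_dense.

Lemma bohr_eq_fun (f g : bohr -> C) : continuous f -> continuous g ->
  (forall t, f (bohr_of t) = g (bohr_of t)) -> forall x, f x = g x.
Proof.
move=> fc gc fg x; apply: (closure_eq (A := range bohr_of) fc gc) => [_ [t _ <-] //|].
move=> V /=; rewrite nbhsE => -[U [oU Ux] UV].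
have [y [Uy yr]] := bohr_of_dense (ex_intro _ x Ux) oU.
by exists y; split => //; exact: UV.
Qed.

End BohrGroup.

(** * Means and orthogonality of matrix coefficients *)

Section Mean.
Context {R : realType} {G : topologicalGroupType}.
Local Notation C := (Cplx R).
Implicit Types pi rho theta : fdrep R G.

(** P plays the role of the integral of rho over G.  The second property is
    positivity of the integral, the third one its value on functions which are
    constant on G. *)
Lemma mean_exists rho : exists P : 'M[C]_(rep_dim rho),
  [/\ forall t, rho t *m P = P,
      forall (l : 'M[C]_(rep_dim rho) -> C) (c : R), linear_for *%R l ->
        (forall t, c <= complex.Re (l (rho t))) -> c <= complex.Re (l P) &
      forall (l : 'M[C]_(rep_dim rho) -> C) v, linear_for *%R l ->
        (forall t, l (rho t) = v) -> l P = v].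
Proof.
pose Theta t : {linear 'M[C]_(rep_dim rho) -> 'M[C]_(rep_dim rho)} := mulmx (rho t).
have [M M0 rhoM] := rep_fro_bounded rho.
have [||||P hP PT] := @hull_fixed_point R G _ _ Theta (2 ^+ rep_dim rho * M) 1%:M.
- by move=> A /=; rewrite rep1 mul1mx.
- by move=> s t A /=; rewrite repM mulmxA.
- by rewrite mulr_gt0 ?exprn_gt0.
- move=> t A /=; apply: (le_trans (froM_le _ _)); rewrite -mulrA ler_wpM2l ?exprn_ge0 //.
  by rewrite ler_wpM2r ?fro_ge0.
exists P; split; first exact: PT.
  move=> l c ll lc; apply: (hP (mk_scalar ll)) => t /=.
  by rewrite mulmx1; exact: lc.
move=> l v ll lv; apply: (hull_scalar_eq ll hP) => t /=.
by rewrite mulmx1; exact: lv.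
Qed.

Lemma sum_mxtens (V : nmodType) m n (F : 'I_(m * n) -> V) :
  \sum_k F k = \sum_i \sum_j F (mxtens_index (i, j)).
Proof.
rewrite pair_big /= (reindex (@mxtens_index m n)).
  by apply: eq_bigr => -[i j] _.
by exists (@mxtens_unindex m n) => x _; [exact: mxtens_indexK|exact: mxtens_unindexK].
Qed.

(** Column k of P, a vector of the tensor product, read as an m x n matrix;
    after conjugation, invariant vectors of conj(pi) (x) theta become
    intertwiners. *)
Definition unfold_mx m n p (P : 'M[C]_(m * n, p)) k : 'M[C]_(m, n) :=
  \matrix_(i, j) P (mxtens_index (i, j)) k.

Lemma unfold_mx0 m n p (P : 'M[C]_(m * n, p)) : (forall k, unfold_mx P k = 0) -> P = 0.
Proof.
move=> P0; apply/matrixP => k l; case: (mxtens_indexP k) => i j.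
by have /matrixP/(_ i j) := P0 l; rewrite !mxE.
Qed.

Lemma unfold_mx_tens m n p (A : 'M[C]_m) (B : 'M[C]_n) (P : 'M[C]_(m * n, p)) k :
  unfold_mx (tensmx A B *m P) k = A *m unfold_mx P k *m B^T.
Proof.
apply/matrixP => i j; rewrite !mxE sum_mxtens exchange_big; apply: eq_bigr => b _.
rewrite !mxE mulr_suml; apply: eq_bigr => a _.
by rewrite tensmxE !mxE mulrAC.
Qed.

Lemma fixed_intertwiner pi theta p
    (P : 'M[C]_(rep_dim (tens_rep (conj_rep pi) theta), p)) k :
  unitary_rep theta -> (forall t, tens_rep (conj_rep pi) theta t *m P = P) ->
  forall t, map_mx Num.conj (unfold_mx P k) *m theta t =
            pi t *m map_mx Num.conj (unfold_mx P k).
Proof.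
move=> tu Pt t; set Q := unfold_mx P k.
have : map_mx Num.conj (conj_rep pi t *m Q *m (theta t)^T) = map_mx Num.conj Q.
  by rewrite -unfold_mx_tens; congr (map_mx _ (unfold_mx _ k)); exact: Pt.
rewrite !map_mxM -[map_mx _ (theta t)^T]/(adj (theta t)) => e.
have cpi : map_mx Num.conj (conj_rep pi t) = pi t.
  by apply/matrixP => i j; rewrite !mxE conjCK.
by rewrite -{1}e cpi -!mulmxA (mulmx1C (tu t)) mulmx1.
Qed.

(** The columns of the mean of conj(pi) (x) pi, unfolded, are scalar matrices by
    Schur's lemma, and their traces determine them: the entries of the mean are the integrals of products
    conj(pi a b) * pi i j.  Testing the relation tr (pi(t) V) = 0 against
    conj(pi j0 b0) extracts the entry V b0 j0. *)
Lemma coefficients_independent pi (V : 'M[C]_(rep_dim pi)) :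
  irreducible pi -> unitary_rep pi -> (forall t, \tr (pi t *m V) = 0) -> V = 0.
Proof.
move=> ipi piu piV.
have [P [Pt _ eql]] := mean_exists (tens_rep (conj_rep pi) pi).
have /choice[q qE] k : exists q, unfold_mx P k = q%:M.
  have [a aE] := schur_scalar ipi (fixed_intertwiner k piu Pt).
  exists (a^*); apply/matrixP => i j; have /matrixP/(_ i j) := aE.
  by rewrite !mxE => /(congr1 Num.conj); rewrite conjCK rmorphMn.
have PE a i k : P (mxtens_index (a, i)) k = q k *+ (a == i).
  by have /matrixP/(_ a i) := qE k; rewrite !mxE.
have entry t a i b j : tens_rep (conj_rep pi) pi t (mxtens_index (a, i)) (mxtens_index (b, j))
    = (pi t a b)^* * pi t i j.
  by rewrite tensmxE mxE.
pose d : C := (rep_dim pi)%:R.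
have d0 : d != 0 by rewrite pnatr_eq0 -lt0n; exact: ipi.1.
have dq b j : d * q (mxtens_index (b, j)) = (b == j)%:R.
  transitivity (\sum_a P (mxtens_index (a, a)) (mxtens_index (b, j))).
    under eq_bigr do rewrite PE eqxx mulr1n.
    by rewrite sumr_const card_ord mulr_natl.
  apply: (eql (fun A => \sum_a A (mxtens_index (a, a)) (mxtens_index (b, j)))).
    move=> c x y /=; rewrite mulr_sumr -big_split; apply: eq_bigr => a _.
    by rewrite !mxE.
  move=> t; under eq_bigr do rewrite entry.
  have /matrixP/(_ b j) := mulmx1C (piu t); rewrite [X in _ = X]mxE => <-.
  by rewrite !mxE; apply: eq_bigr => a _; rewrite !mxE.
apply/matrixP => b0 j0; rewrite mxE.
have : \sum_i \sum_j V j i * P (mxtens_index (j0, i)) (mxtens_index (b0, j)) = 0.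
  apply: (eql (fun A => \sum_i \sum_j V j i * A (mxtens_index (j0, i)) (mxtens_index (b0, j)))).
    move=> c x y /=; rewrite mulr_sumr -big_split; apply: eq_bigr => i _ /=.
    rewrite mulr_sumr -big_split; apply: eq_bigr => j _.
    by rewrite !mxE mulrDr mulrCA.
  move=> t; transitivity ((pi t j0 b0)^* * \tr (pi t *m V)); last by rewrite piV mulr0.
  rewrite /mxtrace mulr_sumr; apply: eq_bigr => i _; rewrite mxE mulr_sumr.
  by apply: eq_bigr => j _; rewrite entry mulrCA [V j i * _]mulrC.
rewrite (bigD1 j0) //= [X in _ + X]big1 ?addr0; last first.
  by move=> i ij; rewrite big1 // => j _; rewrite PE eq_sym (negPf ij) mulr0.
rewrite (bigD1 b0) //= [X in _ + X]big1 ?addr0; last first.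
  move=> j jb; rewrite PE eqxx mulr1n; apply: (mulfI d0).
  by rewrite mulrCA dq eq_sym (negPf jb) !mulr0.
rewrite PE eqxx mulr1n => /(congr1 ( *%R d)).
by rewrite mulrCA dq eqxx !mulr0 mulr1.
Qed.

(** Without intertwiners the mean is zero, so no linear combination of the
    products conj(pi a b) * theta i j has a real part bounded below by a
    positive constant. *)
Lemma disjoint_mean_le0 pi theta (l : 'M[C]_(rep_dim (tens_rep (conj_rep pi) theta)) -> C) (c : R) :
  unitary_rep theta ->
  (forall T : 'M[C]_(rep_dim pi, rep_dim theta),
     (forall t, T *m theta t = pi t *m T) -> T = 0) ->
  linear_for *%R l ->
  (forall t, c <= complex.Re (l (tens_rep (conj_rep pi) theta t))) -> c <= 0.
Proof.
move=> tu noT ll lc.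
have [P [Pt Pl _]] := mean_exists (tens_rep (conj_rep pi) theta).
have P0 : P = 0.
  apply: unfold_mx0 => k; have /noT e := fixed_intertwiner k tu Pt.
  by apply/matrixP => i j; have /matrixP/(_ i j) := e; rewrite !mxE => /eqP;
     rewrite conjC_eq0 => /eqP.
have l0 : l 0 = 0 by have := ll (-1) 0 0; rewrite scaler0 addr0 mulN1r addNr.
by have := Pl l c ll lc; rewrite P0 l0.
Qed.

End Mean.

(** * The rotation on the compactification *)

Section BlockRep.
Context {R : realType} {G : topologicalGroupType}.
Local Notation C := (Cplx R).
Variables pi rho : fdrep R G.

Let f t : 'M[C]_(rep_dim pi + rep_dim rho) := block_mx (pi t) 0 0 (rho t).

Let f1 : f 1%g = 1%:M.
Proof. by rewrite /f !rep1 -scalar_mx_block. Qed.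

Let fM s t : f (s * t)%g = f s *m f t.
Proof.
by rewrite /f mulmx_block !repM !mulmx0 !mul0mx !addr0 !add0r.
Qed.

Let f_continuous : continuous f.
Proof.
apply/continuous_mxP => i j.
have /continuous_mxP piC := @rep_continuous _ _ pi.
have /continuous_mxP rhoC := @rep_continuous _ _ rho.
have ext (g : G -> C) : (forall t, f t i j = g t) -> continuous g -> continuous (fun t => f t i j).
  by move=> fg gc; rewrite (_ : (fun t => _) = g) //; apply/funext.
case: (split_ordP i) ext => i' -> ext; case: (split_ordP j) ext => j' -> ext.
- by apply: (ext (fun t => pi t i' j')) => [t|]; [rewrite block_mxEul|exact: piC].
- by apply: (ext (fun t => 0)) => [t|]; [rewrite block_mxEur mxE|exact: cst_continuous].
- by apply: (ext (fun t => 0)) => [t|]; [rewrite block_mxEdl mxE|exact: cst_continuous].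
- by apply: (ext (fun t => rho t i' j')) => [t|]; [rewrite block_mxEdr|exact: rhoC].
Qed.

Let f_bounded : [bounded f t | t in [set: G]].
Proof.
apply/bounded_mxP.
have /bounded_mxP[M M0 piM] := @rep_bounded _ _ pi.
have /bounded_mxP[N N0 rhoN] := @rep_bounded _ _ rho.
exists (M + N) => [|t i j]; first exact: addr_gt0.
case: (split_ordP i) => i' ->; case: (split_ordP j) => j' ->;
  rewrite /f ?block_mxEul ?block_mxEur ?block_mxEdl ?block_mxEdr ?mxE ?normr0 ?addr_gt0 //.
  by rewrite ltr_wpDr // ltW.
by rewrite ltr_wpDl // ltW.
Qed.

Definition block_rep : fdrep R G := FdRep f1 fM f_continuous f_bounded.

End BlockRep.

Lemma adj_block {R : realType} m n (A : 'M[Cplx R]_m) (D : 'M[Cplx R]_n) :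
  adj (block_mx A 0 0 D) = block_mx (adj A) 0 0 (adj D).
Proof. by rewrite /adj tr_block_mx map_block_mx !trmx0 !map_mx0. Qed.

Section BohrRotation.
Context {R : realType} {G : topologicalGroupType}.
Local Notation C := (Cplx R).
Variable S : set (fdrep R G).
Local Notation X := (rotation (bohr_compactification S)).
Local Notation bmx := (@bohr_mx R G S).
Local Notation bof := (@bohr_of R G S).

Lemma bohr_mx_act t (x : X) i : bmx (tds_act t x) i = sval i t *m bmx x i.
Proof. by rewrite -(bohr_mx_of t i) -bohr_mxM. Qed.

Lemma bohr_act_one t : tds_act t (bof 1%g : X) = bof t.
Proof.
by apply: bohr_inj => i; rewrite bohr_mx_act !bohr_mx_of rep1 mulmx1.
Qed.

Lemma bohr_ergodic : ergodic (R := R) X.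
Proof.
move=> g gc gt; suff h x : g x = g (bof 1%g) by move=> x y; rewrite (h x) (h y).
apply: (@bohr_eq_fun R G S g (fun=> g (bof 1%g)) gc) => [|t]; first exact: cst_continuous.
by rewrite -[in LHS](bohr_act_one t) gt.
Qed.

Definition bohr_frame i (x : X) := adj (bmx x i).

Lemma bohr_frameP i : frame (X := X) (bohr_frame i).
Proof.
split; last by move=> x; rewrite /bohr_frame adjK; exact: mulmx1C (bohr_mx_unitary x i).
split; first exact: (ctsmx_adj (@cts_bohr_mx R G S i)).
by move=> t x; rewrite /bohr_frame bohr_mx_act adjM unitary_inv //; case: (svalP i).
Qed.

(** A linear relation between the entries of the adjoint of the coordinate i
    restricts, on the image of G, to a relation between the entries of the representation. *)
Lemma bohr_frame_free i : irreducible (sval i) -> free_entries (bohr_frame i).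
Proof.
move=> ii v v0.
pose V : 'M[C]_(rep_dim (sval i)) := \matrix_(a, k) v k a 0.
have V0 : V = 0.
  apply: coefficients_independent => // [|t]; first by case: (svalP i).
  have := v0 (bof t^-1%g); rewrite /bohr_frame bohr_mx_of unitary_inv; last by case: (svalP i).
  rewrite invgK => e; rewrite -[RHS]e; apply: eq_bigr => k _; rewrite !mxE.
  by apply: eq_bigr => a _; rewrite mxE.
by move=> k; apply/colP => a; have /matrixP/(_ a k) := V0; rewrite !mxE.
Qed.

Lemma bohr_embeds (i : uindex S) n : irreducible (sval i) ->
  embeds n (sval i) X -> (n <= rep_dim (sval i))%N.
Proof.
move=> ii; apply: (frame_embeds_le bohr_ergodic _ (bohr_frameP i)) => //.
  by case: (svalP i).
by exists (bof 1%g).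
Qed.

Lemma bohr_mult (i : uindex S) : irreducible (sval i) ->
  multiplicity X (sval i) = (rep_dim (sval i))%:R%:E.
Proof.
move=> ii; apply/eqP; rewrite eq_le; apply/andP; split.
  apply: ge_ereal_sup => _ [n /bohr_embeds-/(_ ii) h <-].
  by rewrite lee_fin ler_nat.
apply: embeds_le_mult; apply/embedsP; exists (bohr_frame i).
split; first by case: (bohr_frameP i).
exact: bohr_frame_free.
Qed.

(** Direct sums of indexing representations, with a trivial summand to account
    for constants.  Finitely many representations are thereby handled as a
    single one. *)
Fixpoint blk (l : seq (uindex S)) : fdrep R G :=
  if l is i :: l' then block_rep (sval i) (blk l') else @triv_rep R G.

Fixpoint blk_mx (l : seq (uindex S)) (x : bohr S) : 'M[C]_(rep_dim (blk l)) :=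
  match l with
  | [::] => 1%:M
  | i :: l' => block_mx (bmx x i) 0 0 (blk_mx l' x)
  end.

Lemma blk_mx_of l t : blk_mx l (bof t) = blk l t.
Proof. by elim: l => [|i l IH] //=; rewrite IH bohr_mx_of. Qed.

Lemma blk_mx_act l t (x : X) : blk_mx l (tds_act t x) = blk l t *m blk_mx l x.
Proof.
elim: l => [|i l IH] /=; first by rewrite mul1mx.
by rewrite IH bohr_mx_act mulmx_block !mulmx0 !mul0mx !addr0 !add0r.
Qed.

Lemma blk_unitary l : unitary_rep (blk l).
Proof.
elim: l => [|i l IH] t; first by rewrite /= adjmx1 mul1mx.
rewrite /= adj_block mulmx_block IH !mulmx0 !mul0mx !addr0 !add0r.
by case: (svalP i) => _ ->; rewrite -scalar_mx_block.
Qed.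

Lemma cts_blk_mx l : ctsmx (blk_mx l).
Proof.
elim: l => [|i l IH] /=; first exact: ctsmx_cst.
move=> a b.
have ext (g : bohr S -> C) : (forall x, block_mx (bmx x i) 0 0 (blk_mx l x) a b = g x) -> continuous g ->
    continuous (fun x => block_mx (bmx x i) 0 0 (blk_mx l x) a b).
  by move=> fg gc; rewrite (_ : (fun t => _) = g) //; apply/funext.
case: (split_ordP a) ext => a' -> ext; case: (split_ordP b) ext => b' -> ext.
- by apply: (ext (fun t => bmx t i a' b')) => [t|]; [rewrite block_mxEul|exact: cts_bohr_mx].
- by apply: (ext (fun t => 0)) => [t|]; [rewrite block_mxEur mxE|exact: cst_continuous].
- by apply: (ext (fun t => 0)) => [t|]; [rewrite block_mxEdl mxE|exact: cst_continuous].
- by apply: (ext (fun t => blk_mx l t a' b')) => [t|]; [rewrite block_mxEdr|exact: IH].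
Qed.

Lemma tr_delta_mul n (M : 'M[C]_n) a b : \tr (delta_mx b a *m M) = M a b.
Proof.
rewrite /mxtrace (bigD1 b) //= [X in _ + X]big1 ?addr0 => [|k kb].
  rewrite mxE (bigD1 a) //= [X in _ + X]big1 ?addr0 => [|k ka]; first by rewrite mxE !eqxx mul1r.
  by rewrite mxE (negPf ka) andbF mul0r.
by rewrite mxE big1 // => j _; rewrite mxE (negPf kb) mul0r.
Qed.

(** Linear combinations of the entries of the coordinates in l and of
    constants, written as traces against the block sum. *)
Definition coefs (l : seq (uindex S)) : set (X -> C) :=
  [set f | exists B, forall x, f x = \tr (B *m blk_mx l x)].

Lemma coefs_nil f : coefs [::] f <-> exists c, forall x, f x = c.
Proof.
split=> [[B fB]|[c fc]]; first by exists (\tr B) => x; rewrite fB /= mulmx1.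
by exists (c%:M : 'M[C]_1) => x; rewrite fc /= mulmx1 mxtrace_scalar.
Qed.

Lemma tr_mul_block m n (B : 'M[C]_(m + n)) (A : 'M[C]_m) (D : 'M[C]_n) :
  \tr (B *m block_mx A 0 0 D) = \tr (ulsubmx B *m A) + \tr (drsubmx B *m D).
Proof.
rewrite -{1}[B]submxK mulmx_block !mulmx0 !addr0 !add0r.
by rewrite mxtrace_block.
Qed.

Lemma coefs_cons i l f : coefs (i :: l) f <->
  exists B g, coefs l g /\ forall x, f x = \tr (B *m bmx x i) + g x.
Proof.
split=> [[B fB]|[B [g [[D gD] fB]]]].
  exists (ulsubmx B), (fun x => \tr (drsubmx B *m blk_mx l x)); split.
    by exists (drsubmx B).
  by move=> x; rewrite fB /= tr_mul_block.
exists (block_mx B 0 0 D) => x.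
by rewrite fB gD /= tr_mul_block block_mxKul block_mxKdr.
Qed.

Lemma coefs_lin l a f g : coefs l f -> coefs l g -> coefs l (a *: f + g).
Proof.
move=> [B fB] [D gD]; exists (a *: B + D) => x.
by rewrite -[LHS]/(a * f x + g x) fB gD mulmxDl -scalemxAl linearD linearZ.
Qed.

Lemma coefs_cat l1 l2 f g : coefs l1 f -> coefs l2 g -> coefs (l1 ++ l2) (fun x => f x + g x).
Proof.
elim: l1 f => [|i l1 IH] f.
  move=> /coefs_nil[c fc]; elim: l2 g => [|j l2 IH] g.
    by move=> /coefs_nil[d gd]; apply/coefs_nil; exists (c + d) => x; rewrite fc gd.
  move=> /coefs_cons[B [h [hl gB]]]; apply/coefs_cons; exists B, (fun x => f x + h x).
  by split; [exact: IH|move=> x; rewrite gB addrCA].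
move=> /coefs_cons[B [h [hl fB]]] gl; apply/coefs_cons.
exists B, (fun x => h x + g x); split; first exact: IH.
by move=> x; rewrite fB addrA.
Qed.

Lemma coefs0 l : coefs l (fun=> 0).
Proof. by exists 0 => x; rewrite mul0mx mxtrace0. Qed.

Lemma coefs_cts l f : coefs l f -> continuous f.
Proof.
move=> [B fB]; rewrite (_ : f = fun x => \sum_k (B *m blk_mx l x) k k).
  by apply: cts_sum => k; exact: (ctsmx_mul (ctsmx_cst B) (@cts_blk_mx l) k k).
by apply/funext => x; rewrite fB.
Qed.

Lemma coefs_koopman l : stable_under (@koopman R G X) (coefs l).
Proof.
move=> t f [B fB]; exists (B *m blk l t^-1%g) => x.
by rewrite /koopman fB blk_mx_act mulmxA.
Qed.

Lemma coefs_findim l : findim (coefs l).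
Proof.
set N := rep_dim (blk l).
exists (N * N)%N, (fun k (x : X) => blk_mx l x (mxtens_unindex k).2 (mxtens_unindex k).1).
apply/seteqP; split=> [f [B fB]|_ [a _ <-]].
  exists (fun k => B (mxtens_unindex k).1 (mxtens_unindex k).2) => //.
  apply/funext => x; rewrite fct_sumE fB sum_mxtens; apply: eq_bigr => i _.
  by rewrite mxE; apply: eq_bigr => j _; rewrite -[LHS]/(_ * _) mxtens_indexK.
exists (\matrix_(i, j) a (mxtens_index (i, j))) => x.
rewrite fct_sumE sum_mxtens; apply: eq_bigr => i _.
by rewrite mxE; apply: eq_bigr => j _; rewrite -[LHS]/(_ * _) mxtens_indexK mxE.
Qed.

Lemma coefs_linsubspace l : linsubspace (coefs l).
Proof.
by apply/linsubspaceP; split; [exact: coefs0|move=> a u v; exact: coefs_lin].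
Qed.

(** The representative functions on the compactification: a linear space in
    general, and an algebra when S is closed under the components of tensor
    products. *)
Definition repfun : set (X -> C) := [set f | exists l, coefs l f].

Lemma repfun_cst c : repfun (fun=> c).
Proof. by exists [::]; apply/coefs_nil; exists c. Qed.

Lemma repfunD f g : repfun f -> repfun g -> repfun (fun x => f x + g x).
Proof. by move=> [l1 fl] [l2 gl]; exists (l1 ++ l2); exact: coefs_cat. Qed.

Lemma repfunZ a f : repfun f -> repfun (fun x => a * f x).
Proof.
move=> [l fl]; exists l.
rewrite (_ : (fun x => _) = a *: f + (fun=> 0)); first by apply: coefs_lin => //; exact: coefs0.
by apply/funext => x; rewrite -[RHS]/(a * f x + 0) addr0.
Qed.

Lemma repfun_sum (I : Type) (r : seq I) (F : I -> X -> C) :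
  (forall i, repfun (F i)) -> repfun (fun x => \sum_(i <- r) F i x).
Proof.
move=> AF; elim: r => [|i r IH].
  rewrite (_ : (fun x => _) = fun=> 0); first exact: repfun_cst.
  by apply/funext => x; rewrite big_nil.
rewrite (_ : (fun x => _) = fun x => F i x + \sum_(j <- r) F j x); first exact: repfunD.
by apply/funext => x; rewrite big_cons.
Qed.

Lemma repfun_entry i a b : repfun (fun x => bmx x i a b).
Proof.
exists [:: i]; apply/coefs_cons; exists (delta_mx b a), (fun=> 0); split; first exact: coefs0.
by move=> x; rewrite addr0 tr_delta_mul.
Qed.

Lemma repfun_ind (P : (X -> C) -> Prop) :
  (forall c, P (fun=> c)) -> (forall i a b, P (fun x => bmx x i a b)) ->
  (forall f g, P f -> P g -> P (fun x => f x + g x)) ->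
  (forall c f, P f -> P (fun x => c * f x)) -> forall f, repfun f -> P f.
Proof.
move=> Pc Pe PD PZ f [l]; elim: l f => [|i l IH] f.
  move=> /coefs_nil[c fc]; rewrite (_ : f = fun=> c) //; exact/funext.
move=> /coefs_cons[B [g [/IH Pg fB]]].
have Psum (I : Type) (r : seq I) (F : I -> X -> C) :
  (forall i, P (F i)) -> P (fun x => \sum_(i <- r) F i x).
  move=> AF; elim: r => [|j r IHr].
    by rewrite (_ : (fun x => _) = fun=> 0) //; apply/funext => x; rewrite big_nil.
  rewrite (_ : (fun x => _) = fun x => F j x + \sum_(k <- r) F k x); first exact: PD.
  by apply/funext => x; rewrite big_cons.
rewrite (_ : f = fun x => \sum_a \sum_b B a b * bmx x i b a + g x).
  apply: PD => //; apply: (Psum) => a; apply: (Psum) => b; apply: PZ; exact: Pe.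
by apply/funext => x; rewrite fB; congr (_ + _); apply: eq_bigr => a _; rewrite mxE.
Qed.

End BohrRotation.

(** * The rotation attached to a grouplike set *)

Section GrouplikeRotation.
Context {R : realType} {G : topologicalGroupType}.
Local Notation C := (Cplx R).
Variable sigma : set (set (fdrep R G)).
Hypothesis sg : grouplike sigma.

Definition sigma_irr : set (fdrep R G) := [set pi | irreducible pi /\ sigma (rclass pi)].
Local Notation S := sigma_irr.
Local Notation X := (rotation (bohr_compactification S)).
Local Notation bmx := (@bohr_mx R G S).
Local Notation bof := (@bohr_of R G S).

Lemma component_subrep (pi : fdrep R G) (c : component pi) :
  isom_to_subrep (@fdact _ _ c) setT (@fdact _ _ pi).
Proof.
exists (range (mulmx (comp_in c) : 'cV_(rep_dim c) -> 'cV_(rep_dim pi))); split => //.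
- apply/linsubspaceP; split=> [|a _ _ [u _ <-] [v _ <-]].
    by exists 0 => //; rewrite mulmx0.
  by exists (a *: u + v) => //; rewrite mulmxDr -scalemxAr.
- by move=> t _ [v _ <-]; exists (c t *m v) => //; rewrite /fdact !mulmxA comp_inE.
exists (mulmx (comp_in c)); split => // [u v /= uv|t v].
  by rewrite -[u]mul1mx -[v]mul1mx -(comp_outK c) -!mulmxA uv.
by rewrite /fdact /= !mulmxA comp_inE.
Qed.

Definition sigma_index (pi : fdrep R G) (p : irreducible pi) (q : sigma (rclass pi))
  (u : unitary_rep pi) : uindex S := exist _ pi (conj (conj p q) u).

Lemma index_irr (i : uindex S) : irreducible (sval i).
Proof. by case: (svalP i) => -[]. Qed.
Lemma index_sigma (i : uindex S) : sigma (rclass (sval i)).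
Proof. by case: (svalP i) => -[]. Qed.
Lemma index_unitary (i : uindex S) : unitary_rep (sval i).
Proof. by case: (svalP i). Qed.

Lemma sigma_irreducible pi : sigma (rclass pi) -> irreducible pi.
Proof.
case: sg => sd _ _ _ /sd[rho irho /rclass_eq h]; exact: irreducible_iso irho.
Qed.

Lemma tens_sigma (i j : uindex S) (c : component (tens_rep (sval i) (sval j))) :
  sigma (rclass c).
Proof.
case: sg => _ st _ _; apply: (st _ _ (index_sigma i) (index_sigma j)).
exists (comp_rep c) => //; split; first exact: comp_irr.
exact: component_subrep.
Qed.

Definition tens_index (i j : uindex S) (c : component (tens_rep (sval i) (sval j))) :
  uindex S := sigma_index (comp_irr c) (tens_sigma c) (@comp_unitary _ _ _ c).

Lemma repfun_sandwich (i : uindex S) m n (A : 'M[C]_(m, rep_dim (sval i))) (B : 'M[C]_(rep_dim (sval i), n)) k l :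
  repfun (fun x : X => (A *m bmx x i *m B) k l).
Proof.
rewrite (_ : (fun x => _) = fun x => \sum_q \sum_p (B q l * A k p) * bmx x i p q).
  by do 2![apply: repfun_sum => ?]; apply: repfunZ; exact: repfun_entry.
apply/funext => x; rewrite [LHS]mxE; apply: eq_bigr => q _.
rewrite [X in X * _]mxE mulr_suml; apply: eq_bigr => p _.
by rewrite [LHS]mulrC mulrA.
Qed.

Lemma repfun_cts f : repfun (S := S) f -> continuous f.
Proof. by move=> [l]; exact: coefs_cts. Qed.

(** Both sides are continuous, so it is enough to compare them on G, where the
    product is an entry of the tensor product, which decomposes into
    components with class in sigma. *)
Lemma repfun_entryM i j a b a' b' : repfun (fun x : X => bmx x i a b * bmx x j a' b').
Proof.
have [l lE] := decomposition (tens_rep (sval i) (sval j)).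
pose g (x : X) := \sum_(c <- l) (comp_in c *m bmx x (tens_index c) *m comp_out c)
   (mxtens_index (a, a')) (mxtens_index (b, b')).
have Ag : repfun g by apply: repfun_sum => c; exact: repfun_sandwich.
rewrite (_ : (fun x => _) = g) //; apply/funext.
apply: (@bohr_eq_fun R G S).
- by apply: ctsM; apply: repfun_cts; exact: repfun_entry.
- exact: repfun_cts.
move=> t; rewrite /g !bohr_mx_of.
have -> : sval i t a b * sval j t a' b' =
    tens_rep (sval i) (sval j) t (mxtens_index (a, a')) (mxtens_index (b, b')).
  by rewrite tensmxE.
rewrite -[X in fun_of_matrix X]mulmx1 -lE mulmx_sumr summxE; apply: eq_bigr => c _.
by rewrite bohr_mx_of mulmxA comp_inE.
Qed.

Lemma repfunM f g : repfun (S := S) f -> repfun (S := S) g -> repfun (fun x : X => f x * g x).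
Proof.
move=> Af Ag; move: f Af.
apply: (@repfun_ind R G S (fun f => repfun (fun x : X => f x * g x))) => [c|i a b|f1 f2 A1 A2|c f Af].
- exact: repfunZ.
- move: g Ag.
  apply: (@repfun_ind R G S (fun g => repfun (fun x : X => bmx x i a b * g x))) => [c|j a' b'|f1 f2 A1 A2|c f Af].
  + rewrite (_ : (fun x => _) = fun x : X => c * bmx x i a b).
      by apply: repfunZ; exact: repfun_entry.
    by apply/funext => x; rewrite mulrC.
  + exact: repfun_entryM.
  + rewrite (_ : (fun x => _) = fun x : X => bmx x i a b * f1 x + bmx x i a b * f2 x).
      exact: repfunD.
    by apply/funext => x; rewrite mulrDr.
  + rewrite (_ : (fun x => _) = fun x : X => c * (bmx x i a b * f x)).
      exact: repfunZ.
    by apply/funext => x; rewrite mulrCA.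
- rewrite (_ : (fun x => _) = fun x : X => f1 x * g x + f2 x * g x).
    exact: repfunD.
  by apply/funext => x; rewrite mulrDl.
- rewrite (_ : (fun x => _) = fun x : X => c * (f x * g x)).
    exact: repfunZ.
  by apply/funext => x; rewrite mulrA.
Qed.

Lemma conj_sigma (i : uindex S) : sigma (rclass (conj_rep (sval i))).
Proof. by case: sg => _ _ sc _; apply: sc; exact: index_sigma. Qed.

Lemma conj_unitary (i : uindex S) : unitary_rep (conj_rep (sval i)).
Proof.
move=> t; rewrite [conj_rep _ _]/(map_mx _ _) /adj map_trmx -map_mxM.
by rewrite -[X in _ *m X]/(adj (sval i t)) index_unitary map_mx1.
Qed.

Definition conj_index (i : uindex S) : uindex S :=
  sigma_index (sigma_irreducible (conj_sigma i)) (conj_sigma i) (@conj_unitary i).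

Lemma repfun_conj f : repfun (S := S) f -> repfun (fun x : X => (f x)^*).
Proof.
move: f; apply: (@repfun_ind R G S (fun f => repfun (fun x : X => (f x)^*))) => [c|i a b|f1 f2 A1 A2|c f Af].
- exact: repfun_cst.
- rewrite (_ : (fun x => _) = fun x : X => bmx x (conj_index i) a b).
    exact: repfun_entry.
  apply/funext; apply: (@bohr_eq_fun R G S).
  + by apply: cts_conj; apply: repfun_cts; exact: repfun_entry.
  + by apply: repfun_cts; exact: repfun_entry.
  by move=> t; rewrite !bohr_mx_of [RHS]mxE.
- rewrite (_ : (fun x => _) = fun x : X => (f1 x)^* + (f2 x)^*); first exact: repfunD.
  by apply/funext => x; rewrite rmorphD.
- rewrite (_ : (fun x => _) = fun x : X => c^* * (f x)^*); first exact: repfunZ.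
  by apply/funext => x; rewrite rmorphM.
Qed.

Lemma repfun_dense (f : X -> C) (e : R) : continuous f -> 0 < e ->
  exists2 g, repfun (S := S) g & forall x, nsq (f x - g x) < e.
Proof.
move=> fc e0; apply: (@stone_weierstrass R X (@phase_compact _ X) (repfun (S := S)) _ _ _ _ _ _ f e fc e0).
- exact: repfun_cts.
- exact: repfun_cst.
- exact: repfunD.
- exact: repfunM.
- exact: repfun_conj.
move=> x y /eqP xy.
have [i [a [b h]]] : exists i a b, bmx x i a b <> bmx y i a b.
  apply: contrapT => h; apply: xy; apply: bohr_inj => i; apply/matrixP => a b.
  by apply: contrapT => hab; apply: h; exists i, a, b.
by exists (fun z => bmx z i a b) => //; exact: repfun_entry.
Qed.

Lemma rotation_discrete_spectrum : @discrete_spectrum R G X.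
Proof.
move=> f fc N /uniform_nbhs[E [+ EN]]; rewrite -entourage_ballE => -[e /= e0 eE].
have [r r0 er] := gt0_realC e0.
have [g [l gl] fg] := repfun_dense fc (exprn_gt0 2 r0).
exists g; split.
  exists (coefs l) => //; split.
  - exact: coefs_cts.
  - exact: coefs_linsubspace.
  - exact: coefs_findim.
  - exact: coefs_koopman.
apply: EN => y _; apply: eE; rewrite /= -ball_normE /= er norm_ltr ?(ltW r0) //.
Qed.

(** Both blocks of T are intertwiners; a nonzero one would make rho isomorphic
    to a member of sigma. *)
Lemma blk_intertwiner rho l (T : 'M[C]_(rep_dim rho, rep_dim (blk l))) :
  irreducible rho -> ~ sigma (rclass rho) ->
  (forall t, T *m @blk R G S l t = rho t *m T) -> T = 0.
Proof.
move=> irho nrho; elim: l T => [|i l IH] T Tt.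
  apply: contrapT => T0; apply: nrho.
  have /rclass_eq <- := schur_iso triv_irreducible irho Tt T0.
  by case: sg.
rewrite -[T]hsubmxK.
have Tt' t : row_mx (lsubmx T *m sval i t) (rsubmx T *m blk l t) =
    row_mx (rho t *m lsubmx T) (rho t *m rsubmx T).
  rewrite -mul_mx_row hsubmxK -(Tt t) -{3}[T]hsubmxK /= mul_row_block.
  by rewrite !mulmx0 addr0 add0r.
have -> : rsubmx T = 0 by apply: IH => t; case/eq_row_mx: (Tt' t).
suff -> : lsubmx T = 0 by rewrite row_mx0.
apply: contrapT => T0; apply: nrho.
have h t : lsubmx T *m sval i t = rho t *m lsubmx T by case/eq_row_mx: (Tt' t).
have /rclass_eq <- := schur_iso (index_irr i) irho h T0.
exact: index_sigma.
Qed.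

Lemma common_coefs (I : eqType) (s : seq I) (g : I -> X -> C) :
  (forall k, repfun (S := S) (g k)) -> exists l, forall k, k \in s -> coefs (S := S) l (g k).
Proof.
move=> Ag; elim: s => [|k s [l sl]]; first by exists [::].
have [lk gk] := Ag k; exists (lk ++ l) => k'; rewrite inE => /predU1P[->|k's].
  rewrite (_ : g k = fun x => g k x + 0); first by apply: coefs_cat => //; exact: coefs0.
  by apply/funext => x; rewrite addr0.
rewrite (_ : g k' = fun x => 0 + g k' x); first by apply: coefs_cat; [exact: coefs0|exact: sl].
by apply/funext => x; rewrite add0r.
Qed.

(** The mean inequality |z w| <= |z|^2 / 4 + |w|^2, in the form in which the
    error of an approximation of conj z is absorbed by |z|^2. *)
Lemma Re_mul_ge (z w : C) : - (nsq z / 4 + nsq w) <= complex.Re (z * w).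
Proof.
rewrite cReM /nsq.
have := sqr_ge0 (complex.Re z / 2 + complex.Re w).
have := sqr_ge0 (complex.Im z / 2 - complex.Im w).
by nra.
Qed.

(** Let j be an equivariant row of type rho.  Its squared length is constant by
    ergodicity, say c > 0.  Approximate each conj(j k) by a representative
    function g k.  On G, the sum of the j k * g k is a linear combination of
    products of entries of conj(rho) and of members of sigma, with real part at
    least c / 2.  If rho were not in sigma, there would be no intertwiners, and
    [disjoint_mean_le0] would be contradicted. *)
Lemma unitary_mult_sigma rho : irreducible rho -> unitary_rep rho ->
  (0 < multiplicity X rho)%E -> sigma (rclass rho).
Proof.
move=> irho rhou /(mult_gt0P _ irho)[j [[jc jt] [x0 jx0]]].
apply: contrapT => nrho.
have jj x : j x *m adj (j x) = j x0 *m adj (j x0).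
  apply: (ergodic_mx (@bohr_ergodic R G S) (F := fun x => j x *m adj (j x))) => [|t z].
    exact: (ctsmx_mul jc (ctsmx_adj jc)).
  by rewrite jt adjM mulmxA -(mulmxA (j z)) rhou mulmx1.
pose c := fro (j x0).
have c0 : 0 < c.
  by rewrite lt_neqAle fro_ge0 andbT eq_sym; apply/eqP => /fro_eq0.
have froj x : \sum_k nsq (j x 0 k) = c.
  transitivity (fro (j x)); first by rewrite /fro big_ord1.
  by apply: (@complexI R); rewrite -!tr_mul_adj jj.
pose d := (rep_dim rho)%:R : R.
have d0 : 0 < d by rewrite ltr0n; exact: irho.1.
have e0 : 0 < c / (4 * d) by rewrite divr_gt0 // mulr_gt0.
have /choice[g gP] k : exists g, repfun (S := S) g /\ forall x, nsq ((j x 0 k)^* - g x) < c / (4 * d).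
  have [g Ag gP] := repfun_dense (cts_conj (jc 0 k)) e0.
  by exists g.
have [l lg] := common_coefs (enum 'I_(rep_dim rho)) (fun k => (gP k).1).
have /choice[B BP] k : exists B, forall x, g k x = \tr (B *m blk_mx l x).
  by apply: lg; rewrite mem_enum.
pose j0 := j (bof 1%g).
pose ell (A : 'M[C]_(rep_dim rho * rep_dim (@blk R G S l))) : C :=
  \sum_k \sum_a \sum_p \sum_q j0 0 a * B k p q * A (mxtens_index (k, q)) (mxtens_index (a, p)).
have ell_lin : linear_for *%R ell.
  move=> u M N; rewrite /ell mulr_sumr -big_split; apply: eq_bigr => k _ /=.
  rewrite mulr_sumr -big_split; apply: eq_bigr => a _ /=.
  rewrite mulr_sumr -big_split; apply: eq_bigr => p _ /=.
  rewrite mulr_sumr -big_split; apply: eq_bigr => q _ /=.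
  by rewrite !mxE mulrDr mulrCA.
have ellE t : ell (tens_rep (conj_rep rho) (blk l) t) =
    \sum_k j (bof t) 0 k * g k (bof t).
  apply: eq_bigr => k _; rewrite BP blk_mx_of -bohr_act_one jt -unitary_inv //.
  rewrite mxE mulr_suml; apply: eq_bigr => a _.
  rewrite /mxtrace mulr_sumr; apply: eq_bigr => p _.
  rewrite [X in _ = _ * X]mxE mulr_sumr; apply: eq_bigr => q _.
  rewrite tensmxE !mxE -!mulrA; congr (_ * _).
  exact: mulrCA.
have : c / 2 <= 0.
  apply: (@disjoint_mean_le0 R G rho (blk l) ell (c / 2) (@blk_unitary R G S l)) => //.
    by move=> T; exact: blk_intertwiner.
  move=> t; rewrite ellE; set x := bof t.
  have sumRe (F : 'I_(rep_dim rho) -> C) : complex.Re (\sum_k F k) = \sum_k complex.Re (F k).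
    by elim/big_rec2: _ => // k u v _ <-; rewrite cReD.
  rewrite sumRe.
  apply: (@le_trans _ _ (\sum_k (nsq (j x 0 k) - nsq (j x 0 k) / 4 - c / (4 * d)))).
    have cd : \sum_(k < rep_dim rho) c / (4 * d) = c / 4.
      by rewrite sumr_const card_ord -[LHS]mulr_natl -/d; field; rewrite gt_eqF.
    by rewrite !sumrB -mulr_suml froj cd; lra.
  apply: ler_sum => k _.
  have -> : j x 0 k * g k x = j x 0 k * (j x 0 k)^* + j x 0 k * (g k x - (j x 0 k)^*).
    by rewrite -mulrDr addrC subrK.
  have /ltW := (gP k).2 x.
  have -> : nsq ((j x 0 k)^* - g k x) = nsq (g k x - (j x 0 k)^*).
    by rewrite /nsq !cReD !cImD !cReN !cImN; ring.
  have := Re_mul_ge (j x 0 k) (g k x - (j x 0 k)^*).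
  have -> : j x 0 k * (j x 0 k)^* = (nsq (j x 0 k))%:C%C by rewrite nsqE normCK.
  by rewrite cReD /=; lra.
by rewrite leNgt divr_gt0.
Qed.

Lemma rotation_mult_sigma pi : irreducible pi -> (0 < multiplicity X pi)%E ->
  sigma (rclass pi).
Proof.
move=> ipi; have [rho [rhou h]] := unitary_representative pi.
rewrite (multiplicity_iso _ h) => m0; have /rclass_eq -> := h.
exact: (unitary_mult_sigma (irreducible_iso h ipi)).
Qed.

Lemma rotation_mult pi : sigma (rclass pi) -> multiplicity X pi = (rep_dim pi)%:R%:E.
Proof.
move=> spi; have [rho [rhou h]] := unitary_representative pi.
have irho := irreducible_iso h (sigma_irreducible spi).
have srho : sigma (rclass rho) by have /rclass_eq <- := h.
rewrite (multiplicity_iso _ h) (bohr_mult (i := sigma_index irho srho rhou)) //=.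
have [A [B [AB BA _]]] := isomorphic_mx h.
congr (_%:R%:E); apply/eqP; rewrite eqn_leq.
by rewrite (mulmx1_min AB) (mulmx1_min BA).
Qed.

Lemma rotation_point_spectrum : point_spectrum R X = sigma.
Proof.
apply/seteqP; split=> [_ [pi [ipi m0] <-]|s ss].
  exact: rotation_mult_sigma.
have [pi ipi e] : group_dual R G s by case: sg => sd _ _ _; exact: sd.
exists pi => //; split => //; rewrite rotation_mult ?e // lte_fin ltr0n.
exact: ipi.1.
Qed.

Lemma rotation_normal : normal_tds R X.
Proof.
split.
- exact: rotation_discrete_spectrum.
- by rewrite rotation_point_spectrum.
move=> pi ipi; have [spi|nspi] := pselect (sigma (rclass pi)).
  by right; exact: rotation_mult.
left; apply/eqP; rewrite eq_le; apply/andP; split.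
  by rewrite leNgt; apply/negP => /(rotation_mult_sigma ipi).
exact: (embeds_le_mult (embeds0 pi X)).
Qed.

End GrouplikeRotation.

(** * Frames identify a system with a rotation *)

Section CompactHausdorff.
Context {R : realType}.
Local Notation C := (Cplx R).

Lemma compact_hausdorff_separation (T : topologicalType) (x y : T) :
  compact [set: T] -> hausdorff_space T -> x <> y ->
  exists f : T -> R, [/\ continuous f, f x = 0 & f y = 1].
Proof.
move=> Tc Th xy.
have cl1 (z : T) : closed [set z] by exact: (compact_closed Th (@compact_set1 T z)).
have xy0 : [set x] `&` [set y] = set0.
  by apply/seteqP; split=> // z [/= -> /xy].
have := (@normal_separatorP R T).1 (compact_normal Th Tc) _ _ (cl1 x) (cl1 y) xy0.
move=> /(@uniform_separatorP T R).
case=> f [fc _ fx fy]; exists f; split => //.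
  by apply: fx; exists x.
by apply: fy; exists y.
Qed.

Lemma compact_hausdorff_inverse (T U : topologicalType) (q : T -> U) (r : U -> T) :
  compact [set: T] -> hausdorff_space U -> continuous q -> cancel q r -> cancel r q ->
  continuous r.
Proof.
move=> Tc Uh qc qr rq; apply/continuous_closedP => A clA.
have -> : r @^-1` A = q @` A.
  apply/seteqP; split=> [u Au|_ [x Ax <-]]; first by exists (r u).
  by rewrite /= qr.
apply: (compact_closed Uh); apply: continuous_compact; first exact: continuous_subspaceT.
exact: subclosed_compact clA Tc _.
Qed.

End CompactHausdorff.

Section Fro.
Context {R : realType}.
Local Notation C := (Cplx R).

Lemma fro0 m n : fro (0 : 'M[C]_(m, n)) = 0.
Proof. by rewrite /fro big1 // => i _; rewrite big1 // => j _; rewrite mxE nsq0. Qed.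

(** Unlike the version with constant 2, this nearly subadditive form gives
    continuity of functions built from [fro] when e tends to 0. *)
Lemma nsqD_weighted (e : R) (z w : C) : 0 < e ->
  nsq (z + w) <= (1 + e) * nsq z + (1 + e^-1) * nsq w.
Proof.
move=> e0; rewrite /nsq cReD cImD.
have key (a b : R) : (a + b) ^+ 2 <= (1 + e) * a ^+ 2 + (1 + e^-1) * b ^+ 2.
  rewrite -subr_ge0.
  have -> : (1 + e) * a ^+ 2 + (1 + e^-1) * b ^+ 2 - (a + b) ^+ 2 = e^-1 * (e * a - b) ^+ 2.
    by field; rewrite gt_eqF.
  by rewrite mulr_ge0 ?sqr_ge0 // invr_ge0 ltW.
have := key (complex.Re z) (complex.Re w); have := key (complex.Im z) (complex.Im w).
by lra.
Qed.

Lemma froD_weighted m n (e : R) (A B : 'M[C]_(m, n)) : 0 < e ->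
  fro (A + B) <= (1 + e) * fro A + (1 + e^-1) * fro B.
Proof.
move=> e0; rewrite /fro !mulr_sumr -big_split ler_sum // => i _ /=.
rewrite !mulr_sumr -big_split ler_sum // => j _ /=.
by rewrite mxE nsqD_weighted.
Qed.

Lemma fro_mul_unitary m n (U : 'M[C]_m) (A : 'M[C]_(m, n)) :
  U *m adj U = 1%:M -> fro (U *m A) = fro A.
Proof.
move=> U1; apply: (@complexI R); rewrite -!tr_mul_adj adjM mxtrace_mulC -mulmxA.
by rewrite (mulmxA (adj U)) (mulmx1C U1) mul1mx mxtrace_mulC.
Qed.

Lemma fro_unitary m (U : 'M[C]_m) : U *m adj U = 1%:M -> fro U = m%:R.
Proof.
by move=> U1; apply: (@complexI R); rewrite -tr_mul_adj U1 mxtrace1 rmorph_nat.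
Qed.

Lemma cts_fro (T : topologicalType) m n (F : T -> 'M[C]_(m, n)) :
  ctsmx F -> continuous (fun x => fro (F x)).
Proof.
move=> Fc x; apply: cvg_big => [|i _]; first exact: add_continuous.
apply: cvg_big => [|j _]; first exact: add_continuous.
by apply: cvgD; apply: cvgM; (exact: (cts_Re (Fc i j)) || exact: (cts_Im (Fc i j))).
Qed.

End Fro.

Section NormalSystems.
Context {R : realType} {G : topologicalGroupType}.
Local Notation C := (Cplx R).

(** The boxes given by finitely many coordinates and a radius form a
    neighbourhood base of x, in which it is enough to approximate. *)
Lemma uset_box (S : set (fdrep R G)) (x : uprod S) :
  (forall (l : seq (uindex S)) (e : R), 0 < e ->
     exists t, \sum_(i <- l) fro (umx x i - sval i t) < e) -> uset x.
Proof.
move=> box; rewrite /uset closureEcvg.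
pose D (le : seq (uindex S) * R) := 0 < le.2.
pose P (le : seq (uindex S) * R) : set (uprod S) :=
  [set y | range (@uorbit R G S) y /\ \sum_(i <- le.1) fro (umx x i - umx y i) < le.2].
have PF : ProperFilter (filter_from D P).
  apply: filter_from_proper.
    apply: filter_from_filter; first by exists ([::], 1); exact: ltr01.
    move=> [l1 e1] [l2 e2] /= d1 d2; exists (l1 ++ l2, Num.min e1 e2).
      by rewrite /D /= lt_min; apply/andP; split.
    have ge0 l (y : uprod S) : 0 <= \sum_(i <- l) fro (umx x i - umx y i).
      by apply: sumr_ge0 => i _; exact: fro_ge0.
    move=> y [yr]; rewrite /= big_cat lt_min => /andP[y1 y2]; split; split => //=.
      by apply: le_lt_trans y1; rewrite lerDl.
    by apply: le_lt_trans y2; rewrite lerDr.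
  move=> [l e] /= e0; have [t tP] := box l e e0.
  exists (@uorbit R G S t); split; first by exists t.
  by apply: le_lt_trans tP; apply: ler_sum => i _; rewrite umxK.
exists (filter_from D P) => //; split.
  apply/cvg_sup => -[i [a b]] U [_ [[W oW <-] Wx]] /filterS; apply.
  have /nbhs_ballP[e e0 eW] : nbhs (x (existT _ i (a, b))) W by exact: open_nbhs_nbhs.
  have [r r0 er] := gt0_realC e0.
  exists ([:: i], r ^+ 2); first exact: exprn_gt0.
  move=> y [_ /=]; rewrite big_seq1 => yr; apply: eW.
  rewrite -ball_normE /= er norm_ltr ?(ltW r0) //; apply: le_lt_trans yr.
  by have := nsq_le_fro (umx x i - umx y i) a b; rewrite !mxE.
by move=> A rA; exists ([::], 1); [exact: ltr01|move=> y [yr _]; exact: rA].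
Qed.

Variable X : tds G.
Hypothesis eX : ergodic (R := R) X.
Variable x0 : X.
Variable S : set (fdrep R G).
Variable F : forall i : uindex S, X -> 'M[C]_(rep_dim (sval i)).
Hypothesis FP : forall i, frame (F i) /\ F i x0 = 1%:M.

Let iu (i : uindex S) : unitary_rep (sval i). Proof. by case: (svalP i). Qed.

Let E (i : uindex S) (x : X) := adj (F i x).

Let E0 i : E i x0 = 1%:M.
Proof. by rewrite /E (FP i).2 adjmx1. Qed.

Let Eu i x : E i x *m adj (E i x) = 1%:M.
Proof. by rewrite /E adjK; exact: frame_adjK (FP i).1. Qed.

Let Et i t x : E i (tds_act t x) = sval i t *m E i x.
Proof.
by case: (FP i) => -[[_ Ft] _] _; rewrite /E Ft adjM unitary_inv // invgK.
Qed.

Let Ec i : ctsmx (E i).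
Proof. by case: (FP i) => -[[Fc _] _] _; exact: (ctsmx_adj Fc). Qed.

(** The distance f(y) from (E i y) to the points (sval i t), t in G, is
    invariant because each sval i s acts isometrically; it is continuous, so it
    is constant by ergodicity, and it vanishes at x0, where E i x0 = 1. *)
Lemma orbit_approximation (l : seq (uindex S)) (e : R) x : 0 < e ->
  exists t, \sum_(i <- l) fro (E i x - sval i t) < e.
Proof.
move=> e0.
pose h t y := \sum_(i <- l) fro (E i y - sval i t).
have h0 t y : 0 <= h t y by apply: sumr_ge0 => i _; exact: fro_ge0.
pose D : R := \sum_(i <- l) 4 * (rep_dim (sval i))%:R.
have hD t y : h t y <= D.
  apply: ler_sum => i _; apply: (le_trans (froD_le _ _)); rewrite froN.
  by rewrite !fro_unitary ?iu //; lra.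
pose f y := inf [set h t y | t in [set: G]].
have hi y : has_inf [set h t y | t in [set: G]].
  by split; [exists (h 1%g y), 1%g|exists 0 => _ [t _ <-]].
have f_le t y : f y <= h t y by apply: ge_inf; [case: (hi y)|exists t].
have f_ge y c : (forall t, c <= h t y) -> c <= f y.
  by move=> ch; apply: lb_le_inf; [case: (hi y)|move=> _ [t _ <-]].
have hs s t y : h t (tds_act s y) = h (s^-1 * t)%g y.
  apply: eq_bigr => i _; rewrite Et.
  have -> : sval i s *m E i y - sval i t = sval i s *m (E i y - sval i (s^-1 * t)%g).
    by rewrite mulmxBr -repM mulgA mulgV mul1g.
  by rewrite fro_mul_unitary // iu.
have fs s y : f (tds_act s y) = f y.
  apply/eqP; rewrite eq_le; apply/andP; split; apply: f_ge => t.
    by have := f_le (s * t)%g (tds_act s y); rewrite hs mulgA mulVg mul1g.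
  by rewrite hs; exact: f_le.
have D0 : 0 <= D by apply: sumr_ge0 => i _; rewrite mulr_ge0 // ler0n.
have fc : continuous f.
  move=> y; apply/cvgrPdist_le => d d0.
  (* h t z1 <= (1 + n) h t z2 + (1 + n^-1) c, where n D and (1 + n^-1) c are at
     most d / 2: moving from z2 to z1 costs at most d. *)
  pose n := d / (2 * (D + 1)).
  have D1 : 0 < D + 1 by rewrite ltr_wpDl.
  have n0 : 0 < n by rewrite divr_gt0 // mulr_gt0.
  have nD : n * D <= d / 2.
    by rewrite /n invfM mulrA mulrAC ler_pdivrMr // mulrC -[leRHS]mulrC ler_wpM2r ?ler_wpDr // divr_ge0 // ltW.
  pose c := d / (2 * (1 + n^-1)).
  have n1 : 0 < 1 + n^-1 by rewrite ltr_pwDl // invr_ge0 ltW.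
  have c0 : 0 < c by rewrite divr_gt0 // mulr_gt0.
  have nc : (1 + n^-1) * c = d / 2.
    by rewrite /c; move: n1; move: (1 + n^-1) => m m0; field; rewrite gt_eqF.
  have near_y : \forall z \near y, \sum_(i <- l) fro (E i y - E i z) < c.
    have : \sum_(i <- l) fro (E i y - E i z) @[z --> y] -->
        (\sum_(i <- l) fro (E i y - E i y) : R).
      apply: cvg_big => [|i _]; first exact: add_continuous.
      have dc : ctsmx (fun z => E i y - E i z).
        move=> a b; have -> : (fun z => (E i y - E i z) a b) = (fun z => E i y a b - E i z a b).
          by apply/funext => z; rewrite !mxE.
        by move=> z; apply: cvgB; [exact: cvg_cst|exact: Ec].
      exact: (@cts_fro R X _ _ _ dc y).
    have -> : \sum_(i <- l) fro (E i y - E i y) = 0.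
      by rewrite big1 // => i _; rewrite subrr fro0.
    move=> /cvgrPdist_lt/(_ _ c0); apply: filterS => z; rewrite sub0r normrN ger0_norm //.
    by apply: sumr_ge0 => i _; exact: fro_ge0.
  have cmp z1 z2 : \sum_(i <- l) fro (E i z1 - E i z2) < c -> f z1 - d <= f z2.
    move=> z12; apply: f_ge => t.
    have : h t z1 <= (1 + n) * h t z2 + (1 + n^-1) * \sum_(i <- l) fro (E i z1 - E i z2).
      rewrite /h !mulr_sumr -big_split; apply: ler_sum => i _ /=.
      have -> : E i z1 - sval i t = (E i z2 - sval i t) + (E i z1 - E i z2).
        by rewrite [RHS]addrC addrA subrK.
      exact: froD_weighted.
    have := f_le t z1; have := hD t z2.
    have : (1 + n^-1) * (\sum_(i <- l) fro (E i z1 - E i z2)) <= d / 2.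
      by rewrite -nc ler_pM2l // ltW.
    have : n * h t z2 <= n * D by rewrite ler_pM2l.
    by rewrite mulrDl mul1r; lra.
  apply: filterS near_y => z yz.
  have := cmp y z yz; have := cmp z y _.
  rewrite ler_norml => /(_ _) h1 h2.
  have {}h1 : f z - d <= f y.
    apply: h1; rewrite (eq_bigr (fun i => fro (E i y - E i z))) // => i _.
    by rewrite -froN opprB.
  by apply/andP; split; lra.
have fx : f x = 0.
  have : (f x)%:C%C = (f x0)%:C%C :> C.
    by apply: (eX (cts_realC fc)) => t y; rewrite fs.
  move=> /(@complexI R) ->; apply/eqP; rewrite eq_le f_ge // andbT.
  apply: (le_trans (f_le 1%g x0)); rewrite /h big1 // => i _.
  by rewrite E0 rep1 subrr fro0.
have [_ [t _ <-]] := inf_adherent e0 (hi x).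
by rewrite -/(f x) fx add0r; exists t.
Qed.

Let psi (x : X) : uprod S := of_umx (fun i => E i x).

Let psi_uset x : uset (psi x).
Proof.
apply: uset_box => l e e0; have [t tP] := orbit_approximation l x e0.
by exists t; apply: le_lt_trans tP; apply: ler_sum => i _; rewrite umxK.
Qed.

Let q (x : X) : bohr S := to_bohr (@psi_uset x).

Let q_mx x i : bohr_mx (q x) i = E i x.
Proof. exact: umxK. Qed.

Let q_continuous : continuous q.
Proof.
apply: cts_to_bohr => i a b.
by rewrite (_ : (fun x => _) = fun x => E i x a b) ?[RHS]q_mx //; [exact: Ec|apply/funext => x; rewrite q_mx].
Qed.

Let q_act t x : q (tds_act t x) = @rotate G (bohr_compactification S) t (q x).
Proof.
by apply: bohr_inj => i; rewrite q_mx Et -(bohr_mx_of t i) [RHS]bohr_mxM q_mx.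
Qed.

(** The range of q is compact, and contains the dense image of G as the orbit of
    q x0. *)
Let q_surj (y : bohr S) : exists x, q x = y.
Proof.
have qcl : closed (range q).
  apply: (compact_closed (@bohr_hausdorff R G S)).
  apply: continuous_compact; first exact: continuous_subspaceT.
  exact: (@phase_compact _ X).
have : closure (range q) y.
  move=> V /=; rewrite nbhsE => -[U [oU Uy] UV].
  have [z [Uz [t _ zt]]] := @bohr_of_dense R G S U (ex_intro _ y Uy) oU.
  exists (q (tds_act t x0)); split; first by exists (tds_act t x0).
  apply: UV; have -> : q (tds_act t x0) = @bohr_of R G S t; last by rewrite zt.
  by apply: bohr_inj => i; rewrite q_mx Et E0 mulmx1 bohr_mx_of.
by move/(qcl _) => [x _ <-]; exists x.
Qed.

Lemma frames_isom : (forall x y, (forall i, F i x = F i y) -> x = y) ->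
  tds_isom X (rotation (bohr_compactification S)).
Proof.
move=> Finj.
have qi : injective q.
  move=> x y qxy; apply: Finj => i; rewrite -[F i x]adjK -[F i y]adjK.
  by rewrite -[adj (F i x)]q_mx -[adj (F i y)]q_mx qxy.
have [r qr rq] := bij_of_inj_surj qi q_surj.
exists q, r; split => //.
  apply: (compact_hausdorff_inverse (@phase_compact _ X) _ q_continuous qr rq).
  exact: bohr_hausdorff.
Qed.

End NormalSystems.

(** * Normal systems are rotations *)

Section Isomorphism.
Context {R : realType} {G : topologicalGroupType}.
Implicit Types X Y Z : tds G.

Lemma tds_isom_sym X Y : tds_isom X Y -> tds_isom Y X.
Proof.
case=> q [r [qr rq qc rc qt]]; exists r, q; split => // t y.
by apply: (can_inj qr); rewrite qt !rq.
Qed.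

Lemma tds_isom_trans Y X Z : tds_isom X Y -> tds_isom Y Z -> tds_isom X Z.
Proof.
case=> q [r [qr rq qc rc qt]] [q' [r' [qr' rq' qc' rc' qt']]].
exists (q' \o q), (r \o r'); split.
- exact: can_comp.
- exact: can_comp.
- by move=> x; apply: continuous_comp; [exact: qc|exact: qc'].
- by move=> x; apply: continuous_comp; [exact: rc'|exact: rc].
- by move=> t x /=; rewrite qt qt'.
Qed.

Lemma tds_isom_embeds X Y (pi : fdrep R G) n : tds_isom X Y -> embeds n pi X -> embeds n pi Y.
Proof.
move=> /tds_isom_sym[r [q [rq qr rc _ rt]]] /embedsP[F [[Fc Ft] Ff]].
apply/embedsP; exists (F \o r); split.
  split=> [i j y|t y]; last by rewrite /= rt Ft.
  by apply: (@continuous_comp _ _ _ r (fun x => F x i j)); [exact: rc|exact: Fc].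
move=> v v0; apply: Ff => x; rewrite -[RHS](v0 (q x)).
by apply: eq_bigr => k _; rewrite /= qr.
Qed.

Lemma tds_isom_point_spectrum X Y : tds_isom X Y ->
  point_spectrum R X = point_spectrum R Y.
Proof.
move=> XY; rewrite /point_spectrum; congr (_ @` _); apply/seteqP.
have mXY pi : multiplicity X pi = multiplicity Y pi :> \bar R.
  congr ereal_sup; apply/seteqP; split=> _ [n nX <-]; exists n => //.
    exact: tds_isom_embeds nX.
  by apply: tds_isom_embeds nX; exact: tds_isom_sym.
by split=> pi [ipi m0]; split => //; move: m0; rewrite mXY.
Qed.

End Isomorphism.

Section NormalRepresentation.
Context {R : realType} {G : topologicalGroupType}.
Local Notation C := (Cplx R).
Variable X : tds G.
Hypothesis nX : normal_tds R X.
Variable x0 : X.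
Local Notation S := (sigma_irr (point_spectrum R X)).

Let eX : ergodic (R := R) X := normal_ergodic nX.

Lemma normal_frames (i : uindex S) : exists F, frame (X := X) F /\ F x0 = 1%:M :> 'M[C]_(rep_dim (sval i)).
Proof.
case: i => pi [[ipi [rho [irho m0] /rclass_eq h]] piu] /=.
apply: frame_exists => //; apply: mult_eq_embeds.
have [_ _ /(_ pi ipi)[m00|//]] := nX.
by move: m0; rewrite (multiplicity_iso X h) m00 ltxx.
Qed.

(** If the frames agree at x and y, so does every equivariant row of a type in
    the spectrum by [frame_factor], hence every function in a
    finite-dimensional invariant subspace of C(X), and by density every
    continuous function. *)
Lemma frames_separate (F : forall i : uindex S, X -> 'M[C]_(rep_dim (sval i))) :
  (forall i, frame (F i)) -> forall x y, (forall i, F i x = F i y) -> x = y.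
Proof.
move=> Ff x y Fxy; apply: contrapT => xy.
have [f [fc fx fy]] := @compact_hausdorff_separation R X x y
  (@phase_compact _ X) (@phase_hausdorff _ X) xy.
pose g z : C := (f z)%:C%C.
have gc : continuous g by exact: cts_realC.
have [ds _ _] := nX.
have h0 : 0 < 2^-1 :> C by rewrite invr_gt0.
have [w [[W [Wc Wl Wf Ws] Ww] gw]] : exists w, (\bigcup_(W in [set W : set (X -> C) |
      [/\ W `<=` @ctsfun R G X, linsubspace W, findim W & stable_under (@koopman R G X) W]]) W) w /\
    forall z, `|g z - w z| < 2^-1.
  apply: (ds g gc); apply/uniform_nbhs.
  exists [set uv | ball uv.1 (2^-1 : C) uv.2]; split.
    by rewrite -entourage_ballE; exists 2^-1.
  by move=> w /= gw z; have := gw z I; rewrite -ball_normE.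
have [pi [e [[ec et] eW]]] := findim_rep Wc Wl Wf Ws.
have [a wa] := eW w Ww.
suff exy : e x = e y.
  have : `|g x - g y| < 1.
    rewrite (splitr 1) !mul1r; apply: le_lt_trans (ltrD (gw x) (gw y)).
    rewrite [X in _ <= _ + X]distrC -[g x - g y](subrKA (w x)).
    by rewrite {2}(wa x) exy -wa ler_normD.
  by rewrite /g fx fy /= sub0r normrN normr1 ltxx.
have [l lE] := decomposition pi.
suff ec' (c : component pi) : e x *m comp_in c = e y *m comp_in c.
  rewrite -[e x]mulmx1 -[e y]mulmx1 -lE !mulmx_sumr; apply: eq_bigr => c _.
  by rewrite !mulmxA ec'.
pose j z := e z *m comp_in c.
have je : equivariant (pi := c) j.
  split; first exact: (ctsmx_mul ec (ctsmx_cst (comp_in c))).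
  by move=> t z; rewrite /j et -!mulmxA comp_inE.
have [[z jz]|h] := pselect (exists z, j z <> 0); last first.
  have j0 z : j z = 0 by apply: contrapT => jz; apply: h; exists z.
  by rewrite -/(j x) -/(j y) !j0.
have m0 : (0 < multiplicity X c)%E by apply/(mult_gt0P X (comp_irr c)); exists j; split => //; exists z.
have pc : point_spectrum R X (rclass c) by exists (comp_rep c) => //; split => //; exact: comp_irr.
pose i : uindex S := exist _ (comp_rep c) (conj (conj (comp_irr c) pc) (@comp_unitary _ _ _ c)).
rewrite -/(j x) -/(j y) (frame_factor eX (@comp_unitary _ _ _ c) (Ff i) je x x0).
by rewrite (frame_factor eX (@comp_unitary _ _ _ c) (Ff i) je y x0) Fxy.
Qed.

End NormalRepresentation.

Lemma normal_isom_rotation (R : realType) (G : topologicalGroupType) (X : tds G) :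
  normal_tds R X ->
  tds_isom X (rotation (bohr_compactification (sigma_irr (point_spectrum R X)))).
Proof.
move=> nX; have [x0 _] := normal_point nX.
pose F i := projT1 (cid (normal_frames nX x0 i)).
have FP i : frame (F i) /\ F i x0 = 1%:M by exact: projT2 (cid (normal_frames nX x0 i)).
apply: (frames_isom (normal_ergodic nX) FP).
exact: (frames_separate nX x0 (fun i => (FP i).1)).
Qed.

Theorem theorem5p42 (R : realType) (G : topologicalGroupType) :
  [/\ forall X1 X2 : tds G, normal_tds R X1 -> normal_tds R X2 ->
        (tds_isom X1 X2 <-> point_spectrum R X1 = point_spectrum R X2),
      forall sigma : set (set (fdrep R G)), grouplike sigma ->
        exists X : tds G, normal_tds R X /\ point_spectrum R X = sigma &
      forall X : tds G, normal_tds R X ->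
        exists H : group_compactification G, tds_isom X (rotation H)].
Proof.
split.
- move=> X1 X2 n1 n2; split; first exact: tds_isom_point_spectrum.
  move=> e; apply: tds_isom_trans (normal_isom_rotation n1) _.
  by rewrite e; apply: tds_isom_sym; exact: normal_isom_rotation.
- move=> sigma sg; exists (rotation (bohr_compactification (sigma_irr sigma))).
  by split; [exact: rotation_normal|exact: rotation_point_spectrum].
by move=> X nX; eexists; exact: (normal_isom_rotation nX).
Qed.
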